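(* Let $I\subset(0,\infty)$ be an open interval and let $h\in C^\infty(I)$ be a positive function such that $h'''\not\equiv0$ in any (nonempty) open subset of $I$. Then the spacetime $$\left(I\times\mathbb{S}^2\times\mathbb{R},\ \frac{1}{h(r)}dr^2+r^2g_0-h(r)dt^2\right)$$ has exactly two totally umbilic null hypersurfaces through each point.
   Context: $r$ is the coordinate on $I$, $t$ the coordinate on $\mathbb{R}$, and $g_0$ is the canonical metric on the unit sphere $\mathbb{S}^2$. A null hypersurface $L$ of a Lorentzian manifold $(M,g)$ is a hypersurface on which the induced metric is degenerate. Given a nowhere zero null vector field $\xi\in\mathfrak{X}(L)$, the null second fundamental form is $B(X,Y)=-g(\nabla_X\xi,Y)$ for $X,Y\in\partial_t^\perp\cap TL$; $L$ is totally umbilic if $B=\rho g$ for some $\rho\in C^\infty(L)$ (this does not depend on the choice of $\xi$). The count of hypersurfaces through a point is local: hypersurfaces which coincide in a neighborhood of the point are identified. *)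

(* Defs.v *)
From HB Require Import structures.
From mathcomp Require Import all_boot all_order all_algebra.
From mathcomp Require Import all_classical all_reals all_analysis.

Set Implicit Arguments.
Unset Strict Implicit.
Unset Printing Implicit Defensive.

Import Order.TTheory GRing.Theory Num.Theory.
Import numFieldNormedType.Exports.

Local Open Scope classical_set_scope.
Local Open Scope ring_scope.

Section Smoothness.
Context {R : realType} {V W : normedModType R}.

Definition iter_derive (f : V -> W) (vs : seq V) : V -> W :=
  foldr (fun v g => 'D_v g) f vs.

(* C^oo on a neighborhood of x: all iterated directional derivatives exist and
   are Frechet differentiable there. *)
Definition smooth_at (f : V -> W) (x : V) : Prop :=
  \forall y \near x, forall vs : seq V, differentiable (iter_derive f vs) y.

(* Smoothness of the restriction of f to a subset S that need not be open:
   existence of smooth local extensions. The values of f off S are irrelevant. *)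
Definition smooth_on (S : set V) (f : V -> W) : Prop :=
  forall q, S q -> exists F : V -> W,
    smooth_at F q /\ \forall y \near q, S y -> F y = f y.

End Smoothness.

(* Geometry of a submanifold M of V, carrying a metric g q u v defined at the
   points q of M for u and v tangent to M at q. *)
Section SubmanifoldGeometry.
Context {R : realType} {V : normedModType R}.
Implicit Types (S M L : set V) (q v : V) (X Y : V -> V).

(* v is tangent to S at q when the derivation f |-> 'D_v f q descends to germs
   of smooth functions on S, i.e. kills those vanishing on S near q. *)
Definition tangent S q v : Prop :=
  forall f : V -> R, smooth_at f q ->
    (\forall y \near q, S y -> f y = 0) -> 'D_v f q = 0.

(* Local vector fields on S, given through an extension to a neighborhood of q
   in V. *)
Definition vector_field_at S q X : Prop :=
  smooth_at X q /\ \forall y \near q, S y -> tangent S y (X y).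

(* [nabla q v X] is the covariant derivative at q of the local vector field X
   in the direction v. *)
Record levi_civita M (g : V -> V -> V -> R) (nabla : V -> V -> (V -> V) -> V)
    : Prop := LeviCivita {
  lc_tangent : forall q v X, M q -> tangent M q v -> vector_field_at M q X ->
    tangent M q (nabla q v X);
  lc_local : forall q v X Y, M q -> tangent M q v ->
    vector_field_at M q X -> vector_field_at M q Y ->
    (\forall y \near q, M y -> X y = Y y) -> nabla q v X = nabla q v Y;
  lc_linear : forall q (a : R) u v X, M q -> tangent M q u -> tangent M q v ->
    vector_field_at M q X ->
    nabla q (a *: u + v) X = a *: nabla q u X + nabla q v X;
  lc_add : forall q v X Y, M q -> tangent M q v ->
    vector_field_at M q X -> vector_field_at M q Y ->
    nabla q v (fun y => X y + Y y) = nabla q v X + nabla q v Y;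
  lc_leibniz : forall q v (f : V -> R) X, M q -> tangent M q v ->
    smooth_at f q -> vector_field_at M q X ->
    nabla q v (fun y => f y *: X y) = 'D_v f q *: X q + f q *: nabla q v X;
  lc_smooth : forall q X Y, M q ->
    vector_field_at M q X -> vector_field_at M q Y ->
    exists2 Z, vector_field_at M q Z &
      \forall y \near q, M y -> Z y = nabla y (X y) Y;
  (* the right-hand side is the Lie bracket [X, Y] at q *)
  lc_torsion : forall q X Y, M q ->
    vector_field_at M q X -> vector_field_at M q Y ->
    nabla q (X q) Y - nabla q (Y q) X = 'D_(X q) Y q - 'D_(Y q) X q;
  lc_metric : forall q v X Y, M q -> tangent M q v ->
    vector_field_at M q X -> vector_field_at M q Y ->
    'D_v (fun y => g y (X y) (Y y)) q =
      g q (nabla q v X) (Y q) + g q (X q) (nabla q v Y)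
}.

Definition hypersurface M L : Prop :=
  L `<=` M /\
  forall q, L q -> exists f : V -> R,
    [/\ smooth_at f q,
        exists2 v, tangent M q v & 'D_v f q != 0 &
        \forall y \near q, M y -> (L y <-> f y = 0)].

Definition null_hypersurface M (g : V -> V -> V -> R) L : Prop :=
  hypersurface M L /\
  forall q, L q -> exists v,
    [/\ tangent L q v, v != 0 & forall w, tangent L q w -> g q v w = 0].

Definition null_field (g : V -> V -> V -> R) L (xi : V -> V) : Prop :=
  smooth_on L xi /\
  forall q, L q -> [/\ tangent L q (xi q), xi q != 0 & g q (xi q) (xi q) = 0].

(* A vector field xi along L is differentiated, in directions tangent to L,
   through an extension to a local vector field on M. One exists when xi is
   smooth and tangent to L, which is contained in the submanifold M, and the
   derivative does not depend on which one is selected. *)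
Definition local_extension M L q (xi : V -> V) : V -> V :=
  xget xi [set X | vector_field_at M q X /\
                   \forall y \near q, L y -> X y = xi y].

Definition null_second_form M (g : V -> V -> V -> R)
    (nabla : V -> V -> (V -> V) -> V) L (xi : V -> V) q (u v : V) : R :=
  - g q (nabla q u (local_extension M L q xi)) v.

(* T is the timelike field whose orthogonal complement in the tangent bundle of
   L is the screen distribution. *)
Definition totally_umbilic M (g : V -> V -> V -> R)
    (nabla : V -> V -> (V -> V) -> V) (T : V) L : Prop :=
  exists xi : V -> V, null_field g L xi /\
  exists2 rho : V -> R, smooth_on L rho &
    forall q u v, L q ->
      tangent L q u -> g q u T = 0 -> tangent L q v -> g q v T = 0 ->
      null_second_form M g nabla L xi q u v = rho q * g q u v.

Definition same_germ q L L' : Prop := \forall y \near q, L y <-> L' y.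

End SubmanifoldGeometry.

(* The spacetime I x S^2 x R as a submanifold of R x R^3 x R; points are
   triples (r, x, t) with x in the unit sphere. *)
Section Spacetime.
Context {R : realType}.

Definition ambient : normedModType R := (R^o * 'rV[R]_3 * R^o)%type.

Definition dot (u v : 'rV[R]_3) : R := \sum_i u 0 i * v 0 i.

Definition spacetime (I : set R) : set ambient :=
  [set p | I p.1.1 /\ dot p.1.2 p.1.2 = 1].

(* dr^2 / h(r) + r^2 g_0 - h(r) dt^2, with g_0 induced by the dot product *)
Definition metric (h : R -> R) (p u v : ambient) : R :=
  u.1.1 * v.1.1 / h p.1.1 + p.1.1 ^+ 2 * dot u.1.2 v.1.2 - h p.1.1 * (u.2 * v.2).

Definition partial_t : ambient := (0, 0, 1).

Definition umbilic_null_through (I : set R) (h : R -> R)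
    (nabla : ambient -> ambient -> (ambient -> ambient) -> ambient)
    (p : ambient) (L : set ambient) : Prop :=
  [/\ L p, null_hypersurface (spacetime I) (metric h) L &
      totally_umbilic (spacetime I) (metric h) nabla partial_t L].

End Spacetime.

(* Main.v *)
From HB Require Import structures.
Require Import Defs.
From mathcomp Require Import all_boot all_order all_algebra.
From mathcomp Require Import all_classical all_reals all_analysis.
From mathcomp Require Import ring lra.
Set Implicit Arguments.
Unset Strict Implicit.
Unset Printing Implicit Defensive.
Import Order.TTheory GRing.Theory Num.Theory.
Import numFieldNormedType.Exports.
Local Open Scope classical_set_scope.
Local Open Scope ring_scope.

(**
   The theorem is about null directions and conformal geometry. Space at a
   fixed time is conformally flat: with kappa = 1 / (r sqrt h) and
   d rho = kappa dr, the map (r, x) |-> exp(rho) x to R^3 is conformal, and the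
   spacetime metric is conformal to - psi^-1 dt^2 + d rho^2 + g_0, where
   psi = r^2 / h. Locally, a null hypersurface is a graph t = tau over an open
   set of space. Its slowness p, the flat gradient of tau multiplied by exp(rho),
   satisfies the eikonal equation |p|^2 = psi, and total umbilicity, a
   conformally invariant property, says that the level sets of tau are totally
   umbilic in R^3. In place of tau, the proof uses the lifts to the
   hypersurface of the constant fields of R^3 ([frame]): they span the
   tangent space, and the components of p along them are functions on the
   hypersurface.

   The derivative of p is then known up to one function, the umbilicity factor
   ([frame_umbilic], [frame_derivE]); the formula for the connection behind
   this is [nabla_screen]. The symmetry of the second derivatives of p, tested
   on suitable vectors orthogonal to p, no longer involves this function. It
   states that (x . e) (x . w) weyl(r) = 0 for all orthogonal e, w in the plane
   orthogonal to p, where weyl(r) = 1 - h + r h' - r^2 h'' / 2 ([shear]). In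
   other words, where the Weyl curvature does not vanish, p is proportional to
   x, so that the null direction is radial ([nonradial_weyl]). Geometrically,
   the null direction of a totally umbilic null hypersurface is a principal
   null direction, and there are only two of them where the Weyl curvature does
   not vanish.

   The derivative of weyl is - r^2 h''' / 2, so weyl vanishes identically on no
   interval. If the null direction were not radial at some point, the same
   would hold at the nearby points of the hypersurface, whose radii fill an
   interval because the hypersurface is transversal to the time direction; so
   the null direction is radial everywhere ([radial]). It follows that
   dt = eps dr / h on the hypersurface with a locally constant sign eps, which
   determines its germ ([germ]). Conversely, the two hypersurfaces
   t = t_0 + eps H(r), where H is a primitive of 1 / h, are null and totally
   umbilic with factor - eps h / r ([sheet_umbilic]), and their null directions
   differ ([sheets_differ]).

   Covariant and ordinary derivatives along a hypersurface only see its tangent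
   vectors, which are described without charts: a function differentiable at q
   and vanishing on {f = 0} has zero derivative along the kernel of the
   differential of f, by the intermediate value theorem ([implicit_dir]).
*)

(** * Smooth functions *)

Section ClassCk.
Context {R : realType} {V : normedModType R}.

Lemma differentiableW (W : normedModType R) (f : V -> W) x :
  differentiable f x -> forall e : R, 0 < e ->
  \forall y \near x, `|f y - f x - 'd f x (y - x)| <= e * `|y - x|.
Proof.
move=> /diff_locallyxP [_ df] e e0.
have : (fun h => f (h + x)) = (fun h => f x + 'd f x h) +o_ (0:V) (@id V).
  by apply/funext => h; exact: df.
move=> /eqaddoP/(_ e e0) H.
rewrite (near_shift 0 x) subr0 /=.
apply: filterS H => h /=; rewrite !fctE addrK opprD addrA.
by [].
Qed.

Lemma near_eq_differentiable (W : normedModType R) (f g : V -> W) x :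
  {near x, f =1 g} -> differentiable f x -> differentiable g x.
Proof.
move=> fg df.
have gx : g x = f x by rewrite (nbhs_singleton fg).
have key : g \o shift x = cst (g x) + 'd f x +o_ (0:V) (@id V).
  apply/eqaddoP => e e0.
  have := differentiableW df e0.
  rewrite (near_shift 0 x) subr0 /= => H.
  have fg' : \forall h \near 0, f (h + x) = g (h + x).
    by move: fg; rewrite (near_shift 0 x) subr0.
  apply: filterS2 H fg' => h /= Hh Eh.
  by rewrite !fctE /= -Eh gx opprD addrA; move: Hh; rewrite addrK.
apply/diff_locallyP; rewrite (diff_unique _ key); last exact: diff_continuous.
by split => //; exact: diff_continuous.
Qed.

(** Regularity of a fixed order on a fixed set, so that closure under the
    operations below can be proved by induction on the order. *)
Fixpoint Ck (n : nat) (U : set V) {W : normedModType R} (f : V -> W) : Prop :=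
  (forall y, U y -> differentiable f y) /\
  (if n is n'.+1 then forall v, Ck n' U ('D_v f) else True).

Lemma Ck_diff n U (W : normedModType R) (f : V -> W) y :
  Ck n U f -> U y -> differentiable f y.
Proof. by case: n => [|n] [H _]; apply: H. Qed.

Lemma Ck_pred n U (W : normedModType R) (f : V -> W) :
  Ck n.+1 U f -> Ck n U f.
Proof.
elim: n f => [|n IH] f [H1 H2]; split => // v.
by apply: IH; exact: H2.
Qed.

Lemma Ck_sub n (U U' : set V) (W : normedModType R) (f : V -> W) :
  U' `<=` U -> Ck n U f -> Ck n U' f.
Proof.
move=> s; elim: n f => [|n IH] f [H1 H2]; split => //.
- by move=> y /s; exact: H1.
- by move=> y /s; exact: H1.
- by move=> v; apply: IH; exact: H2.
Qed.

(** The open set is the interior of the neighborhood on which all iterated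
    derivatives are differentiable; those of length [n] are controlled by [Ck
    n]. *)
Lemma smooth_atP (W : normedModType R) (f : V -> W) x :
  smooth_at f x <-> exists U, [/\ open U, U x & forall n, Ck n U f].
Proof.
split.
  rewrite /smooth_at => /nbhs_interior H.
  set P := (X in nbhs x X°) in H.
  exists P°; split; [exact: open_interior| exact: nbhs_singleton|].
  have sub y : P° y -> forall vs, differentiable (iter_derive f vs) y.
    by move=> /interior_subset.
  have Ck_iter n (k : V -> W) (U : set V) :
      (forall y, U y -> forall vs, differentiable (iter_derive k vs) y) -> Ck n U k.
    elim: n k => [|n IH] k HU; split => //; try by move=> y /HU /(_ [::]).
    move=> v; apply: IH => y Uy vs.
    by have := HU y Uy (rcons vs v); rewrite /iter_derive foldr_rcons.
  by move=> n; exact: Ck_iter.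
move=> [U [Uo Ux H]].
have Unbhs : nbhs x U by apply: open_nbhs_nbhs.
apply: filterS Unbhs => y Uy vs.
have {}H := H (size vs).
elim/last_ind: vs f H => [|vs v IH] f; first by move=> /Ck_diff; apply.
rewrite size_rcons => -[_ /(_ v) H2].
by rewrite /iter_derive foldr_rcons; apply: IH.
Qed.

Section Ext.
Variables (U : set V).
Hypothesis Uo : open U.

Let nearU y : U y -> \forall z \near y, U z.
Proof. by move=> Uy; apply: open_nbhs_nbhs. Qed.

Lemma Ck_ext n (W : normedModType R) (f g : V -> W) :
  (forall y, U y -> f y = g y) -> Ck n U f -> Ck n U g.
Proof.
elim: n f g => [|n IH] f g fg [H1 H2]; split => //; try
 (move=> y Uy; apply: near_eq_differentiable (H1 y Uy);
  apply: filterS (nearU Uy) => z; exact: fg).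
move=> v; apply: IH (H2 v) => y Uy.
by apply: near_eq_derive; apply: filterS (nearU Uy) => z; exact: fg.
Qed.

Lemma Ck_cst n (W : normedModType R) (c : W) : Ck n U (fun _ => c).
Proof.
elim: n c => [|n IH] c; split => //; try
  by move=> y _; exact: differentiable_cst.
move=> v; apply: (@Ck_ext _ _ (fun=> 0)) => // y Uy.
by rewrite derive_cst.
Qed.

Lemma Ck_add n (W : normedModType R) (f g : V -> W) :
  Ck n U f -> Ck n U g -> Ck n U (fun y => f y + g y).
Proof.
elim: n f g => [|n IH] f g [f1 f2] [g1 g2]; split => //; try
  by move=> y Uy; apply: differentiableD; [exact: f1|exact: g1].
move=> v; apply: Ck_ext (IH _ _ (f2 v) (g2 v)) => y Uy.
by rewrite -deriveD //; apply: diff_derivable; [exact: f1|exact: g1].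
Qed.

Lemma Ck_mul n (f g : V -> R) :
  Ck n U f -> Ck n U g -> Ck n U (fun y => f y * g y).
Proof.
elim: n f g => [|n IH] f g Hf Hg.
  split => // y Uy.
  by apply: differentiableM; [exact: (Ck_diff Hf)|exact: (Ck_diff Hg)].
split => [y Uy|v].
  by apply: differentiableM; [exact: (Ck_diff Hf)|exact: (Ck_diff Hg)].
apply: (@Ck_ext _ _ (fun y => f y * 'D_v g y + g y * 'D_v f y)).
  move=> y Uy; rewrite -[in RHS]/('D_v (f * g) y) deriveM //.
    by apply: diff_derivable; exact: (Ck_diff Hf).
  by apply: diff_derivable; exact: (Ck_diff Hg).
apply: Ck_add; apply: IH; first exact: Ck_pred.
- by case: Hg => _; apply.
- exact: Ck_pred.
- by case: Hf => _; apply.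
Qed.

Lemma Ck_Zl n (W : normedModType R) (f : V -> R) (w : W) :
  Ck n U f -> Ck n U (fun y => f y *: w).
Proof.
elim: n f => [|n IH] f [f1 f2]; split => //; try
  by move=> y Uy; exact: (differentiableZl _ (f1 y Uy)).
move=> v; apply: Ck_ext (IH _ (f2 v)) => y Uy.
have dfy := f1 y Uy.
rewrite [RHS]deriveE; last exact: differentiableZl.
by rewrite diffZl // deriveE.
Qed.

Lemma Ck_lin n (W W' : normedModType R) (l : {linear W -> W'}) (f : V -> W) :
  continuous l -> Ck n U f -> Ck n U (fun y => l (f y)).
Proof.
move=> lc; elim: n f => [|n IH] f [f1 f2].
  split => // y Uy; apply: differentiable_comp; first exact: f1.
  by apply: linear_differentiable => z; exact: lc.
have ld z : differentiable l z by apply: linear_differentiable => ?; exact: lc.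
split => [y Uy|v].
  by apply: differentiable_comp; [exact: f1|exact: ld].
apply: Ck_ext (IH _ (f2 v)) => y Uy.
rewrite [RHS]deriveE; last by apply: differentiable_comp; [exact: f1|exact: ld].
rewrite -[fun y => _]/(l \o f) diff_comp //=; last exact: f1.
by rewrite diff_lin // deriveE //; exact: f1.
Qed.

End Ext.

End ClassCk.

Section SmoothFunctions.
Context {R : realType} {V : normedModType R}.

Lemma path_derive (W : normedModType R) (f : V -> W) (g : R -> V) (s : R) (dg : V) :
  differentiable f (g s) -> is_derive s 1 g dg ->
  is_derive s 1 (fun s => f (g s)) ('D_dg f (g s)).
Proof.
move=> df [Dg <-].
have dgs : differentiable g s by apply/derivable1_diffP.
have dfg : differentiable (f \o g) s by apply: differentiable_comp.
rewrite -[fun _ => _]/(f \o g); apply: DeriveDef.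
  by apply/derivable1_diffP.
by rewrite deriveE // diff_comp //= [in RHS]deriveE // [in RHS]deriveE.
Qed.

Lemma derive_chain (W W' : normedModType R) (f : W -> W') (g : V -> W) y v :
  differentiable g y -> differentiable f (g y) ->
  'D_v (fun z => f (g z)) y = 'D_('D_v g y) f (g y).
Proof.
move=> dg df; rewrite -[fun _ => _]/(f \o g) deriveE; last exact: differentiable_comp.
by rewrite diff_comp //= [in RHS]deriveE // [in RHS]deriveE.
Qed.

Lemma derive_lin (W : normedModType R) (f : V -> W) y (a : R) u v :
  differentiable f y -> 'D_(a *: u + v) f y = a *: 'D_u f y + 'D_v f y.
Proof. by move=> df; rewrite !deriveE // linearP. Qed.

Lemma derive_dirD (W : normedModType R) (f : V -> W) y u v :
  differentiable f y -> 'D_(u + v) f y = 'D_u f y + 'D_v f y.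
Proof. by move=> df; rewrite !deriveE // linearD. Qed.

Lemma derive_dirZ (W : normedModType R) (f : V -> W) y (a : R) u :
  differentiable f y -> 'D_(a *: u) f y = a *: 'D_u f y.
Proof. by move=> df; rewrite !deriveE // linearZ. Qed.

Lemma derive_real (W : normedModType R) (phi : R -> W) (z a : R) :
  differentiable phi z -> 'D_a phi z = a *: derive1 phi z.
Proof.
move=> dphi; rewrite derive1E !deriveE // -linearZ; congr ('d _ _ _).
by rewrite -[RHS]/(a * 1) mulr1.
Qed.

Section Ext.
Variables (U : set V).
Hypothesis Uo : open U.

(** The derivative of [phi \o f] is [phi^`() \o f] times that of [f], and
    [phi^`()] is as smooth as [phi]. *)
Lemma Ck_comp1 n (I : set R) (phi : R -> R) (f : V -> R) :
  (forall (n : nat) r, I r -> derivable (derive1n n phi) r 1) ->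
  (forall y, U y -> I (f y)) ->
  Ck n U f -> Ck n U (fun y => phi (f y)).
Proof.
move=> + UI; elim: n phi => [|n IH] phi Hphi Hf.
  split=> // y Uy; apply: (@differentiable_comp _ _ _ _ f phi).
    exact: (Ck_diff Hf).
  by apply/derivable1_diffP; apply: (Hphi 0%N); exact: UI.
have dphi y : U y -> differentiable phi (f y).
  by move=> Uy; apply/derivable1_diffP; apply: (Hphi 0%N); exact: UI.
split=> [y Uy|v].
  by apply: (@differentiable_comp _ _ _ _ f phi); [exact: (Ck_diff Hf)|exact: dphi].
apply: (@Ck_ext _ _ _ Uo _ _ (fun y => derive1 phi (f y) * 'D_v f y)).
  move=> y Uy; rewrite [RHS]derive_chain; [|exact: (Ck_diff Hf)|exact: dphi].
  by rewrite (derive_real _ (dphi y Uy)); exact: mulrC.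
apply: Ck_mul => //.
- apply: IH; last exact: Ck_pred.
  by move=> m r Ir; rewrite -derive1Sn; exact: Hphi.
- by case: Hf => _; apply.
Qed.

Lemma Ck_inv n (f : V -> R) :
  (forall y, U y -> f y != 0) -> Ck n U f -> Ck n U (fun y => (f y)^-1).
Proof.
move=> f0; elim: n => [|n IH] Hf.
  by split=> // y Uy; apply: differentiableV; [exact: (Ck_diff Hf)|exact: f0].
split=> [y Uy|v].
  by apply: differentiableV; [exact: (Ck_diff Hf)|exact: f0].
have If := IH (Ck_pred Hf).
apply: (@Ck_ext _ _ _ Uo _ _ (fun y => (-1) * ((f y)^-1 * (f y)^-1) * 'D_v f y)).
  move=> y Uy; rewrite deriveV; [|exact: f0|apply: diff_derivable; exact: (Ck_diff Hf)].
  by rewrite mulN1r expr2 invfM.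
apply: Ck_mul => //; last by case: Hf => _; apply.
apply: Ck_mul => //; first exact: Ck_cst.
exact: Ck_mul.
Qed.

Lemma Ck_sqrt n (f : V -> R) :
  (forall y, U y -> 0 < f y) -> Ck n U f -> Ck n U (fun y => Num.sqrt (f y)).
Proof.
move=> f0.
have dsq y : U y -> differentiable Num.sqrt (f y).
  by move=> /f0 fy0; apply/derivable1_diffP; case: (is_derive1_sqrt fy0).
have d0 m (g : V -> R) : Ck m U g -> (forall y, U y -> 0 < g y) ->
    forall y, U y -> differentiable (fun y => Num.sqrt (g y)) y.
  move=> Hg g0 y Uy; apply: (@differentiable_comp _ _ _ _ g Num.sqrt).
    exact: (Ck_diff Hg).
  by apply/derivable1_diffP; case: (is_derive1_sqrt (g0 y Uy)).
elim: n => [|n IH] Hf; first by split => //; exact: d0 Hf f0.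
split=> [|v]; first exact: d0 Hf f0.
have If := IH (Ck_pred Hf).
apply: (@Ck_ext _ _ _ Uo _ _ (fun y => (2 * Num.sqrt (f y))^-1 * 'D_v f y)).
  move=> y Uy; rewrite [RHS]derive_chain; [|exact: (Ck_diff Hf)|exact: dsq].
  rewrite (derive_real _ (dsq y Uy)) derive1E derive_sqrt ?f0 //.
  exact: mulrC.
apply: Ck_mul => //; last by case: Hf => _; apply.
apply: Ck_inv; last by apply: Ck_mul => //; exact: Ck_cst.
by move=> y Uy; rewrite mulf_neq0 // gt_eqF // sqrtr_gt0 f0.
Qed.

End Ext.

Section SmoothAt.
Implicit Types (x : V).

Lemma smooth_atI (W : normedModType R) (f : V -> W) x (P : V -> Prop) :
  smooth_at f x -> (\forall y \near x, P y) ->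
  exists U, [/\ open U, U x, (forall y, U y -> P y) & forall n, Ck n U f].
Proof.
move=> /smooth_atP [U [Uo Ux H]] HP.
exists (U `&` [set y | P y]°); split.
- by apply: openI => //; exact: open_interior.
- by split=> //; apply: nbhs_singleton; exact: nbhs_interior.
- by move=> y [_ /interior_subset].
- by move=> n; apply: Ck_sub (H n) => y [].
Qed.

Lemma smooth_diff (W : normedModType R) (f : V -> W) x :
  smooth_at f x -> differentiable f x.
Proof. by move=> /nbhs_singleton /(_ [::]). Qed.

Lemma smooth_near (W : normedModType R) (f : V -> W) x :
  smooth_at f x -> \forall y \near x, smooth_at f y.
Proof.
move=> /smooth_atP [U [Uo Ux H]].
have : nbhs x U by apply: open_nbhs_nbhs.
by apply: filterS => y Uy; apply/smooth_atP; exists U; split.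
Qed.

Lemma smooth_cont (W : normedModType R) (f : V -> W) x :
  smooth_at f x -> {for x, continuous f}.
Proof. by move=> /smooth_diff; exact: differentiable_continuous. Qed.

Lemma smooth_ext (W : normedModType R) (f g : V -> W) x :
  (\forall y \near x, f y = g y) -> smooth_at f x -> smooth_at g x.
Proof.
move=> fg /smooth_atI /(_ fg) [U [Uo Ux UP H]]; apply/smooth_atP.
by exists U; split=> // n; apply: Ck_ext (H n).
Qed.

Lemma smooth_cst (W : normedModType R) (c : W) x : smooth_at (fun _ => c) x.
Proof.
by apply/smooth_atP; exists setT; split=> //; [exact: openT|move=> n; apply: Ck_cst; exact: openT].
Qed.

Lemma smooth2 (W1 W2 : normedModType R) (f : V -> W1) (g : V -> W2) x :
  smooth_at f x -> smooth_at g x ->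
  exists U, [/\ open U, U x, forall n, Ck n U f & forall n, Ck n U g].
Proof.
move=> /smooth_atP [U [Uo Ux H]] /smooth_atP [U' [U'o U'x H']].
exists (U `&` U'); split=> //; first exact: openI.
  by move=> n; apply: Ck_sub (H n) => y [].
by move=> n; apply: Ck_sub (H' n) => y [].
Qed.

Lemma smooth_add (W : normedModType R) (f g : V -> W) x :
  smooth_at f x -> smooth_at g x -> smooth_at (fun y => f y + g y) x.
Proof.
move=> Hf /(smooth2 Hf) [U [Uo Ux {}Hf Hg]]; apply/smooth_atP.
by exists U; split=> // n; exact: Ck_add.
Qed.

Lemma smooth_mul (f g : V -> R) x :
  smooth_at f x -> smooth_at g x -> smooth_at (fun y => f y * g y) x.
Proof.
move=> Hf /(smooth2 Hf) [U [Uo Ux {}Hf Hg]]; apply/smooth_atP.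
by exists U; split=> // n; exact: Ck_mul.
Qed.

Lemma smooth_Zl (W : normedModType R) (f : V -> R) (w : W) x :
  smooth_at f x -> smooth_at (fun y => f y *: w) x.
Proof.
move=> /smooth_atP [U [Uo Ux H]]; apply/smooth_atP.
by exists U; split=> // n; exact: Ck_Zl.
Qed.

Lemma smooth_lin (W W' : normedModType R) (l : {linear W -> W'}) (f : V -> W) x :
  continuous l -> smooth_at f x -> smooth_at (fun y => l (f y)) x.
Proof.
move=> lc /smooth_atP [U [Uo Ux H]]; apply/smooth_atP.
by exists U; split=> // n; exact: Ck_lin.
Qed.

Lemma smooth_id x : smooth_at (fun y : V => y) x.
Proof.
apply/smooth_atP; exists setT; split=> //; first exact: openT.
case=> [|n]; split => //; try by move=> y _; exact: ex_diff.
move=> v; apply: (@Ck_ext _ _ _ openT _ _ (fun=> v)) => [y _|].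
  by rewrite derive_id.
by apply: Ck_cst; exact: openT.
Qed.

Lemma smooth_opp (f : V -> R) x :
  smooth_at f x -> smooth_at (fun y => - f y) x.
Proof.
move=> H; apply: (@smooth_ext _ (fun y => (-1) * f y)).
  by apply: nearW => y; rewrite mulN1r.
by apply: smooth_mul => //; exact: smooth_cst.
Qed.

Lemma smooth_sub (f g : V -> R) x :
  smooth_at f x -> smooth_at g x -> smooth_at (fun y => f y - g y) x.
Proof. by move=> Hf Hg; apply: smooth_add => //; exact: smooth_opp. Qed.

Lemma smooth_inv (f : V -> R) x :
  f x != 0 -> smooth_at f x -> smooth_at (fun y => (f y)^-1) x.
Proof.
move=> f0 Hf.
have fn : \forall y \near x, f y != 0.
  have /cvgrPdist_lt /(_ `|f x|) := smooth_cont Hf.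
  rewrite normr_gt0 => /(_ f0); apply: filterS => y.
  by apply: contraTneq => ->; rewrite subr0 ltxx.
have [U [Uo Ux UP H]] := smooth_atI Hf fn; apply/smooth_atP.
by exists U; split=> // n; exact: Ck_inv.
Qed.

Lemma smooth_sqrt (f : V -> R) x :
  0 < f x -> smooth_at f x -> smooth_at (fun y => Num.sqrt (f y)) x.
Proof.
move=> f0 Hf.
have fn : \forall y \near x, 0 < f y by apply: cvgr_gt (smooth_cont Hf) _ f0.
have [U [Uo Ux UP H]] := smooth_atI Hf fn; apply/smooth_atP.
by exists U; split=> // n; exact: Ck_sqrt.
Qed.

Lemma smooth_comp1 (I : set R) (phi : R -> R) (f : V -> R) x :
  open I -> I (f x) ->
  (forall (n : nat) r, I r -> derivable (derive1n n phi) r 1) ->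
  smooth_at f x -> smooth_at (fun y => phi (f y)) x.
Proof.
move=> Io If Hphi Hf.
have fn : \forall y \near x, I (f y).
  by apply: (smooth_cont Hf); apply: open_nbhs_nbhs.
have [U [Uo Ux UP H]] := smooth_atI Hf fn; apply/smooth_atP.
by exists U; split=> // n; exact: (Ck_comp1 Uo Hphi UP).
Qed.

Lemma smooth_D (W : normedModType R) (f : V -> W) x v :
  smooth_at f x -> smooth_at ('D_v f) x.
Proof.
move=> /smooth_atP [U [Uo Ux H]]; apply/smooth_atP.
by exists U; split=> // n; case: (H n.+1) => _; apply.
Qed.

End SmoothAt.

End SmoothFunctions.

(** * Symmetry of second derivatives *)

Section Schwarz.
Context {R : realType} {V : normedModType R}.

Lemma is_derive_line (a v : V) (s : R) : is_derive s 1 (fun t : R => a + t *: v) v.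
Proof.
have -> : (fun t : R => a + t *: v) = (fun t : R => cst a t + t *: v) by [].
apply: is_derive_eq.
  apply: is_deriveD.
  apply: DeriveDef; first by apply: diff_derivable; exact: ex_diff.
  rewrite deriveE; last exact: ex_diff.
  by rewrite diff_val.
by rewrite /= scale1r add0r.
Qed.

(** The mean value theorem in the direction [v] turns the second difference
    into a difference of values of ['D_v f], which the differentiability of
    ['D_v f] at [x] evaluates. *)
Lemma second_diff (U : set V) (f : V -> R) x v w (e : R) :
  open U -> U x -> Ck 1 U f -> 0 < e ->
  \forall s \near 0^'+,
   `|f (x + s *: w + s *: v) - f (x + s *: v) - f (x + s *: w) + f x
     - s ^+ 2 * 'D_w ('D_v f) x| <= e * s ^+ 2.
Proof.
move=> Uo Ux Hf e0.
have Dg : differentiable ('D_v f) x by case: Hf => _ /(_ v) [Hv _]; exact: Hv.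
set K := `|w| + 2 * `|v| + 1.
have K0 : 0 < K by rewrite /K ltr_wpDl // addr_ge0 // mulr_ge0.
have e'0 : 0 < e / K by rewrite divr_gt0.
have HU : nbhs x U by apply: open_nbhs_nbhs.
have [d /= d0 Hd] := (nbhs_ballP _ _).1 (filterI HU (differentiableW Dg e'0)).
near=> s.
have s0 : 0 < s by near: s; exact: nbhs_right_gt.
have sd : s * K < d.
  by rewrite -ltr_pdivlMr //; near: s; apply: nbhs_right_lt; rewrite divr_gt0.
have small a b : 0 <= a <= s -> 0 <= b <= s -> ball x d (x + a *: w + b *: v).
  move=> /andP[a0 As] /andP[b0 bs]; rewrite -ball_normE /= -addrA opprD addNKr normrN.
  apply: le_lt_trans (ler_normD _ _) _; rewrite !normrZ !ger0_norm //.
  apply: le_lt_trans sd; rewrite /K.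
  have : a * `|w| <= s * `|w| by apply: ler_wpM2r.
  have : b * `|v| <= s * `|v| by apply: ler_wpM2r.
  have : 0 <= s * `|v| by apply: mulr_ge0 => //; exact: ltW.
  move: s0; set aw := a * _; set bv := b * _; nra.
pose phi (t : R) := f (x + s *: w + t *: v) - f (x + 0 *: w + t *: v).
pose g := 'D_v f.
have ss : 0 <= s <= s by rewrite ltW //= lexx.
have s00 : (0 : R) <= 0 <= s by rewrite lexx ltW.
have Dphi t : 0 <= t <= s -> is_derive t 1 phi (g (x + s *: w + t *: v) - g (x + 0 *: w + t *: v)).
  move=> ts; apply: is_deriveB.
    apply: path_derive; last exact: is_derive_line.
    by apply: (Ck_diff Hf); case: (Hd _ (small s t ss ts)).
  apply: path_derive; last exact: is_derive_line.
  by apply: (Ck_diff Hf); case: (Hd _ (small 0 t s00 ts)).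
have [c cs] : exists2 c, c \in `]0, s[%R &
    phi s - phi 0 = (g (x + s *: w + c *: v) - g (x + 0 *: w + c *: v)) * (s - 0).
  apply: (@MVT _ phi (fun c => g (x + s *: w + c *: v) - g (x + 0 *: w + c *: v))) => //.
    by move=> t; rewrite in_itv /= => /andP[/ltW t0 /ltW ts]; apply: Dphi; rewrite t0.
  apply: derivable_within_continuous => t; rewrite in_itv /= => /Dphi Ht.
  exact: ex_derive.
move: cs; rewrite in_itv /= => /andP[/ltW c0 /ltW cs].
have c0s : 0 <= c <= s by rewrite c0.
rewrite subr0 /phi !scale0r !addr0 => Heq.
have -> : f (x + s *: w + s *: v) - f (x + s *: v) - f (x + s *: w) + f x
  = (g (x + s *: w + c *: v) - g (x + c *: v)) * s by rewrite -Heq; ring.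
have cancelx A B : x + A + B - x = A + B by rewrite addrC !addrA addNr add0r.
have cancelx1 A : x + A - x = A by rewrite addrC addKr.
pose Gw := 'D_w g x; pose Gv := 'D_v g x.
have H1 : `|g (x + s *: w + c *: v) - g x - (s * Gw + c * Gv)| <=
    e / K * `|s *: w + c *: v|.
  have [_ /=] := Hd _ (small s c ss c0s).
  by rewrite cancelx linearD !linearZ /= -!deriveE.
have H2 : `|g (x + c *: v) - g x - c * Gv| <= e / K * `|c *: v|.
  have [_ /=] := Hd _ (small 0 c s00 c0s).
  by rewrite scale0r addr0 cancelx1 linearZ /= -deriveE.
rewrite -/g -/Gw.
have E1 : `|s *: w + c *: v| <= s * (`|w| + `|v|).
  apply: le_trans (ler_normD _ _) _; rewrite !normrZ !ger0_norm // ?(ltW s0) // mulrDr.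
  by rewrite lerD2l; apply: ler_wpM2r.
have E2 : `|c *: v| <= s * `|v| by rewrite normrZ ger0_norm //; apply: ler_wpM2r.
have H1' := le_trans H1 (ler_wpM2l (ltW e'0) E1).
have H2' := le_trans H2 (ler_wpM2l (ltW e'0) E2).
set X1 := g (x + _ + _) in H1' *; set X2 := g (x + _) in H2' *.
have -> : (X1 - X2) * s - s ^+ 2 * Gw =
  s * ((X1 - g x - (s * Gw + c * Gv)) - (X2 - g x - c * Gv)) by ring.
rewrite normrM gtr0_norm //.
have /le_trans : s * `|(X1 - g x - (s * Gw + c * Gv)) - (X2 - g x - c * Gv)| <=
  s * (e / K * (s * (`|w| + `|v|)) + e / K * (s * `|v|)).
  rewrite ler_pM2l //; apply: le_trans (ler_normB _ _) _.
  exact: lerD.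
apply.
have -> : s * (e / K * (s * (`|w| + `|v|)) + e / K * (s * `|v|)) =
  e * s ^+ 2 * ((`|w| + 2 * `|v|) / K) by field; rewrite gt_eqF.
rewrite ler_piMr //; first by rewrite mulr_ge0 // ?sqr_ge0 // ltW.
by rewrite ler_pdivrMr // mul1r /K lerDl.
Unshelve. all: by end_near. Qed.

(** Both iterated derivatives are approximated by the same second difference.
    *)
Lemma schwarz (f : V -> R) x v w : smooth_at f x ->
  'D_w ('D_v f) x = 'D_v ('D_w f) x.
Proof.
move=> /smooth_atP [U [Uo Ux /(_ 1%N) Hf]].
apply/eqP; rewrite -subr_eq0 -normr_le0; apply/ler_addgt0Pl => e e0.
rewrite addr0.
have e20 : 0 < e / 2 by rewrite divr_gt0.
have S1 := second_diff v w Uo Ux Hf e20.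
have S2 := second_diff w v Uo Ux Hf e20.
have [s [s0 [H1 H2]]] := filter_ex (filterI (nbhs_right_gt 0) (filterI S1 S2)).
have s20 : 0 < s ^+ 2 by rewrite exprn_gt0.
rewrite -(ler_pM2r s20).
have Ep : x + s *: v + s *: w = x + s *: w + s *: v by rewrite addrAC.
rewrite Ep in H2; clear Ep.
move: H1 H2; set A := 'D_w _ x; set B := 'D_v _ x.
set f1 := f (_ + _ + _); set f2 := f (_ + s *: v); set f3 := f (_ + s *: w).
set f0 := f x => H1 H2.
have -> : `|A - B| * s ^+ 2 =
    `|(f1 - f3 - f2 + f0 - s ^+ 2 * B) - (f1 - f2 - f3 + f0 - s ^+ 2 * A)|.
  by rewrite -[s ^+ 2 in LHS]gtr0_norm // -normrM; congr (`|_|); ring.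
apply: le_trans (ler_normB _ _) _.
have -> : e * s ^+ 2 = e / 2 * s ^+ 2 + e / 2 * s ^+ 2 by field.
exact: (lerD H2 H1).
Qed.

End Schwarz.

(** * Coordinates on the ambient space *)

Section Coordinates.
Context {R : realType}.
Local Notation amb := (@ambient R).

(** The coordinates r, x and t. *)
Definition rc (p : amb) : R := p.1.1.
Definition xc (p : amb) : 'rV[R]_3 := p.1.2.
Definition tc (p : amb) : R := p.2.
Definition ec (i : 'I_3) (u : 'rV[R]_3) : R := u 0 i.
Definition mk (a : R) (b : 'rV[R]_3) (c : R) : amb := (a, b, c).

Lemma mkE p : p = mk (rc p) (xc p) (tc p).
Proof. by case: p => [[a b] c]. Qed.

Lemma rc_lin : linear rc. Proof. by []. Qed.
Lemma xc_lin : linear xc. Proof. by []. Qed.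
Lemma tc_lin : linear tc. Proof. by []. Qed.
Lemma ec_lin i : linear (ec i).
Proof. by move=> a u v; rewrite /ec !mxE. Qed.
HB.instance Definition _ := GRing.isLinear.Build R amb R _ rc rc_lin.
HB.instance Definition _ := GRing.isLinear.Build R amb 'rV[R]_3 _ xc xc_lin.
HB.instance Definition _ := GRing.isLinear.Build R amb R _ tc tc_lin.
HB.instance Definition _ i := GRing.isLinear.Build R 'rV[R]_3 R _ (ec i) (ec_lin i).

Lemma rc_cont : continuous rc.
Proof. by move=> p; apply: (@continuous_comp _ _ _ fst fst); [exact: cvg_fst|exact: cvg_fst]. Qed.
Lemma xc_cont : continuous xc.
Proof. by move=> p; apply: (@continuous_comp _ _ _ fst snd); [exact: cvg_fst|exact: cvg_snd]. Qed.
Lemma tc_cont : continuous tc.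
Proof. by move=> p; exact: cvg_snd. Qed.
Lemma ec_cont i : continuous (ec i).
Proof. by move=> u; exact: coord_continuous. Qed.

Lemma sum3 (W : zmodType) (F : 'I_3 -> W) :
  \sum_i F i = F 0 + F 1 + F (inord 2).
Proof.
rewrite !big_ord_recl big_ord0 addr0 addrA.
by congr (_ + F _ + F _); apply/val_inj => //=; rewrite inordK.
Qed.

Section FromV.
Context {V : normedModType R}.
Implicit Types (x v : V).

Lemma derive_linear (W W' : normedModType R) (l : {linear W -> W'}) (f : V -> W) x v :
  continuous l -> differentiable f x ->
  'D_v (fun y => l (f y)) x = l ('D_v f x).
Proof.
move=> lc df.
have dl z : differentiable l z by apply: linear_differentiable => ?; exact: lc.
by rewrite derive_chain // [LHS]deriveE // diff_lin.
Qed.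

Lemma smooth_rV (f : V -> 'rV[R]_3) x :
  (forall i, smooth_at (fun y => f y 0 i) x) -> smooth_at f x.
Proof.
move=> H.
apply: (@smooth_ext _ _ _ (fun y => f y 0 0 *: delta_mx 0 0 + f y 0 1 *: delta_mx 0 1
   + f y 0 (inord 2) *: delta_mx 0 (inord 2))).
  by apply: nearW => y; rewrite [RHS]row_sum_delta sum3.
by do 2?[apply: smooth_add]; apply: smooth_Zl.
Qed.

Lemma smooth_mk (a : V -> R) (b : V -> 'rV[R]_3) (c : V -> R) x :
  smooth_at a x -> smooth_at b x -> smooth_at c x ->
  smooth_at (fun y => mk (a y) (b y) (c y)) x.
Proof.
move=> Ha Hb Hc.
pose ib (u : 'rV[R]_3) : amb := mk 0 u 0.
have lin : linear ib.
  move=> k u w; rewrite /ib /mk; congr (_, _, _) => /=.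
    by rewrite [_ *: _]mulr0 addr0.
  by rewrite [_ *: _]mulr0 addr0.
pose ibM := GRing.isLinear.Build _ _ _ _ _ lin.
pose ibl : {linear 'rV[R]_3 -> amb} := HB.pack ib ibM.
have ibc : continuous ibl.
  move=> u; apply: differentiable_continuous.
  apply: (@differentiable_pair _ _ (R^o * 'rV[R]_3)%type R^o (fun u => (0, u)) (fun=> 0)).
    apply: (@differentiable_pair _ _ R^o _ (fun=> 0) id); last exact: ex_diff.
    exact: differentiable_cst.
  exact: differentiable_cst.
apply: (@smooth_ext _ _ _ (fun y => a y *: mk 1 0 0 + ibl (b y) + c y *: mk 0 0 1)).
  apply: nearW => y; rewrite /= /ib /mk; congr (_, _, _) => /=.
  - by rewrite [_ *: _]mulr1 [_ *: _]mulr0 !addr0.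
  - by rewrite !scaler0 add0r addr0.
  - by rewrite [_ *: _]mulr0 [_ *: _]mulr1 !add0r.
apply: smooth_add; last exact: smooth_Zl.
apply: smooth_add; first exact: smooth_Zl.
exact: smooth_lin.
Qed.

Lemma smooth_rc (F : V -> amb) x : smooth_at F x -> smooth_at (fun y => rc (F y)) x.
Proof. by move=> H; apply: (@smooth_lin _ _ _ _ rc) => //; exact: rc_cont. Qed.
Lemma smooth_xc (F : V -> amb) x : smooth_at F x -> smooth_at (fun y => xc (F y)) x.
Proof. by move=> H; apply: (@smooth_lin _ _ _ _ xc) => //; exact: xc_cont. Qed.
Lemma smooth_tc (F : V -> amb) x : smooth_at F x -> smooth_at (fun y => tc (F y)) x.
Proof. by move=> H; apply: (@smooth_lin _ _ _ _ tc) => //; exact: tc_cont. Qed.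
Lemma smooth_ec i (f : V -> 'rV[R]_3) x : smooth_at f x -> smooth_at (fun y => f y 0 i) x.
Proof. by move=> H; apply: (@smooth_lin _ _ _ _ (ec i)) => //; exact: ec_cont. Qed.

Lemma derive_rc (F : V -> amb) x v : differentiable F x ->
  'D_v (fun y => rc (F y)) x = rc ('D_v F x).
Proof. by move=> H; apply: (@derive_linear _ _ rc) => //; exact: rc_cont. Qed.
Lemma derive_xc (F : V -> amb) x v : differentiable F x ->
  'D_v (fun y => xc (F y)) x = xc ('D_v F x).
Proof. by move=> H; apply: (@derive_linear _ _ xc) => //; exact: xc_cont. Qed.
Lemma derive_tc (F : V -> amb) x v : differentiable F x ->
  'D_v (fun y => tc (F y)) x = tc ('D_v F x).
Proof. by move=> H; apply: (@derive_linear _ _ tc) => //; exact: tc_cont. Qed.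
Lemma derive_ec i (F : V -> 'rV[R]_3) x v : differentiable F x ->
  'D_v (fun y => F y 0 i) x = ('D_v F x) 0 i.
Proof. by move=> H; apply: (@derive_linear _ _ (ec i)) => //; exact: ec_cont. Qed.

Lemma derive_mk (a : V -> R) (b : V -> 'rV[R]_3) (c : V -> R) x v :
  smooth_at a x -> smooth_at b x -> smooth_at c x ->
  'D_v (fun y => mk (a y) (b y) (c y)) x = mk ('D_v a x) ('D_v b x) ('D_v c x).
Proof.
move=> Ha Hb Hc.
have H := smooth_diff (smooth_mk Ha Hb Hc).
by rewrite [LHS]mkE -derive_rc // -derive_xc // -derive_tc.
Qed.

Lemma derive_add (W : normedModType R) (f g : V -> W) x v :
  differentiable f x -> differentiable g x ->
  'D_v (fun y => f y + g y) x = 'D_v f x + 'D_v g x.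
Proof. by move=> df dg; rewrite -deriveD //; exact: diff_derivable. Qed.

Lemma derive_opp (W : normedModType R) (f : V -> W) x v :
  differentiable f x -> 'D_v (fun y => - f y) x = - 'D_v f x.
Proof. by move=> df; rewrite -deriveN //; exact: diff_derivable. Qed.

Lemma derive_mul (f g : V -> R) x v :
  differentiable f x -> differentiable g x ->
  'D_v (fun y => f y * g y) x = 'D_v f x * g x + f x * 'D_v g x.
Proof.
move=> df dg; rewrite -[fun _ => _]/(f * g) deriveM; try exact: diff_derivable.
by rewrite addrC; congr (_ + _); exact: mulrC.
Qed.

Lemma derive_inv (f : V -> R) x v :
  f x != 0 -> differentiable f x ->
  'D_v (fun y => (f y)^-1) x = - ('D_v f x / f x ^+ 2).
Proof.
move=> f0 df; rewrite deriveV //; last exact: diff_derivable.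
by rewrite -[_ *: _]/(_ * _) mulNr mulrC.
Qed.

Lemma derive_phi (phi : R -> R) (f : V -> R) x v :
  derivable phi (f x) 1 -> differentiable f x ->
  'D_v (fun y => phi (f y)) x = derive1 phi (f x) * 'D_v f x.
Proof.
move=> /derivable1_diffP dphi df; rewrite derive_chain //.
by rewrite (derive_real _ dphi) -[_ *: _]/(_ * _) mulrC.
Qed.

Lemma smooth_rVZ (a : V -> R) (b : V -> 'rV[R]_3) x :
  smooth_at a x -> smooth_at b x -> smooth_at (fun y => a y *: b y) x.
Proof.
move=> Ha Hb; apply: smooth_rV => i.
apply: (@smooth_ext _ _ _ (fun y => a y * b y 0 i)).
  by apply: nearW => y; rewrite mxE.
by apply: smooth_mul => //; exact: smooth_ec.
Qed.

Lemma derive_rVZ (a : V -> R) (b : V -> 'rV[R]_3) x v :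
  smooth_at a x -> smooth_at b x ->
  'D_v (fun y => a y *: b y) x = 'D_v a x *: b x + a x *: 'D_v b x.
Proof.
move=> Ha Hb; apply/rowP => i; rewrite !mxE.
rewrite -derive_ec; last by apply: smooth_diff; exact: smooth_rVZ.
have -> : (fun y => (a y *: b y) 0 i) = (fun y => a y * b y 0 i).
  by apply/funext => y; rewrite mxE.
rewrite derive_mul; [|exact: smooth_diff|by apply: smooth_diff; exact: smooth_ec].
by rewrite derive_ec //; exact: smooth_diff.
Qed.

Lemma dotE (u w : 'rV[R]_3) :
  dot u w = u 0 0 * w 0 0 + u 0 1 * w 0 1 + u 0 (inord 2) * w 0 (inord 2).
Proof. by rewrite /dot sum3. Qed.

Lemma smooth_dot (a b : V -> 'rV[R]_3) x :
  smooth_at a x -> smooth_at b x -> smooth_at (fun y => dot (a y) (b y)) x.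
Proof.
move=> Ha Hb.
apply: (@smooth_ext _ _ _ (fun y => a y 0 0 * b y 0 0 + a y 0 1 * b y 0 1
   + a y 0 (inord 2) * b y 0 (inord 2))).
  by apply: nearW => y; rewrite dotE.
by do 2?[apply: smooth_add]; apply: smooth_mul; exact: smooth_ec.
Qed.

Lemma derive_dot (a b : V -> 'rV[R]_3) x v :
  smooth_at a x -> smooth_at b x ->
  'D_v (fun y => dot (a y) (b y)) x = dot ('D_v a x) (b x) + dot (a x) ('D_v b x).
Proof.
move=> Ha Hb.
have -> : (fun y => dot (a y) (b y)) = (fun y => a y 0 0 * b y 0 0 + a y 0 1 * b y 0 1
   + a y 0 (inord 2) * b y 0 (inord 2)).
  by apply/funext => y; rewrite dotE.
have Sa i := smooth_ec i Ha; have Sb i := smooth_ec i Hb.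
rewrite !derive_add; try by apply: smooth_diff; do ?[apply: smooth_add]; exact: smooth_mul.
rewrite !derive_mul; try exact: smooth_diff.
rewrite !derive_ec; try exact: smooth_diff.
by rewrite !dotE; ring.
Qed.

End FromV.

Lemma dotC (u w : 'rV[R]_3) : dot u w = dot w u.
Proof. by rewrite /dot; apply: eq_bigr => i _; rewrite mulrC. Qed.
Lemma dotDl (u v w : 'rV[R]_3) : dot (u + v) w = dot u w + dot v w.
Proof. by rewrite !dotE !mxE; ring. Qed.
Lemma dotZl a (u w : 'rV[R]_3) : dot (a *: u) w = a * dot u w.
Proof. by rewrite !dotE !mxE; ring. Qed.
Lemma dotDr (u v w : 'rV[R]_3) : dot w (u + v) = dot w u + dot w v.
Proof. by rewrite !dotE !mxE; ring. Qed.
Lemma dotZr a (u w : 'rV[R]_3) : dot w (a *: u) = a * dot w u.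
Proof. by rewrite !dotE !mxE; ring. Qed.
Lemma dotNr (u w : 'rV[R]_3) : dot w (- u) = - dot w u.
Proof. by rewrite !dotE !mxE; ring. Qed.
Lemma dot0l (w : 'rV[R]_3) : dot 0 w = 0.
Proof. by rewrite !dotE !mxE; ring. Qed.
Lemma dot0r (w : 'rV[R]_3) : dot w 0 = 0.
Proof. by rewrite !dotE !mxE; ring. Qed.
Lemma dot_ge0 (w : 'rV[R]_3) : 0 <= dot w w.
Proof. by rewrite /dot; apply: sumr_ge0 => i _; rewrite -expr2 sqr_ge0. Qed.
Lemma dot_eq0 (w : 'rV[R]_3) : dot w w = 0 -> w = 0.
Proof.
move=> H; apply/rowP => i; rewrite mxE; apply/eqP; rewrite -sqrf_eq0 expr2.
apply/eqP; move: H => /eqP; rewrite /dot psumr_eq0 => [/allP /(_ i)|j _].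
  by rewrite mem_index_enum => /(_ isT) /eqP.
by rewrite -expr2 sqr_ge0.
Qed.


End Coordinates.

(** * Zero sets of transversal functions *)

Section ImplicitDirection.
Context {R : realType} {V : normedModType R}.

Lemma le_all_eps (a C : R) : 0 <= C ->
  (forall e, 0 < e <= 1 -> `|a| <= e * C) -> a = 0.
Proof.
move=> C0 H; apply/eqP; rewrite -normr_le0; apply/ler_addgt0Pl => e e0; rewrite addr0.
have C1 : 0 < C + 1 by rewrite ltr_wpDl.
have d0 : 0 < Num.min (e / (C + 1)) 1 by rewrite lt_min divr_gt0 // ltr01.
have := H (Num.min (e / (C + 1)) 1); rewrite d0 ge_min lexx orbT => /(_ isT) /le_trans; apply.
have : Num.min (e / (C + 1)) 1 <= e / (C + 1) by rewrite ge_min lexx.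
move=> /(ler_wpM2r C0) /le_trans; apply.
rewrite -mulrA ler_piMr ?(ltW e0) // mulrC ler_pdivrMr // mul1r; lra.
Qed.

(** This replaces the implicit function theorem: since [f] changes sign along
    [w], the intermediate value theorem gives a zero of [f] at [q + s *: v + u
    *: w] with [u] negligible with respect to [s], and [F] vanishes there. *)
Lemma implicit_dir (f F : V -> R) q v w :
  f q = 0 -> (\forall y \near q, {for y, continuous f}) ->
  differentiable f q -> differentiable F q ->
  'D_v f q = 0 -> 'D_w f q != 0 ->
  (\forall y \near q, f y = 0 -> F y = 0) -> 'D_v F q = 0.
Proof.
wlog w1 : w / 'D_w f q = 1.
  move=> IH fq fc df dF Dv Dw nF.
  apply: (IH (('D_w f q)^-1 *: w)) => //; rewrite derive_dirZ // -[_ *: _]/(_ * _) mulVf //.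
move=> fq fc df dF Dv _ nF.
have Fq : F q = 0 by exact: (nbhs_singleton nF).
apply: (@le_all_eps _ (1 + `|'D_w F q|)); first by rewrite addr_ge0.
move=> e /andP[e0 e1].
set K := `|v| + `|w|.
have K0 : 0 <= K by rewrite addr_ge0.
have K1 : 0 < K + 1 by rewrite ltr_wpDl.
have e'0 : 0 < e / (K + 1) by rewrite divr_gt0.
have [d /= d0 Hd] := (nbhs_ballP _ _).1 (filterI (filterI fc nF)
  (filterI (differentiableW df e'0) (differentiableW dF e'0))).
(* The points [g u] with [`|u| <= e * s] stay within distance [s * K] of [q]. *)
have [s [s0 sK]] : exists s, 0 < s /\ s * K < d.
  exists (d / (2 * (K + 1))); split; first by rewrite divr_gt0 // mulr_gt0.
  have -> : d / (2 * (K + 1)) * K = d * (K / (2 * (K + 1))) by field; rewrite gt_eqF.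
  rewrite gtr_pMr // ltr_pdivrMr ?mulr_gt0 // mul1r; lra.
pose g (u : R) : V := q + s *: v + u *: w.
have gq u : g u - q = s *: v + u *: w by rewrite /g addrC !addrA addNr add0r.
have gn u : - (e * s) <= u <= e * s -> `|g u - q| <= s * K.
  rewrite -ler_norml => Hu; rewrite gq.
  apply: le_trans (ler_normD _ _) _; rewrite !normrZ (gtr0_norm s0) /K mulrDr lerD2l.
  apply: ler_wpM2r => //; apply: (le_trans Hu).
  by rewrite ler_piMl // (ltW s0).
have gb u : - (e * s) <= u <= e * s -> ball q d (g u).
  by move=> /gn H; rewrite -ball_normE /= distrC; apply: le_lt_trans sK.
have es0 : 0 < e * s by rewrite mulr_gt0.
have dfg u : 'd f q (g u - q) = u.
  by rewrite gq linearD !linearZ /= -!deriveE // Dv w1 -![_ *: _]/(_ * _) mulr0 add0r mulr1.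
have dFg u : 'd F q (g u - q) = s * 'D_v F q + u * 'D_w F q.
  by rewrite gq linearD !linearZ /= -!deriveE.
have bnd : e / (K + 1) * (s * K) <= e * s.
  have -> : e / (K + 1) * (s * K) = e * s * (K / (K + 1)) by field; rewrite gt_eqF.
  rewrite ler_piMr ?(ltW es0) // ler_pdivrMr // mul1r; lra.
have fg u : - (e * s) <= u <= e * s -> `|f (g u) - u| <= e * s.
  move=> Hu; have [_ [/= H _]] := Hd _ (gb u Hu).
  move: H; rewrite fq subr0 dfg => /le_trans; apply.
  by apply: le_trans bnd; apply: ler_wpM2l; [exact: ltW|exact: gn].
have [u us fu] : exists2 u, u \in `[- (e * s), e * s] & f (g u) = 0.
  have le : - (e * s) <= e * s by rewrite ge0_cp // ltW.
  apply: (@IVT _ (f \o g)) => //.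
    apply: continuous_in_subspaceT => u; rewrite inE /= in_itv /= => Hu.
    apply: continuous_comp; last by case: (Hd _ (gb u Hu)) => -[].
    apply: differentiable_continuous; apply/derivable1_diffP.
    exact: (@ex_derive _ _ _ _ _ _ _ (is_derive_line _ _ _)).
  have h1 : - (e * s) <= - (e * s) <= e * s by rewrite lexx.
  have h2 : - (e * s) <= e * s <= e * s by rewrite lexx le.
  have := fg _ h1; have := fg _ h2; rewrite !ler_norml => /andP[H2 _] /andP[_ H1].
  rewrite /= ge_min le_max; apply/andP; split; apply/orP; [left|right]; move: H1 H2; lra.
move: us; rewrite in_itv /= => us.
have [[_ /(_ fu) Fu] [_ /= H]] := Hd _ (gb u us).
move: H; rewrite Fu Fq dFg subr0 sub0r normrN => H.
have {}H := le_trans H (ler_wpM2l (ltW e'0) (gn u us)).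
have {}H := le_trans H bnd.
have H3 : `|u * 'D_w F q| <= e * s * `|'D_w F q|.
  rewrite normrM; apply: ler_wpM2r => //; by rewrite ler_norml.
rewrite -(ler_pM2l s0) -[X in X * `|_|]gtr0_norm // -normrM.
have -> : s * 'D_v F q = (s * 'D_v F q + u * 'D_w F q) - u * 'D_w F q by ring.
apply: le_trans (ler_normB _ _) _.
have -> : s * (e * (1 + `|'D_w F q|)) = e * s + e * s * `|'D_w F q| by ring.
exact: (lerD H H3).
Qed.

End ImplicitDirection.

(** * Derivatives along vector fields *)

Section IsDerive.
Context {R : realType} {V : normedModType R}.

Lemma smooth_is_derive (W : normedModType R) (f : V -> W) x v :
  smooth_at f x -> is_derive x v f ('D_v f x).
Proof. by move=> H; apply: derivableP; apply: diff_derivable; exact: smooth_diff. Qed.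

Lemma is_derive_addf (W : normedModType R) (f g : V -> W) x v df dg :
  is_derive x v f df -> is_derive x v g dg ->
  is_derive x v (fun y => f y + g y) (df + dg).
Proof. by move=> Hf Hg; exact: is_deriveD. Qed.

Lemma is_derive_oppf (W : normedModType R) (f : V -> W) x v df :
  is_derive x v f df -> is_derive x v (fun y => - f y) (- df).
Proof. by move=> Hf; exact: is_deriveN. Qed.

Lemma is_derive_mulf (f g : V -> R) x v (df dg : R) :
  is_derive x v f df -> is_derive x v g dg ->
  is_derive x v (fun y => f y * g y) (df * g x + f x * dg).
Proof.
move=> Hf Hg; have -> : df * g x + f x * dg = f x *: dg + g x *: df.
  by rewrite -![_ *: _]/(_ * _) addrC [g x * _]mulrC.
exact: (@is_deriveM _ _ f g x v df dg Hf Hg).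
Qed.

End IsDerive.

Section Fields.
Context {R : realType}.
Local Notation amb := (@ambient R).

Definition er : amb := mk 1 0 0.
Definition ei (i : 'I_3) : amb := mk 0 (delta_mx 0 i) 0.

Lemma amb_basis (w : amb) : w = rc w *: er + (xc w 0 0 *: ei 0 + xc w 0 1 *: ei 1
   + xc w 0 (inord 2) *: ei (inord 2)) + tc w *: partial_t.
Proof.
rewrite [LHS]mkE /mk; congr (_, _, _) => /=.
- by rewrite -![_ *: _]/(_ * _) mulr1 !mulr0 !addr0.
- by rewrite [xc w in LHS]row_sum_delta sum3 !scaler0 add0r addr0.
- by rewrite -![_ *: _]/(_ * _) mulr1 !mulr0 !addr0 add0r.
Qed.

Lemma derive_basis (f : amb -> R) y w : differentiable f y ->
  'D_w f y = rc w * 'D_er f y + (xc w 0 0 * 'D_(ei 0) f y + xc w 0 1 * 'D_(ei 1) f y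
   + xc w 0 (inord 2) * 'D_(ei (inord 2)) f y) + tc w * 'D_partial_t f y.
Proof. by move=> df; rewrite [in LHS](amb_basis w) !derive_dirD // !derive_dirZ. Qed.

Lemma smooth_Dfield (f : amb -> R) (X : amb -> amb) x :
  smooth_at f x -> smooth_at X x -> smooth_at (fun y => 'D_(X y) f y) x.
Proof.
move=> Hf HX.
apply: (@smooth_ext _ _ _ (fun y => rc (X y) * 'D_er f y +
    (xc (X y) 0 0 * 'D_(ei 0) f y + xc (X y) 0 1 * 'D_(ei 1) f y
     + xc (X y) 0 (inord 2) * 'D_(ei (inord 2)) f y) + tc (X y) * 'D_partial_t f y)).
  by apply: filterS (smooth_near Hf) => y /smooth_diff/(derive_basis (X y)) <-.
by do !apply: smooth_add; apply: smooth_mul; do ?apply: smooth_D => //;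
  do ?[apply: smooth_ec; apply: smooth_xc|apply: smooth_rc|apply: smooth_tc].
Qed.

Lemma derive_Dfield (f : amb -> R) (X : amb -> amb) x u :
  smooth_at f x -> smooth_at X x ->
  'D_u (fun y => 'D_(X y) f y) x = 'D_u ('D_(X x) f) x + 'D_('D_u X x) f x.
Proof.
move=> Hf HX.
have E1 : 'D_u (fun y => 'D_(X y) f y) x = 'D_u (fun y => rc (X y) * 'D_er f y + (xc (X y) 0 0 * 'D_(ei 0) f y + xc (X y) 0 1 * 'D_(ei 1) f y
   + xc (X y) 0 (inord 2) * 'D_(ei (inord 2)) f y) + tc (X y) * 'D_partial_t f y) x.
  apply: near_eq_derive.
  by apply: filterS (smooth_near Hf) => y /smooth_diff/(derive_basis (X y)) ->.
have E2 : 'D_u ('D_(X x) f) x = 'D_u (fun y => rc (X x) * 'D_er f y + (xc (X x) 0 0 * 'D_(ei 0) f y + xc (X x) 0 1 * 'D_(ei 1) f y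
   + xc (X x) 0 (inord 2) * 'D_(ei (inord 2)) f y) + tc (X x) * 'D_partial_t f y) x.
  apply: near_eq_derive.
  by apply: filterS (smooth_near Hf) => y /smooth_diff/(derive_basis (X x)) ->.
apply: (etrans E1); apply: (etrans _ (esym
  (congr2 +%R E2 (derive_basis ('D_u X x) (smooth_diff Hf))))).
have sm (a b : amb -> R) : smooth_at a x -> smooth_at b x -> smooth_at (fun y => a y * b y) x.
  exact: smooth_mul.
have Sr : smooth_at (fun y => rc (X y)) x by apply: smooth_rc.
have St : smooth_at (fun y => tc (X y)) x by apply: smooth_tc.
have Se i : smooth_at (fun y => xc (X y) 0 i) x by apply: smooth_ec; apply: smooth_xc.
have SD e : smooth_at ('D_e f) x by exact: smooth_D.
have Sc (c : R) : smooth_at (fun _ : amb => c) x by exact: smooth_cst.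
have comb5 (a1 b1 a2 b2 a3 b3 a4 b4 a5 b5 : amb -> R) :
    smooth_at a1 x -> smooth_at b1 x -> smooth_at a2 x -> smooth_at b2 x ->
    smooth_at a3 x -> smooth_at b3 x -> smooth_at a4 x -> smooth_at b4 x ->
    smooth_at a5 x -> smooth_at b5 x ->
    'D_u (fun y => a1 y * b1 y + (a2 y * b2 y + a3 y * b3 y + a4 y * b4 y) + a5 y * b5 y) x =
    ('D_u a1 x * b1 x + a1 x * 'D_u b1 x) + (('D_u a2 x * b2 x + a2 x * 'D_u b2 x)
     + ('D_u a3 x * b3 x + a3 x * 'D_u b3 x) + ('D_u a4 x * b4 x + a4 x * 'D_u b4 x))
     + ('D_u a5 x * b5 x + a5 x * 'D_u b5 x).
  move=> *; apply: derive_val.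
  by apply: is_derive_addf; [apply: is_derive_addf; [|do 2?apply: is_derive_addf]|];
    apply: is_derive_mulf; exact: smooth_is_derive.
rewrite !comb5 //.
rewrite !derive_cst.
rewrite derive_rc; last exact: smooth_diff.
rewrite derive_tc; last exact: smooth_diff.
rewrite !derive_ec; try by apply: smooth_diff; exact: smooth_xc.
rewrite derive_xc; last exact: smooth_diff.
have alg (a1 a2 a3 a4 a5 d1 d2 d3 d4 d5 r1 r2 r3 r4 r5 e1 e2 e3 e4 e5 : R) :
  (a1 * d1 + r1 * e1) + ((a2 * d2 + r2 * e2) + (a3 * d3 + r3 * e3) + (a4 * d4 + r4 * e4))
    + (a5 * d5 + r5 * e5) =
  ((0 * d1 + r1 * e1) + ((0 * d2 + r2 * e2) + (0 * d3 + r3 * e3) + (0 * d4 + r4 * e4))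
    + (0 * d5 + r5 * e5)) + (a1 * d1 + (a2 * d2 + a3 * d3 + a4 * d4) + a5 * d5) by ring.
exact: alg.
Qed.

(** By the symmetry of second derivatives, the commutator only retains the
    derivatives of the two fields. *)
Lemma bracket_derive (f : amb -> R) (X Y : amb -> amb) x :
  smooth_at f x -> smooth_at X x -> smooth_at Y x ->
  'D_(X x) (fun y => 'D_(Y y) f y) x - 'D_(Y x) (fun y => 'D_(X y) f y) x =
  'D_('D_(X x) Y x - 'D_(Y x) X x) f x.
Proof.
move=> Hf HX HY; rewrite (derive_Dfield (X x) Hf HY) (derive_Dfield (Y x) Hf HX).
have df := smooth_diff Hf.
rewrite (schwarz (Y x) (X x) Hf) -(scaleN1r ('D_(Y x) X x)).
rewrite (derive_dirD _ _ df) (derive_dirZ _ _ df).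
have alg (a b c : R) : a + b - (a + c) = b + -1 * c by ring.
exact: alg.
Qed.

End Fields.

(** * Vectors tangent to the spacetime and to its hypersurfaces *)

Section SphereRetraction.
Context {R : realType} (I : set R) (I_open : open I).
Local Notation amb := (@ambient R).
Local Notation M := (spacetime I).

Lemma smooth_rc_id (q : amb) : smooth_at rc q.
Proof. exact: smooth_rc (smooth_id q). Qed.
Lemma smooth_xc_id (q : amb) : smooth_at xc q.
Proof. exact: smooth_xc (smooth_id q). Qed.
Lemma smooth_tc_id (q : amb) : smooth_at tc q.
Proof. exact: smooth_tc (smooth_id q). Qed.

Lemma derive_rc_id (q v : amb) : 'D_v rc q = rc v.
Proof.
rewrite -[rc]/(fun y => rc (id y)) (@derive_rc _ _ id) ?derive_id //.
Qed.
Lemma derive_xc_id (q v : amb) : 'D_v xc q = xc v.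
Proof.
rewrite -[xc]/(fun y => xc (id y)) (@derive_xc _ _ id) ?derive_id //.
Qed.
Lemma derive_tc_id (q v : amb) : 'D_v tc q = tc v.
Proof.
rewrite -[tc]/(fun y => tc (id y)) (@derive_tc _ _ id) ?derive_id //.
Qed.

(** A retraction onto the spacetime. It transports functions on the
    submanifold to the ambient vector space, where directions can be varied
    freely. *)
Definition normalize (q : amb) : amb :=
  mk (rc q) ((Num.sqrt (dot (xc q) (xc q)))^-1 *: xc q) (tc q).

Lemma normalizeM q : I (rc q) -> 0 < dot (xc q) (xc q) -> M (normalize q).
Proof.
move=> Iq q0; split=> //=; rewrite dotZl dotZr mulrA -expr2 exprVn sqr_sqrtr ?ltW //.
by rewrite mulVf // gt_eqF.
Qed.

Lemma normalize_id q : M q -> normalize q = q.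
Proof.
move=> [_ d1]; rewrite /normalize [dot _ _]d1 sqrtr1 invr1 scale1r; exact/esym/mkE.
Qed.

Lemma dot1 q : M q -> dot (xc q) (xc q) = 1. Proof. by case. Qed.

Lemma smooth_norm q : M q ->
  smooth_at (fun y => (Num.sqrt (dot (xc y) (xc y)))^-1) q.
Proof.
move=> /dot1 Mq.
have dp : 0 < dot (xc q) (xc q) by rewrite Mq ltr01.
apply: smooth_inv; first by rewrite gt_eqF // sqrtr_gt0.
by apply: smooth_sqrt => //; apply: smooth_dot; exact: smooth_xc_id.
Qed.

Lemma smooth_normalize q : M q -> smooth_at normalize q.
Proof.
move=> Mq; apply: smooth_mk; [exact: smooth_rc_id| |exact: smooth_tc_id].
by apply: smooth_rVZ; [exact: smooth_norm|exact: smooth_xc_id].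
Qed.

Lemma derive_normalize q v : M q -> dot (xc q) (xc v) = 0 -> 'D_v normalize q = v.
Proof.
move=> Mq vq.
have Sx := smooth_xc_id q.
have Sn := smooth_norm Mq.
have Mq1 := dot1 Mq.
rewrite derive_mk; [|exact: smooth_rc_id|exact: smooth_rVZ|exact: smooth_tc_id].
rewrite derive_rc_id derive_tc_id derive_rVZ // derive_xc_id.
set N := fun y : amb => _.
have N1 : N q = 1 by rewrite /N Mq1 sqrtr1 invr1.
have DN : 'D_v N q = 0.
  have Sd : smooth_at (fun y : amb => dot (xc y) (xc y)) q by exact: smooth_dot.
  have E : \forall y \near q, N y * N y * dot (xc y) (xc y) = 1.
    have : \forall y \near q, 0 < dot (xc y) (xc y).
      by apply: cvgr_gt (smooth_cont Sd) _ _; rewrite Mq1.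
    apply: filterS => y y0; rewrite /N -expr2 exprVn sqr_sqrtr ?ltW //.
    by rewrite mulVf // gt_eqF.
  have := near_eq_derive v E; rewrite derive_cst.
  have H := is_derive_mulf (is_derive_mulf (smooth_is_derive v Sn) (smooth_is_derive v Sn))
    (smooth_is_derive v Sd).
  rewrite (@derive_val _ _ _ _ _ _ _ H) derive_dot // derive_xc_id -/(N q) N1 vq dotC vq Mq1.
  have alg (a : R) : (a * 1 + 1 * a) * 1 + 1 * 1 * (0 + 0) = 0 -> a = 0 by lra.
  exact: alg.
rewrite [(Num.sqrt _)^-1]N1 DN scale0r add0r scale1r; exact/esym/mkE.
Qed.

Lemma near_normalize q : M q -> \forall y \near q, M (normalize y).
Proof.
move=> Mq; have [Iq _] := Mq.
have H1 : \forall y \near q, I (rc y).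
  by apply: (smooth_cont (smooth_rc_id q)); apply: open_nbhs_nbhs.
have H2 : \forall y \near q, 0 < dot (xc y) (xc y).
  apply: cvgr_gt (smooth_cont (smooth_dot (smooth_xc_id q) (smooth_xc_id q))) _ _.
  by rewrite (dot1 Mq).
by apply: filterS2 H1 H2 => y; exact: normalizeM.
Qed.

Lemma near_comp_normalize q (P : amb -> Prop) : M q ->
  (\forall y \near q, P y) -> \forall y \near q, P (normalize y).
Proof.
move=> Mq HP.
have H : normalize y @[y --> q] --> q.
  by rewrite -[X in _ --> X](normalize_id Mq); exact: smooth_cont (smooth_normalize Mq).
exact: H.
Qed.

Lemma derive_comp_normalize (F : amb -> R) q v : M q -> dot (xc q) (xc v) = 0 ->
  differentiable F q -> 'D_v (fun y => F (normalize y)) q = 'D_v F q.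
Proof.
move=> Mq vq dF; rewrite (@derive_chain _ _ _ _ F normalize).
- by rewrite derive_normalize // normalize_id.
- exact: smooth_diff (smooth_normalize Mq).
- by rewrite normalize_id.
Qed.

(** The function [F \o normalize] vanishes in a whole neighborhood of [q], and
    has the same derivative as [F] along [v]. *)
Lemma sphere_derive0 (F : amb -> R) q v : M q -> dot (xc q) (xc v) = 0 ->
  differentiable F q -> (\forall y \near q, M y -> F y = 0) -> 'D_v F q = 0.
Proof.
move=> Mq vq dF HF; rewrite -(derive_comp_normalize Mq vq dF).
rewrite (@near_eq_derive _ _ _ _ (fun=> 0)) ?derive_cst //.
apply: filterS2 (near_normalize Mq) (near_comp_normalize Mq HF) => y My; exact.
Qed.

(** The equation of the sphere is the test function for the direct
    implication. *)
Lemma tangent_spacetime q v : M q -> tangent M q v <-> dot (xc q) (xc v) = 0.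
Proof.
move=> Mq; split=> [T|vq F sF HF]; last first.
  exact: sphere_derive0 (smooth_diff sF) HF.
have Sd := smooth_dot (smooth_xc_id q) (smooth_xc_id q).
have S : smooth_at (fun y : amb => dot (xc y) (xc y) - 1) q.
  by apply: smooth_sub => //; exact: smooth_cst.
have := T _ S; have -> : 'D_v (fun y : amb => dot (xc y) (xc y) - 1) q = 2 * dot (xc q) (xc v).
  have H := is_derive_addf (smooth_is_derive v Sd) (is_derive_cst (- 1 : R) q v).
  rewrite (@derive_val _ _ _ _ _ _ _ H) derive_dot; try exact: smooth_xc_id.
  by rewrite derive_xc_id [dot (xc v) _]dotC; ring.
have HH : \forall y \near q, M y -> dot (xc y) (xc y) - 1 = 0.
  by apply: (@filterE _ (nbhs q)) => y /dot1 ->; rewrite subrr.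
by move=> /(_ HH); lra.
Qed.

Definition defining (L : set amb) q (f : amb -> R) :=
  [/\ smooth_at f q, exists2 v, dot (xc q) (xc v) = 0 & 'D_v f q != 0 &
      \forall y \near q, M y -> (L y <-> f y = 0)].

Lemma hypersurface_defining L q : hypersurface M L -> L q -> exists f, defining L q f.
Proof.
move=> [LM H] Lq; have [f [Sf [v Tv Dv] Nf]] := H q Lq; exists f; split=> //.
by exists v => //; apply/tangent_spacetime => //; exact: LM.
Qed.

(** Composition with [normalize] reduces the claim to [implicit_dir] in the
    ambient space. *)
Lemma hyper_derive0 L q f (F : amb -> R) v : L `<=` M -> L q -> defining L q f ->
  dot (xc q) (xc v) = 0 -> 'D_v f q = 0 -> differentiable F q ->
  (\forall y \near q, L y -> F y = 0) -> 'D_v F q = 0.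
Proof.
move=> LM Lq [Sf [w wq Dw] Nf] vq Dv dF HF.
have Mq := LM _ Lq.
rewrite -(derive_comp_normalize Mq vq dF).
have dn := smooth_diff (smooth_normalize Mq).
apply: (@implicit_dir _ _ (fun y => f (normalize y)) _ q v w).
- by rewrite normalize_id //; apply: (nbhs_singleton Nf Mq).1.
- have H1 := smooth_near (smooth_normalize Mq).
  have H2 := near_comp_normalize Mq (smooth_near Sf).
  apply: filterS2 H1 H2 => y S1 S2.
  exact: (@continuous_comp _ _ _ normalize f y (smooth_cont S1) (smooth_cont S2)).
- apply: (@differentiable_comp _ _ _ _ normalize f) => //.
  by rewrite normalize_id //; exact: smooth_diff.
- apply: (@differentiable_comp _ _ _ _ normalize F) => //.
  by rewrite normalize_id.
- by rewrite derive_comp_normalize //; exact: smooth_diff.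
- by rewrite derive_comp_normalize //; exact: smooth_diff.
- have H1 := near_comp_normalize Mq Nf; have H2 := near_comp_normalize Mq HF.
  by apply: filterS3 (near_normalize Mq) H1 H2 => y My /(_ My) [_ K1] K2 /K1 /K2.
Qed.

Lemma tangent_hyper L q f v : L `<=` M -> L q -> defining L q f ->
  tangent L q v <-> dot (xc q) (xc v) = 0 /\ 'D_v f q = 0.
Proof.
move=> LM Lq df; have Mq := LM _ Lq; split=> [T|[vq Dv] F SF HF].
  split.
    apply/(tangent_spacetime v Mq) => F SF HF; apply: T => //.
    by apply: filterS HF => y + /LM; apply.
  case: df => Sf _ Nf; apply: T => //.
  by apply: filterS Nf => y Ny Ly; apply: (Ny (LM _ Ly)).1.
exact: hyper_derive0 LM Lq df vq Dv (smooth_diff SF) HF.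
Qed.

Lemma tangent_diff L q v (F : amb -> R) : hypersurface M L -> L q -> tangent L q v ->
  differentiable F q -> (\forall y \near q, L y -> F y = 0) -> 'D_v F q = 0.
Proof.
move=> HL Lq Tv dF HF; have [f df] := hypersurface_defining HL Lq.
have [vq Dv] := (tangent_hyper v HL.1 Lq df).1 Tv.
exact: hyper_derive0 HL.1 Lq df vq Dv dF HF.
Qed.

(** Derivatives along [L] of a function given on [L] can be computed with any
    extension. *)
Lemma tangent_diff_eq L q v (F G : amb -> R) : hypersurface M L -> L q -> tangent L q v ->
  differentiable F q -> differentiable G q ->
  (\forall y \near q, L y -> F y = G y) -> 'D_v F q = 'D_v G q.
Proof.
move=> HL Lq Tv dF dG HF; apply/eqP; rewrite -subr_eq0.
have <- : 'D_v (fun y => F y - G y) q = 'D_v F q - 'D_v G q.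
  by rewrite derive_add ?derive_opp //; exact: differentiableN.
apply/eqP; apply: (tangent_diff HL Lq Tv).
  by apply: differentiableB.
by apply: filterS HF => y H /H ->; rewrite subrr.
Qed.

Lemma tangent_sub L q v : hypersurface M L -> L q -> tangent L q v -> dot (xc q) (xc v) = 0.
Proof.
move=> HL Lq Tv; have [f df] := hypersurface_defining HL Lq.
by have [] := (tangent_hyper v HL.1 Lq df).1 Tv.
Qed.

(** Fields tangent to [L] send the functions that vanish on [L] to functions
    that vanish on [L], hence so does their commutator. *)
Lemma tangent_bracket L q (X Y : amb -> amb) : hypersurface M L -> L q ->
  smooth_at X q -> smooth_at Y q ->
  (\forall y \near q, L y -> tangent L y (X y)) ->
  (\forall y \near q, L y -> tangent L y (Y y)) ->
  tangent L q ('D_(X q) Y q - 'D_(Y q) X q).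
Proof.
move=> HL Lq SX SY TX TY f Sf Nf; rewrite -bracket_derive //.
have Nf2 := near_join Nf; have Sf2 := smooth_near Sf.
have ZX : \forall y \near q, L y -> 'D_(X y) f y = 0.
  by apply: filterS3 TX Nf2 Sf2 => y H1 H2 H3 Ly; apply: (H1 Ly).
have ZY : \forall y \near q, L y -> 'D_(Y y) f y = 0.
  by apply: filterS3 TY Nf2 Sf2 => y H1 H2 H3 Ly; apply: (H1 Ly).
have TXq := nbhs_singleton TX Lq; have TYq := nbhs_singleton TY Lq.
rewrite (TXq _ (smooth_Dfield Sf SY) ZY) (TYq _ (smooth_Dfield Sf SX) ZX).
by rewrite subrr.
Qed.

End SphereRetraction.

(** * The Levi-Civita connection on screen vectors *)

Section Connection.
Context {R : realType} (I : set R) (h : R -> R).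
Hypothesis I_open : open I.
Hypothesis I_pos : I `<=` [set r | 0 < r].
Hypothesis h_smooth : forall (n : nat) (r : R), I r -> derivable (derive1n n h) r 1.
Hypothesis h_pos : forall r : R, I r -> 0 < h r.
Local Notation amb := (@ambient R).
Local Notation M := (spacetime I).
Local Notation g := (metric h).
Local Notation h' := (derive1 h).

Lemma metricE q u v : g q u v = rc u * rc v / h (rc q)
  + rc q ^+ 2 * dot (xc u) (xc v) - h (rc q) * (tc u * tc v).
Proof. by []. Qed.

Lemma metricC q u v : g q u v = g q v u.
Proof. by rewrite !metricE dotC [rc u * _]mulrC [tc u * _]mulrC. Qed.

Lemma metricDl q u v w : g q (u + v) w = g q u w + g q v w.
Proof.
rewrite !metricE [rc _]linearD [xc _]linearD [tc _]linearD /= dotDl.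
ring.
Qed.

Lemma metricZl q a u w : g q (a *: u) w = a * g q u w.
Proof.
rewrite !metricE [rc _]linearZ [xc _]linearZ [tc _]linearZ /= dotZl -![_ *: _]/(_ * _).
ring.
Qed.

Lemma metricNl q u w : g q (- u) w = - g q u w.
Proof. by rewrite -scaleN1r metricZl mulN1r. Qed.

(** The Koszul formula: the three identities of compatibility with the metric,
    combined by means of the vanishing of the torsion. *)
Lemma koszul nabla (lc : levi_civita M g nabla) q (X U Z : amb -> amb) : M q ->
  vector_field_at M q X -> vector_field_at M q U -> vector_field_at M q Z ->
  2 * g q (nabla q (U q) X) (Z q) =
  'D_(U q) (fun y => g y (X y) (Z y)) q + 'D_(X q) (fun y => g y (U y) (Z y)) q
  - 'D_(Z q) (fun y => g y (U y) (X y)) q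
  + g q ('D_(U q) X q - 'D_(X q) U q) (Z q)
  - g q ('D_(U q) Z q - 'D_(Z q) U q) (X q)
  - g q ('D_(X q) Z q - 'D_(Z q) X q) (U q).
Proof.
move=> Mq VX VU VZ.
have [TX TU TZ] : [/\ tangent M q (X q), tangent M q (U q) & tangent M q (Z q)].
  by split; [case: VX|case: VU|case: VZ] => _ /nbhs_singleton /(_ Mq).
rewrite (lc_metric lc Mq TU VX VZ) (lc_metric lc Mq TX VU VZ) (lc_metric lc Mq TZ VU VX).
have tor A B C : vector_field_at M q A -> vector_field_at M q B ->
    g q (nabla q (A q) B) C - g q (nabla q (B q) A) C = g q ('D_(A q) B q - 'D_(B q) A q) C.
  move=> VA VB; have := congr1 (fun D => g q D C) (lc_torsion lc Mq VA VB).
  by rewrite metricDl metricNl.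
rewrite [g q (X q) (nabla _ _ Z)]metricC.
rewrite [g q (U q) (nabla _ _ Z)]metricC [g q (U q) (nabla _ _ X)]metricC.
have alg (a b c d e f A B C : R) : a - c = A -> b - e = B -> d - f = C ->
    2 * a = a + b + (c + d) - (e + f) + A - B - C.
  by move=> <- <- <-; ring.
exact: (alg _ _ _ _ _ _ _ _ _ (tor U X (Z q) VU VX) (tor U Z (X q) VU VZ)
  (tor X Z (U q) VX VZ)).
Qed.

Lemma smooth_h (q : amb) : I (rc q) -> smooth_at (fun y => h (rc y)) q.
Proof. by move=> Iq; apply: (smooth_comp1 I_open) => //; exact: smooth_rc_id. Qed.

Lemma derive_h (q v : amb) : I (rc q) -> 'D_v (fun y => h (rc y)) q = h' (rc q) * rc v.
Proof.
move=> Iq.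
rewrite (derive_phi v (@h_smooth 0%N _ Iq) (smooth_diff (smooth_rc_id q))).
by rewrite derive_rc_id.
Qed.

Lemma h_neq0 r : I r -> h r != 0. Proof. by move=> /h_pos; exact: lt0r_neq0. Qed.

Lemma derive_metric q v (A B : amb -> amb) : I (rc q) -> smooth_at A q -> smooth_at B q ->
  'D_v (fun y => g y (A y) (B y)) q = g q ('D_v A q) (B q) + g q (A q) ('D_v B q)
   + rc v * (2 * rc q * dot (xc (A q)) (xc (B q))
      - h' (rc q) * (rc (A q) * rc (B q) / h (rc q) ^+ 2 + tc (A q) * tc (B q))).
Proof.
move=> Iq SA SB; rewrite -[fun y => _]/(fun y => rc (A y) * rc (B y) * (h (rc y))^-1
  + rc y * rc y * dot (xc (A y)) (xc (B y)) - h (rc y) * (tc (A y) * tc (B y))).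
have dA := smooth_diff SA; have dB := smooth_diff SB.
have h0 := h_neq0 Iq.
have Hr := smooth_is_derive v (smooth_rc_id q).
have Hh := smooth_is_derive v (smooth_h Iq).
have Hh1 := smooth_is_derive v (smooth_inv h0 (smooth_h Iq)).
have HAr := smooth_is_derive v (smooth_rc SA).
have HBr := smooth_is_derive v (smooth_rc SB).
have HAt := smooth_is_derive v (smooth_tc SA).
have HBt := smooth_is_derive v (smooth_tc SB).
have Hd := smooth_is_derive v (smooth_dot (smooth_xc SA) (smooth_xc SB)).
have H := is_derive_addf (is_derive_addf (is_derive_mulf (is_derive_mulf HAr HBr) Hh1)
   (is_derive_mulf (is_derive_mulf Hr Hr) Hd))
   (is_derive_oppf (is_derive_mulf Hh (is_derive_mulf HAt HBt))).
rewrite (@derive_val _ _ _ _ _ _ _ H).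
rewrite derive_inv ?derive_h //; last exact: smooth_diff (smooth_h Iq).
rewrite (derive_rc _ dA) (derive_rc _ dB) (derive_tc _ dA) (derive_tc _ dB).
rewrite derive_dot; [|exact: smooth_xc|exact: smooth_xc].
rewrite (derive_xc _ dA) (derive_xc _ dB) derive_rc_id !metricE.
have alg (DAr DBr DAt DBt d1 d2 d Ar Br At Bt r k k' vr : R) : k != 0 ->
  (DAr * Br + Ar * DBr) * k^-1 + Ar * Br * - (k' * vr / k ^+ 2)
  + ((vr * r + r * vr) * d + r * r * (d1 + d2))
  + - (k' * vr * (At * Bt) + k * (DAt * Bt + At * DBt)) =
  (DAr * Br / k + r ^+ 2 * d1 - k * (DAt * Bt)) + (Ar * DBr / k + r ^+ 2 * d2 - k * (At * DBt))
  + vr * (2 * r * d - k' * (Ar * Br / k ^+ 2 + At * Bt)) by move=> k0; field.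
exact: alg.
Qed.

(** Extends a tangent vector at a point of the spacetime to a tangent field
    whose ambient derivatives at this point are normal to the sphere. *)
Definition tan_ext (u y : amb) : amb :=
  mk (rc u) (xc u + (- dot (xc y) (xc u)) *: xc y) (tc u).

Lemma tan_ext_id (u q : amb) : dot (xc q) (xc u) = 0 -> tan_ext u q = u.
Proof. by move=> E; rewrite /tan_ext E oppr0 scale0r addr0; exact/esym/mkE. Qed.

Lemma smooth_tan_ext (u q : amb) : smooth_at (tan_ext u) q.
Proof.
apply: smooth_mk; [exact: smooth_cst| |exact: smooth_cst].
apply: smooth_add; first exact: smooth_cst.
apply: smooth_rVZ; last exact: smooth_xc_id.
apply: smooth_opp; apply: smooth_dot; [exact: smooth_xc_id|exact: smooth_cst].
Qed.

Lemma derive_tan_ext (u q v : amb) : dot (xc q) (xc u) = 0 ->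
  'D_v (tan_ext u) q = mk 0 (- dot (xc v) (xc u) *: xc q) 0.
Proof.
move=> E.
have Sx := smooth_xc_id q; have Su := smooth_cst (xc u) q.
have Sd := smooth_dot Sx Su; have Sdn := smooth_opp Sd.
have Sz := smooth_rVZ Sdn Sx; have Sa := smooth_add Su Sz.
rewrite (derive_mk v (smooth_cst (rc u) q) Sa (smooth_cst (tc u) q)) !derive_cst.
rewrite (derive_add v (smooth_diff Su) (smooth_diff Sz)) derive_cst add0r.
rewrite (derive_rVZ v Sdn Sx) (derive_opp v (smooth_diff Sd)) (derive_dot v Sx Su).
by rewrite derive_cst derive_xc_id E oppr0 scale0r dot0r !addr0.
Qed.

Lemma field_tan_ext (u q : amb) : M q -> vector_field_at M q (tan_ext u).
Proof.
move=> Mq; split; first exact: smooth_tan_ext.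
apply: (@filterE _ (nbhs q)) => y My; apply/(tangent_spacetime I_open _ My).
by rewrite /tan_ext /= dotDr dotZr (dot1 My) mulr1 subrr.
Qed.

(** Half of the derivatives of the metric coefficients in the Koszul formula.
    The derivatives of the fields that extend [u] and [w] are normal to the
    sphere, hence contribute nothing. *)
Lemma nabla_screen nabla (lc : levi_civita M g nabla) q (X : amb -> amb) u w : M q ->
  vector_field_at M q X -> dot (xc q) (xc u) = 0 -> dot (xc q) (xc w) = 0 ->
  tc u = 0 -> tc w = 0 ->
  g q (nabla q u X) w = g q ('D_u X q) w
   + rc q * (rc u * dot (xc (X q)) (xc w) - rc w * dot (xc (X q)) (xc u)
             + rc (X q) * dot (xc u) (xc w))
   - rc (X q) * h' (rc q) / (2 * h (rc q) ^+ 2) * (rc u * rc w).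
Proof.
move=> Mq VX uq wq tu tw.
have [Iq _] := Mq.
have TX : tangent M q (X q) by case: VX => _ /nbhs_singleton /(_ Mq).
have Xq := (tangent_spacetime I_open _ Mq).1 TX.
have SX : smooth_at X q by case: VX.
have := koszul lc Mq VX (field_tan_ext u Mq) (field_tan_ext w Mq).
rewrite !tan_ext_id //.
have Su := smooth_tan_ext u q; have Sw := smooth_tan_ext w q.
rewrite !derive_metric // !derive_tan_ext // !tan_ext_id //.
rewrite !metricDl !metricNl [g q (X q) (mk _ _ _)]metricC [g q u (mk _ _ _)]metricC.
rewrite [g q u ('D_w X q)]metricC.
have g0 c v : dot (xc q) (xc v) = 0 -> g q (mk 0 (c *: xc q) 0) v = 0.
  by move=> E; rewrite metricE /= dotZl E !mul0r !mulr0 subr0 addr0.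
rewrite !g0 //.
rewrite tu tw (dotC (xc u) (xc (X q))).
have h0 := h_neq0 Iq.
have alg (N a b d1 d2 d3 Xr Xt r k k' ur wr : R) : k != 0 ->
  2 * N = (a + 0 + ur * (2 * r * d1 - k' * (Xr * wr / k ^+ 2 + Xt * 0)))
    + (0 + 0 + Xr * (2 * r * d2 - k' * (ur * wr / k ^+ 2 + 0 * 0)))
    - (0 + b + wr * (2 * r * d3 - k' * (ur * Xr / k ^+ 2 + 0 * Xt)))
    + (a - 0) - (0 - 0) - (0 - b) ->
  N = a + r * (ur * d1 - wr * d3 + Xr * d2) - Xr * k' / (2 * k ^+ 2) * (ur * wr).
  move=> k0 E; have -> : N = (2 * N) / 2 by field.
  by rewrite E; field.
move=> E; exact: alg h0 E.
Qed.

End Connection.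

(** * Null hypersurfaces *)

Section CoordinatesLinear.
Context {R : realType}.
Implicit Types (u v : @ambient R) (a : R).
Lemma rcD u v : rc (u + v) = rc u + rc v. Proof. by []. Qed.
Lemma rcN u : rc (- u) = - rc u. Proof. by []. Qed.
Lemma rcZ a u : rc (a *: u) = a * rc u. Proof. by []. Qed.
Lemma tcD u v : tc (u + v) = tc u + tc v. Proof. by []. Qed.
Lemma tcN u : tc (- u) = - tc u. Proof. by []. Qed.
Lemma tcZ a u : tc (a *: u) = a * tc u. Proof. by []. Qed.
Lemma xcD u v : xc (u + v) = xc u + xc v. Proof. by []. Qed.
Lemma xcN u : xc (- u) = - xc u. Proof. by []. Qed.
Lemma xcZ a u : xc (a *: u) = a *: xc u. Proof. by []. Qed.
Lemma amb_eq u v : rc u = rc v -> xc u = xc v -> tc u = tc v -> u = v.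
Proof. by move=> Er Ex Et; rewrite (mkE u) (mkE v) Er Ex Et. Qed.
End CoordinatesLinear.

Section NullHypersurfaces.
Context {R : realType} (I : set R) (h : R -> R).
Hypothesis I_open : open I.
Hypothesis I_pos : I `<=` [set r | 0 < r].
Hypothesis h_smooth : forall (n : nat) (r : R), I r -> derivable (derive1n n h) r 1.
Hypothesis h_pos : forall r : R, I r -> 0 < h r.
Local Notation amb := (@ambient R).
Local Notation M := (spacetime I).
Local Notation g := (metric h).
Local Notation h' := (derive1 h).

(** The metric is positive definite on vectors without time component. *)
Lemma null_spatial q z : M q -> g q z z = 0 -> tc z = 0 -> z = 0.
Proof.
move=> [Iq _]; rewrite metricE => + z0; rewrite z0 mulr0 mulr0 subr0.
have hq : 0 < h (rc q) by exact: h_pos.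
have rq : 0 < rc q by exact: I_pos.
move=> E.
have E1 : 0 <= rc z * rc z / h (rc q) by rewrite divr_ge0 ?(ltW hq) // -expr2 sqr_ge0.
have E2 : 0 <= rc q ^+ 2 * dot (xc z) (xc z) by rewrite mulr_ge0 ?sqr_ge0 ?dot_ge0.
have F1 : rc z * rc z / h (rc q) = 0 by lra.
have F2 : rc q ^+ 2 * dot (xc z) (xc z) = 0 by lra.
have G1 : rc z = 0.
  move/eqP: F1; rewrite mulf_eq0 invr_eq0 (gt_eqF hq) orbF mulf_eq0 orbb.
  by move/eqP.
have G2 : xc z = 0.
  apply: dot_eq0; move/eqP: F2; rewrite mulf_eq0 sqrf_eq0 (gt_eqF rq) /=.
  by move/eqP.
by rewrite [LHS]mkE G1 G2 z0.
Qed.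

Lemma metric_dt q u : g q u partial_t = - (h (rc q) * tc u).
Proof. by rewrite metricE /= !mulr0 mul0r dot0r mulr0 !add0r mulr1. Qed.

Lemma metric_dt0 q u : M q -> g q u partial_t = 0 <-> tc u = 0.
Proof.
move=> [Iq _]; rewrite metric_dt; split=> [/eqP|->]; last by rewrite mulr0 oppr0.
by rewrite oppr_eq0 mulf_eq0 (gt_eqF (h_pos Iq)) => /eqP.
Qed.

Section Normal.
Variables (L : set amb) (xi : amb -> amb) (q : amb).
Hypothesis HL : null_hypersurface M g L.
Hypothesis Hxi : null_field g L xi.
Hypothesis Lq : L q.

Let Mq : M q. Proof. by case: HL => -[LM _] _; exact: LM. Qed.

Lemma null_field_tc : tc (xi q) != 0.
Proof.
have [Tx x0 nx] := Hxi.2 q Lq; apply/eqP => t0; move/eqP: x0; apply.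
exact: null_spatial Mq nx t0.
Qed.

Lemma null_field_sphere : dot (xc q) (xc (xi q)) = 0.
Proof. have [Tx _ _] := Hxi.2 q Lq; exact: (tangent_sub I_open HL.1 Lq Tx). Qed.

(** Some null vector [v] is orthogonal to the whole tangent space of [L]. It
    is proportional to [xi q]: the combination of the two without time
    component is null, hence zero. *)
Lemma null_field_normal w : tangent L q w -> g q (xi q) w = 0.
Proof.
have [Tx x0 nx] := Hxi.2 q Lq.
have [v [Tv v0 Hv]] := HL.2 q Lq.
(* With this factor [v - c *: xi q] has no time component. *)
pose c := tc v / tc (xi q).
pose z := v - c *: xi q.
have gvx : g q v (xi q) = 0 by exact: Hv.
have gvv : g q v v = 0 by exact: Hv.
have z0 : z = 0.
  apply: (null_spatial Mq); last first.
    rewrite /z tcD tcN tcZ /c divfK ?subrr //.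
    exact: null_field_tc.
  rewrite /z -scaleNr metricDl metricZl [g q v _]metricC [g q (xi q) _]metricC.
  by rewrite !metricDl !metricZl nx gvv [g q (xi q) v]metricC gvx; ring.
move=> Tw; have := Hv w Tw.
have -> : v = c *: xi q by apply/eqP; rewrite -subr_eq0; apply/eqP.
rewrite metricZl => /eqP; rewrite mulf_eq0 => /orP[/eqP c0|/eqP //].
by move: v0; rewrite (_ : v = 0) ?eqxx // -[v](subrK (c *: xi q)) -/z z0 c0 scale0r addr0.
Qed.

(** Conversely, the differential of a defining function of [L] is a nonzero
    multiple of [g q (xi q)] on vectors tangent to the spacetime, because both
    vanish on the tangent space of [L]. *)
Lemma tangent_nullP w :
  tangent L q w <-> dot (xc q) (xc w) = 0 /\ g q (xi q) w = 0.
Proof.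
split=> [Tw|[wq gw]].
  by split; [exact: (tangent_sub I_open HL.1 Lq Tw)|exact: null_field_normal].
have [f df] := hypersurface_defining I_open HL.1 Lq.
apply/(tangent_hyper I_open w HL.1.1 Lq df); split=> //.
have [Sf [e eq De] _] := df.
have Df := smooth_diff Sf.
have key z : dot (xc q) (xc z) = 0 ->
    g q (xi q) z = 'D_z f q / 'D_e f q * g q (xi q) e.
  move=> zq; pose c := 'D_z f q / 'D_e f q.
  have T : tangent L q (z + (- c) *: e).
    apply/(tangent_hyper I_open _ HL.1.1 Lq df); split.
      by rewrite xcD xcZ dotDr dotZr zq eq mulr0 addr0.
    rewrite (derive_dirD _ _ Df) (derive_dirZ _ _ Df) -[_ *: _]/(_ * _) mulNr /c.
    by rewrite divfK // subrr.
  have := null_field_normal T; rewrite metricC metricDl metricZl mulNr => /eqP.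
  by rewrite subr_eq0 => /eqP; rewrite metricC => ->; rewrite [g q e _]metricC.
have e0 : g q (xi q) e != 0.
  apply/eqP => ge.
  have := key partial_t; rewrite ge mulr0 /= dot0r => /(_ erefl) /(metric_dt0 _ Mq).
  by apply/eqP; exact: null_field_tc.
have := key w wq; rewrite gw => /esym /eqP.
by rewrite mulf_eq0 (negbTE e0) orbF mulf_eq0 invr_eq0 (negbTE De) orbF => /eqP.
Qed.

(** A nonzero null vector is not orthogonal to [partial_t], so a null
    hypersurface is transversal to it. *)
Lemma defining_dt f : defining I L q f -> 'D_partial_t f q != 0.
Proof.
move=> df; apply/eqP => D0.
have : tangent L q partial_t.
  by apply/(tangent_hyper I_open _ HL.1.1 Lq df); split=> //=; rewrite dot0r.
move=> /null_field_normal /(metric_dt0 _ Mq); apply/eqP; exact: null_field_tc.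
Qed.

End Normal.

Lemma tangent_diff_eq_amb (L : set amb) q v (F G : amb -> amb) :
  hypersurface M L -> L q -> tangent L q v -> smooth_at F q -> smooth_at G q ->
  (\forall y \near q, L y -> F y = G y) -> 'D_v F q = 'D_v G q.
Proof.
move=> HL Lq Tv SF SG FG.
have key (l : amb -> R) : smooth_at (fun y => l (F y)) q -> smooth_at (fun y => l (G y)) q ->
    'D_v (fun y => l (F y)) q = 'D_v (fun y => l (G y)) q.
  move=> S1 S2; apply: (tangent_diff_eq I_open HL Lq Tv (smooth_diff S1) (smooth_diff S2)).
  by apply: filterS FG => y H /H ->.
have SxF := smooth_xc SF; have SxG := smooth_xc SG.
have dF := smooth_diff SF; have dG := smooth_diff SG.
apply: amb_eq.
- exact: (etrans (esym (derive_rc v dF))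
    (etrans (key rc (smooth_rc SF) (smooth_rc SG)) (derive_rc v dG))).
- apply: (etrans (esym (derive_xc v dF))); apply: (etrans _ (derive_xc v dG)).
  apply/rowP => i; apply: (etrans (esym (derive_ec i v (smooth_diff SxF)))).
  apply: (etrans _ (derive_ec i v (smooth_diff SxG))).
  exact: (key (fun y => xc y 0 i) (smooth_ec i SxF) (smooth_ec i SxG)).
- exact: (etrans (esym (derive_tc v dF))
    (etrans (key tc (smooth_tc SF) (smooth_tc SG)) (derive_tc v dG))).
Qed.

(** An ambient extension of [xi] becomes tangent to the spacetime by
    projection, which does not change it along [L]. *)
Lemma local_extensionP (L : set amb) (xi : amb -> amb) q :
  hypersurface M L -> L q -> smooth_on L xi -> (forall y, L y -> tangent L y (xi y)) ->
  vector_field_at M q (local_extension M L q xi) /\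
  \forall y \near q, L y -> local_extension M L q xi y = xi y.
Proof.
move=> HL Lq Sxi Txi.
apply: (@xgetPex _ xi [set X | vector_field_at M q X /\ \forall y \near q, L y -> X y = xi y]).
have [F [SF NF]] := Sxi q Lq.
have Mq := HL.1 _ Lq.
exists (fun y => mk (rc (F y)) (xc (F y) + (- dot (xc y) (xc (F y))) *: xc y) (tc (F y))).
split=> /=; last first.
  apply: filterS NF => y NFy Ly; rewrite (NFy Ly).
  by rewrite (tangent_sub I_open HL Ly (Txi y Ly)) oppr0 scale0r addr0; exact/esym/mkE.
split.
  apply: smooth_mk; [exact: smooth_rc| |exact: smooth_tc].
  apply: smooth_add; first exact: smooth_xc.
  apply: smooth_rVZ; last exact: smooth_xc_id.
  by apply: smooth_opp; apply: smooth_dot; [exact: smooth_xc_id|exact: smooth_xc].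
apply: (@filterE _ (nbhs q)) => y My; apply/(tangent_spacetime I_open _ My).
by rewrite /= dotDr dotZr (dot1 My) mulr1 subrr.
Qed.

(** In directions tangent to [L], the extension of [xi] that enters the
    definition has the same derivatives as any other smooth extension [F]. *)
Lemma second_formE nabla (lc : levi_civita M g nabla) (L : set amb) xi q F u w :
  hypersurface M L -> L q -> smooth_on L xi -> (forall y, L y -> tangent L y (xi y)) ->
  smooth_at F q -> (\forall y \near q, L y -> F y = xi y) ->
  tangent L q u -> tangent L q w -> tc u = 0 -> tc w = 0 ->
  null_second_form M g nabla L xi q u w =
  - (g q ('D_u F q) w
   + rc q * (rc u * dot (xc (xi q)) (xc w) - rc w * dot (xc (xi q)) (xc u)
             + rc (xi q) * dot (xc u) (xc w))
   - rc (xi q) * h' (rc q) / (2 * h (rc q) ^+ 2) * (rc u * rc w)).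
Proof.
move=> HL Lq Sxi Txi SF NF Tu Tw tu tw; rewrite /null_second_form.
have [VX NX] := local_extensionP HL Lq Sxi Txi.
have Mq := HL.1 _ Lq.
rewrite (nabla_screen I_open h_smooth h_pos lc Mq VX) //; last 2 first.
- exact: (tangent_sub I_open HL Lq Tu).
- exact: (tangent_sub I_open HL Lq Tw).
rewrite (nbhs_singleton NX Lq).
rewrite (tangent_diff_eq_amb HL Lq Tu VX.1 SF) //.
by apply: filterS2 NX NF => y H1 H2 Ly; rewrite H1 // H2.
Qed.

End NullHypersurfaces.

(** * Umbilicity in the conformally flat model *)

Section Cross.
Context {R : realType}.

Lemma row3 (c0 c1 c2 : R) : exists b : 'rV[R]_3, [/\ b 0 0 = c0, b 0 1 = c1 & b 0 (inord 2) = c2].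
Proof.
exists (\row_(i < 3) (if i == 0 then c0 else if i == 1 then c1 else c2)).
by split; rewrite !mxE //= -!val_eqE /= inordK.
Qed.

Lemma cross_exists (p x : 'rV[R]_3) : exists b : 'rV[R]_3,
  [/\ dot p b = 0, dot x b = 0 & dot b b = dot p p * dot x x - dot x p ^+ 2].
Proof.
have [b [b0 b1 b2]] := row3 (p 0 1 * x 0 (inord 2) - p 0 (inord 2) * x 0 1)
  (p 0 (inord 2) * x 0 0 - p 0 0 * x 0 (inord 2)) (p 0 0 * x 0 1 - p 0 1 * x 0 0).
by exists b; split; rewrite !dotE b0 b1 b2; ring.
Qed.

(** The projection of [x] to the plane orthogonal to [p] and the cross product
    of [p] and [x] span this plane. Scaled to the same length, their sum and
    their difference are orthogonal, and have the same component along [x]. *)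
Lemma shear_directions (p x : 'rV[R]_3) : 0 < dot p p -> dot x x = 1 ->
  dot x p ^+ 2 != dot p p ->
  exists e w, [/\ dot p e = 0, dot p w = 0, dot e w = 0 & dot x e * dot x w != 0].
Proof.
move=> p0 x1 xp; have [b [pb xb bb]] := cross_exists p x.
have pn0 : dot p p != 0 by rewrite gt_eqF.
pose s := Num.sqrt (dot p p).
have ss : s ^+ 2 = dot p p by rewrite sqr_sqrtr // ltW.
have s0 : s != 0 by rewrite gt_eqF // sqrtr_gt0.
pose a := x + (- (dot x p / dot p p)) *: p.
have pa : dot p a = 0 by rewrite dotDr dotZr [dot p x]dotC; field.
have xa : dot x a = 1 - dot x p ^+ 2 / dot p p by rewrite dotDr dotZr x1; field.
have aa : dot a a = 1 - dot x p ^+ 2 / dot p p.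
  by rewrite {1}/a dotDl dotZl pa mulr0 addr0 xa.
have ab : dot a b = 0 by rewrite dotDl dotZl xb pb mulr0 addr0.
(* The vector [b] has length [s] times that of [a]. *)
clearbody a; exists (s *: a + b), (s *: a + (- 1) *: b); split.
- by rewrite dotDr dotZr pa pb mulr0 addr0.
- by rewrite dotDr !dotZr pa pb !mulr0 addr0.
- rewrite !(dotDl, dotDr, dotZl, dotZr) [dot b a]dotC ab aa bb x1.
  rewrite !mulr0 !addr0 add0r mulrA -expr2 ss; field.
  by [].
rewrite !dotDr !dotZr xb mulr0 addr0 mulf_neq0 // mulf_neq0 // xa.
  by rewrite subr_eq0 eq_sym; apply: contraNneq xp => E; rewrite -[dot p p]mul1r -E divfK.
by rewrite subr_eq0 eq_sym; apply: contraNneq xp => E; rewrite -[dot p p]mul1r -E divfK.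
Qed.

End Cross.

Section MkProj.
Context {R : realType}.
Implicit Types (a c : R) (b : 'rV[R]_3).
Lemma rc_mk a b c : rc (mk a b c) = a. Proof. by []. Qed.
Lemma xc_mk a b c : xc (mk a b c) = b. Proof. by []. Qed.
Lemma tc_mk a b c : tc (mk a b c) = c. Proof. by []. Qed.
End MkProj.

Section Frame.
Context {R : realType} (I : set R) (h : R -> R).
Hypothesis I_open : open I.
Hypothesis I_pos : I `<=` [set r | 0 < r].
Hypothesis h_smooth : forall (n : nat) (r : R), I r -> derivable (derive1n n h) r 1.
Hypothesis h_pos : forall r : R, I r -> 0 < h r.
Local Notation amb := (@ambient R).
Local Notation M := (spacetime I).
Local Notation g := (metric h).
Local Notation h' := (derive1 h).

Definition sqrth (y : amb) : R := Num.sqrt (h (rc y)).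
(** The eikonal equation of null hypersurfaces in the flat model is [dot p p =
    psi], see [slowness_sqr]. *)
Definition psi (y : amb) : R := rc y * rc y * (h (rc y))^-1.
(** With d rho = kappa dr, the point exp(rho) x of R^3 is the image of (r, x)
    in the conformally flat model of space. *)
Definition kappa (y : amb) : R := (rc y * sqrth y)^-1.
(** Half of the logarithmic derivative of [psi] with respect to the variable
    rho, d rho = kappa dr. *)
Definition alpha (y : amb) : R := (2 * h (rc y) + - (rc y * h' (rc y))) * (2 * sqrth y)^-1.

Section AtPoint.
Variable q : amb.
Hypothesis Iq : I (rc q).
Let hq : 0 < h (rc q). Proof. exact: h_pos. Qed.
Let rq : 0 < rc q. Proof. exact: I_pos. Qed.

Lemma sqrth_gt0 : 0 < sqrth q. Proof. by rewrite sqrtr_gt0. Qed.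
Lemma sqrth_sqr : h (rc q) = sqrth q ^+ 2. Proof. by rewrite sqr_sqrtr // ltW. Qed.
Lemma sqrth_neq0 : sqrth q != 0. Proof. exact: lt0r_neq0 sqrth_gt0. Qed.
Lemma rc_neq0 : rc q != 0. Proof. exact: lt0r_neq0. Qed.
Lemma rsqrth_neq0 : rc q * sqrth q != 0. Proof. by rewrite mulf_neq0 ?sqrth_neq0 ?rc_neq0. Qed.

Let Sh := smooth_h I_open h_smooth Iq.
Let Sr := smooth_rc_id q.

Lemma smooth_sqrth : smooth_at sqrth q. Proof. exact: smooth_sqrt. Qed.

Lemma derive_sqrth v : 'D_v sqrth q = h' (rc q) * rc v / (2 * sqrth q).
Proof.
have Dq : derivable Num.sqrt (h (rc q)) 1 by case: (is_derive1_sqrt hq).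
rewrite (derive_phi v Dq (smooth_diff Sh)) (derive_h h_smooth v Iq).
by rewrite derive1E derive_sqrt // mulrC.
Qed.

Lemma smooth_h' : smooth_at (fun y => h' (rc y)) q.
Proof.
apply: (smooth_comp1 I_open Iq) => // n r Ir; rewrite -derive1Sn; exact: h_smooth.
Qed.

Lemma derive_h' v : 'D_v (fun y => h' (rc y)) q = derive1 h' (rc q) * rc v.
Proof.
have D1 : derivable h' (rc q) 1 by exact: (@h_smooth 1%N).
by rewrite (derive_phi v D1 (smooth_diff Sr)) derive_rc_id.
Qed.

Lemma smooth_psi : smooth_at psi q.
Proof.
apply: smooth_mul; first exact: smooth_mul.
by apply: smooth_inv => //; rewrite sqrth_sqr expf_neq0 // sqrth_neq0.
Qed.

Lemma smooth_kappa : smooth_at kappa q.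
Proof.
apply: smooth_inv; first exact: rsqrth_neq0.
by apply: smooth_mul => //; exact: smooth_sqrth.
Qed.

Lemma smooth_alpha : smooth_at alpha q.
Proof.
have Sc : smooth_at (fun _ : amb => 2 : R) q by exact: smooth_cst.
apply: smooth_mul.
  apply: smooth_add; first exact: smooth_mul.
  by apply: smooth_opp; apply: smooth_mul => //; exact: smooth_h'.
apply: smooth_inv; first by rewrite mulf_neq0 ?pnatr_eq0 // sqrth_neq0.
by apply: smooth_mul => //; exact: smooth_sqrth.
Qed.

Lemma derive_psi v : 'D_v psi q = 2 * alpha q / (rc q * sqrth q) * psi q * rc v.
Proof.
have h0 : h (rc q) != 0 by rewrite gt_eqF.
have Hr := smooth_is_derive v Sr.
have Hi := smooth_is_derive v (smooth_inv h0 Sh).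
have H := is_derive_mulf (is_derive_mulf Hr Hr) Hi.
rewrite (@derive_val _ _ _ _ _ _ _ H) derive_rc_id (derive_inv v h0 (smooth_diff Sh)).
rewrite (derive_h h_smooth v Iq) /alpha /psi.
move: sqrth_sqr sqrth_neq0 rc_neq0; move: (h (rc q)) (h' (rc q)) (sqrth q) (rc q) (rc v).
by move=> H0 H1 k r u -> k0 r0; field; rewrite k0 r0.
Qed.

Lemma derive_kappa v : 'D_v kappa q =
  - (sqrth q + rc q * h' (rc q) / (2 * sqrth q)) / (rc q * sqrth q) ^+ 2 * rc v.
Proof.
have Hr := smooth_is_derive v Sr.
have Hk := smooth_is_derive v smooth_sqrth.
have Hrk := is_derive_mulf Hr Hk.
have Srk := smooth_mul Sr smooth_sqrth.
rewrite (derive_inv v rsqrth_neq0 (smooth_diff Srk)) (@derive_val _ _ _ _ _ _ _ Hrk).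
rewrite derive_rc_id derive_sqrth.
have := sqrth_neq0; have := rc_neq0; move: (h' (rc q)) (sqrth q) (rc q) (rc v).
by move=> H1 k r u r0 k0; field; rewrite k0 r0.
Qed.

Lemma derive_alpha v : 'D_v alpha q = (alpha q ^+ 2 - h (rc q) + rc q * h' (rc q)
   - rc q ^+ 2 * derive1 h' (rc q) / 2) / (rc q * sqrth q) * rc v.
Proof.
have Sc : smooth_at (fun _ : amb => 2 : R) q by exact: smooth_cst.
have k2 : 2 * sqrth q != 0 by rewrite mulf_neq0 ?pnatr_eq0 // sqrth_neq0.
have Hr := smooth_is_derive v Sr.
have Hk := smooth_is_derive v smooth_sqrth.
have Hh := smooth_is_derive v Sh.
have Hh' := smooth_is_derive v smooth_h'.
have Hc := smooth_is_derive v Sc.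
have S2k := smooth_mul Sc smooth_sqrth.
have H2k := is_derive_mulf Hc Hk.
have Hi := smooth_is_derive v (@smooth_inv _ _ (fun y => 2 * sqrth y) q k2 S2k).
have H := is_derive_mulf (is_derive_addf (is_derive_mulf Hc Hh)
  (is_derive_oppf (is_derive_mulf Hr Hh'))) Hi.
rewrite (@derive_val _ _ _ _ _ _ _ H) (@derive_inv _ _ (fun y => 2 * sqrth y) q v k2 (smooth_diff S2k)).
rewrite (@derive_val _ _ _ _ _ _ _ H2k) derive_rc_id derive_sqrth derive_h' (derive_h h_smooth v Iq).
rewrite derive_cst /alpha.
move: sqrth_sqr sqrth_neq0 rc_neq0; move: (h (rc q)) (h' (rc q)) (derive1 h' (rc q)) (sqrth q) (rc q) (rc v).
by move=> H0 H1 H2 k r u -> k0 r0; field; rewrite k0 r0.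
Qed.

End AtPoint.

Section ConormalFrame.
Variables (L : set amb) (xi F : amb -> amb) (rho Ro : amb -> R).
Variable nabla : amb -> amb -> (amb -> amb) -> amb.
Hypothesis lc : levi_civita M g nabla.
Hypothesis HL : null_hypersurface M g L.
Hypothesis Hxi : null_field g L xi.
Hypothesis Humb : forall q u v, L q ->
      tangent L q u -> g q u partial_t = 0 -> tangent L q v -> g q v partial_t = 0 ->
      null_second_form M g nabla L xi q u v = rho q * g q u v.

(** Derivatives along [L] are computed with fixed extensions [F] and [Ro] of
    the null field and of the umbilicity factor. These remain extensions at
    nearby points of [L], so that identities at such points can be
    differentiated. *)
Definition good_at q := [/\ L q, smooth_at F q, (\forall y \near q, L y -> F y = xi y),
  smooth_at Ro q & (\forall y \near q, L y -> Ro y = rho y)].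

Lemma good_near q : good_at q -> \forall y \near q, L y -> good_at y.
Proof.
move=> [Lq SF NF SR NR].
have H : \forall y \near q, smooth_at F y /\ smooth_at Ro y.
  by apply: filterS2 (smooth_near SF) (smooth_near SR) => y H1 H2; split.
by apply: filterS3 H (near_join NF) (near_join NR) => y [H1 H2] H3 H4 Ly; split.
Qed.

Definition slowness_scale (y : amb) : R := psi y * (tc (F y))^-1.
(** Write u^ = kappa u_r x + u_x for the vector of R^3 attached to a vector u
    tangent to the spacetime. The tangent space of [L] is u_t = p . u^ where p
    is the slowness: for the graph of a time function, its gradient in the
    flat model, multiplied by the flat radius exp(rho). *)
Definition slowness (y : amb) : 'rV[R]_3 := slowness_scale y *: ((kappa y * rc (F y)) *: xc y + xc (F y)).
(** Up to a positive scaling, the umbilicity factor of the level sets of the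
    time function in the flat model. *)
Definition umb_coef (y : amb) : R := slowness_scale y * (- Ro y + (kappa y + - (rc y)^-1) * rc (F y)).
(** The lift to [L] of the constant vector field [e] of the flat model,
    multiplied by the flat radius. *)
Definition frame (e : 'rV[R]_3) (y : amb) : amb :=
  mk (rc y * sqrth y * dot (xc y) e) (e + (- dot (xc y) e) *: xc y) (dot (slowness y) e).

Section SlownessAtPoint.
Variable q : amb.
Hypothesis Gq : good_at q.
Let Lq : L q. Proof. by case: Gq. Qed.
Let Mq : M q. Proof. by case: HL => -[LM _] _; exact: LM. Qed.
Let Iq : I (rc q). Proof. by case: Mq. Qed.
Let SF : smooth_at F q. Proof. by case: Gq. Qed.
Let SR : smooth_at Ro q. Proof. by case: Gq. Qed.
Let Fxi : F q = xi q. Proof. by case: Gq => _ _ /nbhs_singleton /(_ Lq). Qed.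
Let ft0 : tc (F q) != 0. Proof. by rewrite Fxi; exact: (null_field_tc I_pos h_pos HL Hxi Lq). Qed.
Let x1 : dot (xc q) (xc q) = 1. Proof. exact: dot1 Mq. Qed.
Let xF : dot (xc q) (xc (F q)) = 0.
Proof. by rewrite Fxi; exact: (null_field_sphere I_open HL Hxi Lq). Qed.
Let nF : g q (F q) (F q) = 0.
Proof. by rewrite Fxi; case: (Hxi.2 q Lq). Qed.
Let k0 := sqrth_neq0 Iq.
Let r0 := rc_neq0 Iq.
Let hk := sqrth_sqr Iq.

Lemma smooth_slowness_scale : smooth_at slowness_scale q.
Proof.
apply: smooth_mul; first exact: (smooth_psi Iq).
by apply: smooth_inv => //; exact: smooth_tc.
Qed.

Lemma smooth_slowness : smooth_at slowness q.
Proof.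
apply: smooth_rVZ; first exact: smooth_slowness_scale.
apply: smooth_add; last exact: smooth_xc.
apply: smooth_rVZ; last exact: smooth_xc_id.
by apply: smooth_mul; [exact: (smooth_kappa Iq)|exact: smooth_rc].
Qed.

Lemma smooth_umb_coef : smooth_at umb_coef q.
Proof.
apply: smooth_mul; first exact: smooth_slowness_scale.
apply: smooth_add; first exact: smooth_opp.
apply: smooth_mul; last exact: smooth_rc.
apply: smooth_add; first exact: (smooth_kappa Iq).
by apply: smooth_opp; apply: smooth_inv => //; exact: smooth_rc_id.
Qed.

Lemma smooth_xc_dot e : smooth_at (fun y => dot (xc y) e) q.
Proof. by apply: smooth_dot; [exact: smooth_xc_id|exact: smooth_cst]. Qed.

Lemma smooth_slowness_dot e : smooth_at (fun y => dot (slowness y) e) q.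
Proof. by apply: smooth_dot; [exact: smooth_slowness|exact: smooth_cst]. Qed.

Lemma smooth_rsqrth : smooth_at (fun y => rc y * sqrth y) q.
Proof. by apply: smooth_mul; [exact: smooth_rc_id|exact: (smooth_sqrth Iq)]. Qed.

Lemma smooth_frame e : smooth_at (frame e) q.
Proof.
apply: smooth_mk; last exact: smooth_slowness_dot.
  by apply: smooth_mul; [exact: smooth_rsqrth|exact: smooth_xc_dot].
apply: smooth_add; first exact: smooth_cst.
by apply: smooth_rVZ; [apply: smooth_opp; exact: smooth_xc_dot|exact: smooth_xc_id].
Qed.

Lemma derive_xc_dot e v : 'D_v (fun y => dot (xc y) e) q = dot (xc v) e.
Proof.
rewrite (derive_dot v (smooth_xc_id q) (smooth_cst e q)) derive_cst derive_xc_id.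
by rewrite dot0r addr0.
Qed.

Lemma slowness_dotE e : dot (slowness q) e = slowness_scale q * (kappa q * rc (F q) * dot (xc q) e + dot (xc (F q)) e).
Proof. by rewrite /slowness dotZl dotDl dotZl. Qed.

Lemma slowness_scale_neq0 : slowness_scale q != 0.
Proof.
by rewrite /slowness_scale /psi hk !mulf_neq0 ?invr_neq0 ?expf_neq0.
Qed.

Lemma tangent_frame e : tangent L q (frame e q).
Proof.
apply/(tangent_nullP I_open I_pos h_pos HL Hxi Lq); split.
  by rewrite /= dotDr dotZr x1 mulr1 subrr.
rewrite -Fxi metricE /frame rc_mk xc_mk tc_mk dotDr dotZr [dot (xc (F q)) (xc q)]dotC xF slowness_dotE /slowness_scale /psi /kappa hk.
move: k0 r0 ft0; move: (sqrth q) (rc q) (tc (F q)) (rc (F q)) (dot (xc q) e) (dot (xc (F q)) e).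
by move=> k r ft fr X Fe k00 r00 ft00; field; rewrite k00 r00 ft00.
Qed.

(** This is the nullity of [xi]. *)
Lemma slowness_sqr : dot (slowness q) (slowness q) = psi q.
Proof.
rewrite {1}/slowness {1}/slowness !(dotZl, dotZr, dotDl, dotDr) x1 xF [dot (xc (F q)) (xc q)]dotC xF.
have : rc (F q) ^+ 2 / sqrth q ^+ 2 + rc q ^+ 2 * dot (xc (F q)) (xc (F q)) = sqrth q ^+ 2 * tc (F q) ^+ 2.
  apply/eqP; rewrite -subr_eq0 -hk; apply/eqP; rewrite -[RHS]nF metricE.
  by rewrite !expr2.
rewrite /slowness_scale /psi /kappa hk.
move: k0 r0 ft0; move: (sqrth q) (rc q) (tc (F q)) (rc (F q)) (dot (xc (F q)) (xc (F q))).
move=> k r ft fr d k00 r00 ft00 E.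
have -> : d = (k ^+ 2 * ft ^+ 2 - fr ^+ 2 / k ^+ 2) / r ^+ 2.
  by rewrite -E; field; rewrite k00 r00.
by field; rewrite k00 r00 ft00.
Qed.

Local Notation T e w := ('D_(frame e q) (fun y => dot (slowness y) w) q).

Lemma derive_xF e : dot (xc q) (xc ('D_(frame e q) F q)) = - dot (xc (frame e q)) (xc (F q)).
Proof.
have Sxf := smooth_dot (smooth_xc_id q) (smooth_xc SF).
have := tangent_diff I_open HL.1 Lq (tangent_frame e) (smooth_diff Sxf).
rewrite (derive_dot (frame e q) (smooth_xc_id q) (smooth_xc SF)) derive_xc_id.
rewrite (derive_xc (frame e q) (smooth_diff SF)) => H; apply/eqP; rewrite -addr_eq0 addrC.
apply/eqP; apply: H.
have [_ _ NF _ _] := Gq.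
apply: filterS NF => y H Ly; rewrite H //.
exact: (null_field_sphere I_open HL Hxi Ly).
Qed.

(** Umbilicity is conformally invariant: on the plane orthogonal to the
    slowness, the second fundamental forms for the spacetime metric and for
    the flat one differ by a multiple of the metric, which [umb_coef] takes
    into account. *)
Lemma frame_umbilic e w : dot (slowness q) e = 0 -> dot (slowness q) w = 0 -> T e w = umb_coef q * dot e w.
Proof.
move=> Pe Pw.
have te : tc (frame e q) = 0 by [].
have tw : tc (frame w q) = 0 by [].
have := Humb Lq (tangent_frame e) ((metric_dt0 h_pos _ Mq).2 te)
   (tangent_frame w) ((metric_dt0 h_pos _ Mq).2 tw).
have [_ _ NF _ NR] := Gq.
have Txi y : L y -> tangent L y (xi y) by move=> Ly; case: (Hxi.2 y Ly).
rewrite (second_formE I_open h_smooth h_pos lc HL.1 Lq Hxi.1 Txi SF NF) //; last 2 first.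
- exact: tangent_frame.
- exact: tangent_frame.
rewrite -(nbhs_singleton NR Lq) -Fxi.
set DF := 'D_(frame e q) F q.
have xDF : dot (xc q) (xc DF) = - dot (xc (frame e q)) (xc (F q)) by exact: derive_xF.
set D := 'D_(frame e q) _ q.
have DE : D = slowness_scale q * ('D_(frame e q) kappa q * rc (F q) * dot (xc q) w
    + kappa q * rc DF * dot (xc q) w + kappa q * rc (F q) * dot (xc (frame e q)) w
    + dot (xc DF) w).
  have Hcf := smooth_is_derive (frame e q) smooth_slowness_scale.
  have Hk := smooth_is_derive (frame e q) (smooth_kappa Iq).
  have HF := smooth_is_derive (frame e q) (smooth_rc SF).
  have Hx := smooth_is_derive (frame e q) (smooth_xc_dot w).
  have HFw := smooth_is_derive (frame e q) (smooth_dot (smooth_xc SF) (smooth_cst w q)).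
  have H := is_derive_mulf Hcf (is_derive_addf (is_derive_mulf (is_derive_mulf Hk HF) Hx) HFw).
  have E0 : kappa q * rc (F q) * dot (xc q) w + dot (xc (F q)) w = 0.
    by move: Pw; rewrite slowness_dotE => /eqP; rewrite mulf_eq0 (negbTE slowness_scale_neq0) => /eqP.
  have EP : (fun y => dot (slowness y) w) = (fun y => slowness_scale y * (kappa y * rc (F y) * dot (xc y) w
     + dot (xc (F y)) w)).
    by apply/funext => y; rewrite /slowness dotZl dotDl dotZl.
  have := @derive_val _ _ _ _ _ _ _ H; rewrite -EP -/D => ->.
  rewrite E0 (derive_rc (frame e q) (smooth_diff SF)) derive_xc_dot.
  rewrite (derive_dot (frame e q) (smooth_xc SF) (smooth_cst w q)) derive_cst dot0r.
  rewrite (derive_xc (frame e q) (smooth_diff SF)) -/DF.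
  have alg (a b c d e' f g' i j k l m n : R) :
     a * 0 + b * ((c * d + e' * f) * g' + e' * d * i + (j + 0)) =
     b * (c * d * g' + e' * f * g' + e' * d * i + j) by ring.
  exact: alg.
rewrite DE (derive_kappa Iq).
move: xDF Pe Pw; rewrite !slowness_dotE => xDF /eqP; rewrite mulf_eq0 (negbTE slowness_scale_neq0) /=.
move=> /eqP Pe /eqP; rewrite mulf_eq0 (negbTE slowness_scale_neq0) /= => /eqP Pw.
rewrite !metricE te tw /frame !rc_mk !xc_mk; rewrite /frame xc_mk in xDF.
move: xDF; rewrite !(dotDl, dotDr, dotZl, dotZr) x1 [dot (xc (F q)) (xc q)]dotC xF.
rewrite [dot e (xc q)]dotC [dot e (xc (F q))]dotC [dot (xc DF) (xc q)]dotC => ->.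
rewrite /umb_coef; move: (slowness_scale q) => c.
rewrite {2 3}/kappa /kappa hk.
move: Pe Pw; rewrite /kappa.
move: k0 r0; move: (sqrth q) (rc q) (h' (rc q)) (rc (F q)) (dot (xc q) e) (dot (xc q) w)
  (dot (xc (F q)) e) (dot (xc (F q)) w) (rc DF) (dot (xc DF) w) (dot e w) (Ro q) (tc (F q)) (tc DF).
move=> k r H1 fr X Y Fe Fw Dr Dw E ro ft Dt k00 r00 Pe Pw Eq.
have {}Pe : Fe = - ((r * k)^-1 * fr * X) by lra.
have {}Pw : Fw = - ((r * k)^-1 * fr * Y) by lra.
rewrite {}Pe {}Pw in Eq *.
move/eqP: Eq; rewrite -subr_eq0 => /eqP Eq; rewrite -[RHS]mulrA; congr (c * _).
apply/eqP; rewrite -subr_eq0; apply/eqP.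
(* The umbilicity equation, multiplied by [- (r ^+ 2)^-1], is the goal. *)
have solve (a b : R) : b = 0 -> a = - b / r ^+ 2 -> a = 0 by move=> -> ->; rewrite oppr0 mul0r.
by apply: (solve _ _ Eq); field; rewrite k00 r00.
Qed.


Lemma frame_derive_dot e w : T e w = dot ('D_(frame e q) slowness q) w.
Proof.
by rewrite (derive_dot (frame e q) smooth_slowness (smooth_cst w q)) derive_cst dot0r addr0.
Qed.

End SlownessAtPoint.

Definition normal_coef (y : amb) : R :=
  - ((umb_coef y + (alpha y + - 1) * dot (xc y) (slowness y)) * (psi y)^-1).
Definition frame_deriv e w (y : amb) : R :=
  umb_coef y * dot e w + alpha y * dot (xc y) e * dot (slowness y) w
  + (alpha y + - 1) * dot (slowness y) e * dot (xc y) w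
  + normal_coef y * dot (slowness y) e * dot (slowness y) w.


Section SlownessDerivatives.
Variable q : amb.
Hypothesis Gq : good_at q.
Let Lq : L q. Proof. by case: Gq. Qed.
Let Mq : M q. Proof. by case: HL => -[LM _] _; exact: LM. Qed.
Let Iq : I (rc q). Proof. by case: Mq. Qed.
Let Fxi : F q = xi q. Proof. by case: Gq => _ _ /nbhs_singleton /(_ Lq). Qed.
Let ft0 : tc (F q) != 0. Proof. by rewrite Fxi; exact: (null_field_tc I_pos h_pos HL Hxi Lq). Qed.
Let k0 := sqrth_neq0 Iq.
Let r0 := rc_neq0 Iq.
Let hk := sqrth_sqr Iq.
Let sPv := smooth_slowness Gq.
Let sPe := smooth_slowness_dot Gq.
Let sZ := smooth_frame Gq.
Let sxe := smooth_xc_dot q.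
Let tZ := tangent_frame Gq.
Let srsk := smooth_rsqrth Gq.
Let smu := smooth_umb_coef Gq.
Local Notation T e w := ('D_(frame e q) (fun y => dot (slowness y) w) q).

Lemma derive_frame f v : 'D_v (frame f) q =
  mk ((sqrth q + rc q * h' (rc q) / (2 * sqrth q)) * rc v * dot (xc q) f
       + rc q * sqrth q * dot (xc v) f)
     ((- dot (xc v) f) *: xc q + (- dot (xc q) f) *: xc v)
     ('D_v (fun y => dot (slowness y) f) q).
Proof.
have Sxn := smooth_opp (sxe f).
have Sz := smooth_rVZ Sxn (smooth_xc_id q).
have Sa := smooth_add (smooth_cst f q) Sz.
have Hr := smooth_is_derive v (smooth_rc_id q).
have Hk := smooth_is_derive v (smooth_sqrth Iq).
have Hx := smooth_is_derive v (sxe f).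
have H := is_derive_mulf (is_derive_mulf Hr Hk) Hx.
rewrite (derive_mk v (smooth_mul srsk (sxe f)) Sa (sPe f)).
rewrite (@derive_val _ _ _ _ _ _ _ H) derive_rc_id (derive_sqrth Iq) (derive_xc_dot q).
rewrite (derive_add v (smooth_diff (smooth_cst f q)) (smooth_diff Sz)) derive_cst add0r.
rewrite (derive_rVZ v Sxn (smooth_xc_id q)) (derive_opp v (smooth_diff (sxe f))).
rewrite (derive_xc_dot q) derive_xc_id; congr mk.
have alg (a k r H1 X d : R) : (a * k + r * (H1 * a / (2 * k))) * X + r * k * d =
  (k + r * H1 / (2 * k)) * a * X + r * k * d by ring.
exact: alg.
Qed.

Lemma tangentB u v : tangent L q u -> tangent L q v -> tangent L q (u - v).
Proof.
move=> /(tangent_nullP I_open I_pos h_pos HL Hxi Lq) [u1 u2].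
move=> /(tangent_nullP I_open I_pos h_pos HL Hxi Lq) [v1 v2].
apply/(tangent_nullP I_open I_pos h_pos HL Hxi Lq); split.
  by rewrite xcD xcN dotDr dotNr u1 v1 subr0.
by rewrite metricC metricDl metricNl metricC u2 metricC v2 subr0.
Qed.

(** The direction [partial_t] is transversal to [L]. *)
Lemma tangent_tc u v : tangent L q u -> tangent L q v -> rc u = rc v -> xc u = xc v ->
  tc u = tc v.
Proof.
move=> Tu Tv Er Ex.
have := null_field_normal I_pos h_pos HL Hxi Lq (tangentB Tu Tv).
rewrite -Fxi metricE rcD rcN xcD xcN tcD tcN Er Ex !subrr dot0r !mulr0 mul0r add0r sub0r.
move=> /eqP; rewrite oppr_eq0 mulf_eq0 hk expf_eq0 (negbTE k0) /= mulf_eq0 (negbTE ft0) /=.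
by rewrite subr_eq0 => /eqP.
Qed.

Lemma frame_lin a e f : frame (a *: e + f) q = a *: frame e q + frame f q.
Proof.
apply: amb_eq.
- rewrite rcD rcZ !rc_mk dotDr dotZr; ring.
- rewrite xcD xcZ !xc_mk dotDr dotZr.
  by apply/rowP => i; rewrite !mxE; ring.
- by rewrite tcD tcZ !tc_mk dotDr dotZr.
Qed.

Lemma frame_scale a e : frame (a *: e) q = a *: frame e q.
Proof.
apply: amb_eq.
- rewrite rcZ !rc_mk dotZr; ring.
- rewrite xcZ !xc_mk dotZr.
  by apply/rowP => i; rewrite !mxE; ring.
- by rewrite tcZ !tc_mk dotZr.
Qed.

(** Both sides are tangent to [L], so it is enough to compare their space
    components, which are those of the bracket of constant fields of the flat
    model multiplied by the flat radius. *)
Lemma bracket_frame e f : 'D_(frame e q) (frame f) q - 'D_(frame f q) (frame e) q =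
  dot (xc q) e *: frame f q - dot (xc q) f *: frame e q.
Proof.
have TB : tangent L q ('D_(frame e q) (frame f) q - 'D_(frame f q) (frame e) q).
  have near_T e' : \forall y \near q, L y -> tangent L y (frame e' y).
    apply: filterS (good_near Gq) => y Gy Ly; exact (tangent_frame (Gy Ly) e').
  exact (tangent_bracket HL.1 Lq (sZ e) (sZ f) (near_T e) (near_T f)).
have TC : tangent L q (dot (xc q) e *: frame f q - dot (xc q) f *: frame e q).
  rewrite -scaleNr (_ : _ + _ = frame (dot (xc q) e *: f + (- dot (xc q) f) *: e) q).
    exact: tZ.
  by rewrite frame_lin frame_scale.
have Er : rc ('D_(frame e q) (frame f) q - 'D_(frame f q) (frame e) q) =
    rc (dot (xc q) e *: frame f q - dot (xc q) f *: frame e q).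
  rewrite !derive_frame rcD rcN rcD rcN !rcZ !rc_mk ?xc_mk !dotDl !dotZl.
  rewrite [dot f e]dotC; ring.
have Ex : xc ('D_(frame e q) (frame f) q - 'D_(frame f q) (frame e) q) =
    xc (dot (xc q) e *: frame f q - dot (xc q) f *: frame e q).
  rewrite !derive_frame xcD xcN xcD xcN !xcZ !xc_mk !dotDl !dotZl.
  by rewrite [dot f e]dotC; apply/rowP => i; rewrite !mxE; ring.
exact: amb_eq Er Ex (tangent_tc TB TC Er Ex).
Qed.

(** The slowness divided by the flat radius is a gradient, hence closed. *)
Lemma frame_curl e f : T e f - T f e = dot (xc q) e * dot (slowness q) f - dot (xc q) f * dot (slowness q) e.
Proof.
have := congr1 tc (bracket_frame e f).
by rewrite tcD tcN tcD tcN !tcZ !derive_frame !tc_mk.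
Qed.

Lemma frame_derive_linl a e f w : T (a *: e + f) w = a * T e w + T f w.
Proof. by rewrite frame_lin (derive_lin _ _ _ (smooth_diff (sPe w))). Qed.

Lemma frame_derive_linr a e w w' : T e (a *: w + w') = a * T e w + T e w'.
Proof. by rewrite !(frame_derive_dot Gq) dotDr dotZr. Qed.

(** The derivative of the eikonal equation. *)
Lemma frame_slowness e : T e (slowness q) = alpha q * dot (xc q) e * psi q.
Proof.
have SPP := smooth_dot sPv sPv.
have NPP : \forall y \near q, L y -> dot (slowness y) (slowness y) = psi y.
  by apply: filterS (good_near Gq) => y Gy Ly; exact (slowness_sqr (Gy Ly)).
have := tangent_diff_eq I_open HL.1 Lq (tZ e) (smooth_diff SPP) (smooth_diff (smooth_psi Iq)) NPP.
rewrite (derive_dot (frame e q) sPv sPv) (derive_psi Iq) /frame rc_mk -/(frame e q).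
rewrite [dot (slowness q) _]dotC (frame_derive_dot Gq).
move: (dot ('D_(frame e q) slowness q) (slowness q)) => t.
move: (rsqrth_neq0 Iq) (alpha q) (dot (xc q) e) (psi q); move: (rc q * sqrth q) => rk rk0 a X p E.
have -> : t = (t + t) / 2 by field.
by rewrite E; field.
Qed.

Lemma psi_neq0 : psi q != 0.
Proof. by rewrite /psi hk !mulf_neq0 ?invr_neq0 ?expf_neq0. Qed.

(** Umbilicity determines the derivatives in the directions orthogonal to the
    slowness, up to their component along the slowness, which the eikonal
    equation provides; the derivatives along the slowness follow from
    [frame_curl]. *)
Lemma frame_derivE e w : T e w = frame_deriv e w q.
Proof.
have p0 := psi_neq0.
pose a := dot (slowness q) e / psi q; pose b := dot (slowness q) w / psi q.
(* The components of [e] and [w] orthogonal to the slowness. *)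
pose e' := (- a) *: slowness q + e; pose w' := (- b) *: slowness q + w.
have Pe' : dot (slowness q) e' = 0 by rewrite dotDr dotZr (slowness_sqr Gq) /a; field.
have Pw' : dot (slowness q) w' = 0 by rewrite dotDr dotZr (slowness_sqr Gq) /b; field.
have Ee : e = a *: slowness q + e' by rewrite /e' addrA scaleNr subrr add0r.
have Ew : w = b *: slowness q + w' by rewrite /w' addrA scaleNr subrr add0r.
have Tew : T e w = a * (b * T (slowness q) (slowness q) + T (slowness q) w') + (b * T e' (slowness q) + T e' w').
  by rewrite {1}Ee {1}Ew frame_derive_linl !frame_derive_linr.
have TPw : T (slowness q) w' = T w' (slowness q) + (0 - dot (xc q) w' * psi q).
  have := frame_curl (slowness q) w'; rewrite Pw' mulr0 (slowness_sqr Gq) => <-.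
  move: (T _ _) (T _ _) => t1 t2; ring.
rewrite Tew TPw (frame_umbilic Gq Pe' Pw') !frame_slowness.
rewrite /e' /w' /frame_deriv /normal_coef /a /b; move: p0 (slowness_sqr Gq).
clear a b e' w' Pe' Pw' Ee Ew Tew TPw.
move: (slowness q) => P p0 PPq; rewrite !(dotDl, dotDr, dotZl, dotZr) PPq [dot e P]dotC.
move: p0; move: (psi q) (umb_coef q) (alpha q) (dot (xc q) P) (dot (xc q) e) (dot (xc q) w)
  (dot P e) (dot P w) (dot e w) => p m A xP X Y Pe Pw E p0.
by field.
Qed.

Lemma smooth_normal_coef : smooth_at normal_coef q.
Proof.
apply: smooth_opp; apply: smooth_mul; last first.
  by apply: smooth_inv; [exact: psi_neq0|exact: (smooth_psi Iq)].
apply: smooth_add; first exact: smu.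
apply: smooth_mul; last by apply: smooth_dot; [exact: smooth_xc_id|exact: sPv].
by apply: smooth_add; [exact: (smooth_alpha Iq)|exact: smooth_cst].
Qed.

Lemma smooth_alpha1 : smooth_at (fun y => alpha y + - 1) q.
Proof. by apply: smooth_add; [exact: (smooth_alpha Iq)|exact: smooth_cst]. Qed.

Lemma is_derive_frame_deriv e w v : is_derive q v (frame_deriv e w)
  ('D_v umb_coef q * dot e w
   + ('D_v alpha q * dot (xc q) e * dot (slowness q) w + alpha q * dot (xc v) e * dot (slowness q) w
      + alpha q * dot (xc q) e * 'D_v (fun y => dot (slowness y) w) q)
   + ('D_v alpha q * dot (slowness q) e * dot (xc q) w
      + (alpha q + - 1) * 'D_v (fun y => dot (slowness y) e) q * dot (xc q) w
      + (alpha q + - 1) * dot (slowness q) e * dot (xc v) w)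
   + ('D_v normal_coef q * dot (slowness q) e * dot (slowness q) w
      + normal_coef q * 'D_v (fun y => dot (slowness y) e) q * dot (slowness q) w
      + normal_coef q * dot (slowness q) e * 'D_v (fun y => dot (slowness y) w) q)).
Proof.
have Hm := smooth_is_derive v smu.
have Ha := smooth_is_derive v (smooth_alpha Iq).
have Ha1 := is_derive_addf Ha (smooth_is_derive v (smooth_cst (- 1 : R) q)).
have HC := smooth_is_derive v smooth_normal_coef.
have Hxe := smooth_is_derive v (sxe e).
have Hxw := smooth_is_derive v (sxe w).
have HPe := smooth_is_derive v (sPe e).
have HPw := smooth_is_derive v (sPe w).
have Hc := smooth_is_derive v (smooth_cst (dot e w) q).
have H := is_derive_addf (is_derive_addf (is_derive_addf (is_derive_mulf Hm Hc)
   (is_derive_mulf (is_derive_mulf Ha Hxe) HPw))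
   (is_derive_mulf (is_derive_mulf Ha1 HPe) Hxw))
   (is_derive_mulf (is_derive_mulf HC HPe) HPw).
apply: (is_derive_eq H).
rewrite !derive_cst !(derive_xc_dot q).
have alg (Dm E Da DC DPe DPw a X P Pe' ve vw Y C m : R) :
  Dm * E + m * 0 + ((Da * X + a * ve) * P + a * X * DPw)
  + (((Da + 0) * Pe' + (a + - 1) * DPe) * Y + (a + - 1) * Pe' * vw)
  + ((DC * Pe' + C * DPe) * P + C * Pe' * DPw) =
  Dm * E + (Da * X * P + a * ve * P + a * X * DPw)
  + (Da * Pe' * Y + (a + - 1) * DPe * Y + (a + - 1) * Pe' * vw)
  + (DC * Pe' * P + C * DPe * P + C * Pe' * DPw) by ring.
exact: alg.
Qed.

Lemma smooth_frame_deriv e w : smooth_at (frame_deriv e w) q.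
Proof.
have Sa := smooth_alpha Iq; have Sa1 := smooth_alpha1; have SC := smooth_normal_coef.
have Se := sxe e; have Sw := sxe w; have SPe := sPe e; have SPw := sPe w.
exact: (smooth_add (smooth_add (smooth_add (smooth_mul smu (smooth_cst (dot e w) q))
  (smooth_mul (smooth_mul Sa Se) SPw)) (smooth_mul (smooth_mul Sa1 SPe) Sw))
  (smooth_mul (smooth_mul SC SPe) SPw)).
Qed.

End SlownessDerivatives.

Section Integrability.
Variable q : amb.
Hypothesis Gq : good_at q.
Let Lq : L q. Proof. by case: Gq. Qed.
Local Notation T e w := ('D_(frame e q) (fun y => dot (slowness y) w) q).

(** The commutator of two frame fields on a component of the slowness,
    computed from [frame_derivE] at all nearby points of [L]. *)
Lemma integrability e f w :
  'D_(frame e q) (frame_deriv f w) q - 'D_(frame f q) (frame_deriv e w) q =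
  dot (xc q) e * T f w - dot (xc q) f * T e w.
Proof.
have SPw := (smooth_slowness_dot Gq w).
have key e' f' : 'D_(frame e' q) (fun y => 'D_(frame f' y) (fun z => dot (slowness z) w) y) q =
    'D_(frame e' q) (frame_deriv f' w) q.
  apply: (tangent_diff_eq I_open HL.1 Lq (tangent_frame Gq e')).
  - exact: smooth_diff (smooth_Dfield SPw (smooth_frame Gq f')).
  - exact: smooth_diff (smooth_frame_deriv Gq f' w).
  - by apply: filterS (good_near Gq) => y Gy Ly; exact (frame_derivE (Gy Ly) f' w).
have := bracket_derive SPw (smooth_frame Gq e) (smooth_frame Gq f).
rewrite (bracket_frame Gq) => E.
apply: (etrans (congr2 (fun a b : R => a - b) (esym (key e f)) (esym (key f e)))).
apply: (etrans E).
rewrite -scaleNr (derive_lin _ _ _ (smooth_diff SPw)) (derive_dirZ _ _ (smooth_diff SPw)).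
have alg (a b t1 t2 : R) : a *: t1 + (- b) *: t2 = a * t1 - b * t2.
  by rewrite -![_ *: _]/(_ * _) mulNr.
exact: alg.
Qed.
End Integrability.

Section Shear.
Variable q : amb.
Hypothesis Gq : good_at q.
Let Lq : L q. Proof. by case: Gq. Qed.
Let Mq : M q. Proof. by case: HL => -[LM _] _; exact: LM. Qed.
Let Iq : I (rc q). Proof. by case: Mq. Qed.

(** Up to a constant and a power of the radius, the scalar that determines the
    Weyl curvature of the spacetime. *)
Definition weyl (y : R) : R := 1 - h y + y * h' y - y ^+ 2 * derive1 h' y / 2.

Lemma frame_rc e : rc (frame e q) = rc q * sqrth q * dot (xc q) e.
Proof. by []. Qed.

Lemma frame_xc_dot e f : dot (xc (frame e q)) f = dot e f - dot (xc q) e * dot (xc q) f.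
Proof. by rewrite /frame xc_mk dotDl dotZl mulNr. Qed.

(** For orthogonal vectors of the plane orthogonal to the slowness,
    [integrability] along [e] and along the slowness involves neither the
    umbilicity factor nor its derivatives. *)
Lemma shear e w : dot (slowness q) e = 0 -> dot (slowness q) w = 0 -> dot e w = 0 ->
  dot (xc q) e * dot (xc q) w * weyl (rc q) = 0.
Proof.
move=> Pe Pw ew.
have p0 := psi_neq0 Gq.
have rk0 := rsqrth_neq0 Iq.
have := integrability Gq e (slowness q) w.
rewrite (@derive_val _ _ _ _ _ _ _ (is_derive_frame_deriv Gq (slowness q) w (frame e q))).
rewrite (@derive_val _ _ _ _ _ _ _ (is_derive_frame_deriv Gq e w (frame (slowness q) q))).
rewrite (frame_slowness Gq e) !(frame_derivE Gq) /frame_deriv !(derive_alpha Iq) !frame_rc !frame_xc_dot.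
rewrite Pw ew Pe (slowness_sqr Gq).
move: ('D_(frame e q) umb_coef q) ('D_(frame e q) normal_coef q) ('D_(frame (slowness q) q) umb_coef q) ('D_(frame (slowness q) q) normal_coef q).
rewrite /weyl; move: p0 rk0.
move: (dot e (slowness q)) (rc q * sqrth q) (psi q) (umb_coef q) (alpha q) (normal_coef q) (dot (xc q) (slowness q))
  (dot (xc q) e) (dot (xc q) w) => eP rk p m A C xP X Y.
move: (h (rc q)) (h' (rc q)) (derive1 h' (rc q)) (rc q) => H0 H1 H2 r1.
move=> p0 rk0 d1 d2 d3 d4 /eqP; rewrite -subr_eq0 => /eqP E.
apply: (mulfI p0); rewrite mulr0 -[RHS]E.
by field.
Qed.

(** If the null direction is not radial, then the slowness is not proportional
    to the position on the sphere, and [shear_directions] yields vectors for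
    which [shear] is conclusive. *)
Lemma nonradial_weyl : xc (F q) != 0 -> weyl (rc q) = 0.
Proof.
move=> F0.
have pp : 0 < dot (slowness q) (slowness q).
  rewrite (slowness_sqr Gq) lt_neqAle eq_sym (psi_neq0 Gq) /= /psi.
  by rewrite divr_ge0 // ?(ltW (h_pos Iq)) // -expr2 sqr_ge0.
have x1 := dot1 Mq.
have Fxi : F q = xi q by case: Gq => _ _ /nbhs_singleton /(_ Lq).
have xF : dot (xc q) (xc (F q)) = 0.
  by rewrite Fxi; exact: (null_field_sphere I_open HL Hxi Lq).
have xP : dot (xc q) (slowness q) = slowness_scale q * (kappa q * rc (F q)).
  by rewrite dotC (slowness_dotE q) x1 [dot (xc (F q)) _]dotC xF mulr1 addr0.
have [|e [w [Pe Pw ew xn]]] := shear_directions pp x1.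
  rewrite xP {1}/slowness; apply: contra F0 => /eqP E; apply/eqP; apply: dot_eq0.
  move: E; rewrite !(dotZl, dotZr, dotDl, dotDr) x1 xF [dot (xc (F q)) (xc q)]dotC xF.
  move: (slowness_scale_neq0 Gq) (kappa q * rc (F q)) (dot _ _) => c0 t d E.
  have : slowness_scale q ^+ 2 * d = 0.
    by rewrite -[RHS](subrr ((slowness_scale q * t) ^+ 2)) {1}E; ring.
  by move=> /eqP; rewrite mulf_eq0 expf_eq0 (negbTE c0) => /eqP.
by have := shear Pe Pw ew => /eqP; rewrite mulf_eq0 (negbTE xn) => /eqP.
Qed.

End Shear.
End ConormalFrame.
End Frame.

(** * Zero sets as graphs *)

Section Analysis.
Context {R : realType} {V : normedModType R}.

Lemma near0_small (e : R) : 0 < e -> \forall s \near (0 : R), `|s| < e.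
Proof.
by move=> e0; apply/nbhs_ballP; exists e => //= s; rewrite /ball /= sub0r normrN.
Qed.

(** The zero set of a function transversal to [w] meets all lines of direction
    [w] that pass close to [q]. *)
Lemma ivt_transversal (f : V -> R) q u w (A : set V) :
  f q = 0 -> (\forall y \near q, {for y, continuous f}) ->
  differentiable f q -> 'D_w f q != 0 -> nbhs q A ->
  \forall s \near (0 : R), exists t, A (q + s *: u + t *: w) /\ f (q + s *: u + t *: w) = 0.
Proof.
wlog w1 : w / 'D_w f q = 1.
  move=> IH fq fc df Dw nA.
  have := IH (('D_w f q)^-1 *: w); rewrite derive_dirZ // -[_ *: _ in X in X -> _]/(_ * _).
  rewrite mulVf // => /(_ erefl fq fc df); rewrite oner_neq0 => /(_ isT nA).
  apply: filterS => s [t]; rewrite scalerA => H; by exists (t / 'D_w f q).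
move=> fq fc df _ nA.
set W := `|w| + 1; have W0 : 0 < W by rewrite ltr_wpDl.
have [du [d0 Hd]] : exists d, 0 < d /\ forall y, `|y - q| < d -> [/\ A y, {for y, continuous f} &
    `|f y - 'd f q (y - q)| <= (4 * W)^-1 * `|y - q|].
  have e0 : 0 < (4 * W)^-1 by rewrite invr_gt0 mulr_gt0.
  have [d /= d0 Hd] := (nbhs_ballP _ _).1 (filterI nA (filterI fc (differentiableW df e0))).
  exists d; split=> // y yd; have : ball q d y by rewrite -ball_normE /= distrC.
  by move=> /Hd [? [?]]; rewrite /= fq subr0.
have wW : `|w| <= W by rewrite lerDl.
have [t0 [t00 t0W]] : exists t0, 0 < t0 /\ t0 * W = du / 2.
  exists (du / (2 * W)); split; first by rewrite divr_gt0 // mulr_gt0.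
  by field; rewrite gt_eqF.
set K := `|u| + `|'D_u f q| + 1.
have K0 : 0 < K by rewrite ltr_wpDl // addr_ge0.
have uK : `|u| <= K by rewrite /K; have := normr_ge0 ('D_u f q); lra.
have DK : `|'D_u f q| <= K by rewrite /K; have := normr_ge0 u; lra.
clearbody K W.
near=> s.
have s1 : `|s| * K < du / 2.
  by rewrite -ltr_pdivlMr //; near: s; apply: near0_small; rewrite !divr_gt0.
have s2 : `|s| * K < t0 / 2.
  by rewrite -ltr_pdivlMr //; near: s; apply: near0_small; rewrite !divr_gt0.
pose g t := q + s *: u + t *: w.
have gq t : g t - q = s *: u + t *: w by rewrite /g addrC !addrA addNr add0r.
have su : `|s *: u| <= `|s| * K by rewrite normrZ; apply: ler_wpM2l.
have gn t : `|t| <= t0 -> `|g t - q| <= `|s| * K + t0 * W.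
  move=> tt; rewrite gq; apply: le_trans (ler_normD _ _) _; apply: lerD => //.
  by rewrite normrZ; apply: ler_pM.
have gd t : `|t| <= t0 -> `|g t - q| < du by move=> /gn; lra.
have dg t : 'd f q (g t - q) = s * 'D_u f q + t.
  by rewrite gq linearD !linearZ /= -!deriveE // w1 -![_ *: _]/(_ * _) mulr1.
have sD : `|s * 'D_u f q| <= `|s| * K by rewrite normrM; apply: ler_wpM2l.
have fg t : `|t| <= t0 -> `|f (g t) - t| < t0.
  move=> tt; have [_ _] := Hd _ (gd t tt); rewrite dg => H.
  have H1 : (4 * W)^-1 * `|g t - q| <= t0 / 4 + t0 / 4.
    have B : (4 * W)^-1 * `|g t - q| <= (4 * W)^-1 * (2 * (t0 * W)).
      apply: ler_wpM2l; first by rewrite invr_ge0 mulr_ge0 // ltW.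
      by have := gn t tt; lra.
    apply: le_trans B _; have -> : (4 * W)^-1 * (2 * (t0 * W)) = t0 / 4 + t0 / 4.
      by field; rewrite gt_eqF.
    by [].
  have -> : f (g t) - t = (f (g t) - (s * 'D_u f q + t)) + s * 'D_u f q by ring.
  apply: le_lt_trans (ler_normD _ _) _; lra.
have le : - t0 <= t0 by lra.
have [t] : exists2 t, t \in `[- t0, t0] & f (g t) = 0.
  apply: (@IVT _ (f \o g)) => //.
    apply: continuous_in_subspaceT => t; rewrite inE /= in_itv /= -ler_norml => Ht.
    apply: continuous_comp; last by case: (Hd _ (gd t Ht)).
    apply: differentiable_continuous; apply/derivable1_diffP.
    exact: (@ex_derive _ _ _ _ _ _ _ (is_derive_line _ _ _)).
  have h1 : `|- t0| <= t0 by rewrite normrN gtr0_norm.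
  have h2 : `|t0| <= t0 by rewrite gtr0_norm.
  have := fg _ h1; have := fg _ h2; rewrite !ltr_norml => /andP[H2 _] /andP[_ H1].
  rewrite /= ge_min le_max; apply/andP; split; apply/orP; [left|right]; move: H1 H2; lra.
rewrite in_itv /= -ler_norml => tt ft; exists t; split=> //.
by case: (Hd _ (gd t tt)).
Unshelve. all: by end_near. Qed.

(** Otherwise [k] would be negative after some last point, at which it
    vanishes with a positive derivative. *)
Lemma pos_at_zeros_ge0 (k dk : R -> R) : k 0 = 0 ->
  (forall s : R, 0 <= s <= 1 -> is_derive s 1 k (dk s)) ->
  (forall s : R, 0 <= s <= 1 -> k s = 0 -> 0 < dk s) -> 0 <= k 1.
Proof.
move=> k0 Dk pos; rewrite leNgt; apply/negP => k1.
pose S := [set s : R | 0 <= s <= 1 /\ 0 <= k s].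
have S0 : S 0 by split; [rewrite lexx ler01|rewrite k0].
have ubS : ubound S 1 by move=> s [/andP[_ ?] _].
have hsS : has_sup S by split; [exists 0|exists 1].
set a := sup S.
have a0 : 0 <= a by apply: ub_le_sup => //; case: hsS.
have a1 : a <= 1 by apply: ge_sup => //; exists 0.
have a01 : 0 <= a <= 1 by rewrite a0.
have kc : {for a, continuous k}.
  by apply: differentiable_continuous; apply/derivable1_diffP; case: (Dk a a01).
have kneg s : a < s <= 1 -> k s < 0.
  move=> /andP[as_ s1]; rewrite ltNge; apply/negP => ks.
  have : s <= a by apply: ub_le_sup; [case: hsS|split => //; rewrite s1 andbT ltW // (le_lt_trans a0)].
  by rewrite leNgt as_.
have aS : 0 <= k a.
  rewrite leNgt; apply/negP => ka.
  have [d /= d0 Hd] := (nbhs_ballP _ _).1 (cvgr_lt (k a) kc _ ka).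
  have [s [s01 ks] sa] := sup_adherent d0 hsS.
  have : k s < 0.
    apply: Hd; rewrite /ball /= ger0_norm; last by rewrite subr_ge0; apply: ub_le_sup => //; case: hsS.
    by rewrite ltrBlDr -ltrBlDl; move: sa; rewrite -/a; lra.
  by rewrite ltNge ks.
have aN1 : a < 1 by rewrite lt_neqAle a1 andbT; apply: contraTneq aS => ->; rewrite -ltNge.
have ka0 : k a = 0.
  apply/eqP; rewrite eq_le aS andbT leNgt; apply/negP => ka.
  have [d /= d0 Hd] := (nbhs_ballP _ _).1 (cvgr_gt (k a) kc _ ka).
  pose s := Num.min (a + d / 2) 1.
  have sa : a < s by rewrite /s lt_min aN1 andbT ltrDl divr_gt0.
  have s1 : s <= 1 by rewrite /s ge_min lexx orbT.
  have sd : s <= a + d / 2 by rewrite /s ge_min lexx.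
  have : 0 < k s.
    apply: Hd; rewrite /ball /= distrC gtr0_norm ?subr_gt0 //; lra.
  by rewrite ltNge ltW // kneg // sa.
have [Ha1 Ha2] := Dk a a01.
have dpos := pos a a01 ka0.
have df : differentiable k a by apply/derivable1_diffP.
have e0 : 0 < dk a / 2 by rewrite divr_gt0.
have [d /= d0 Hd] := (nbhs_ballP _ _).1 (differentiableW df e0).
pose s := Num.min (a + d / 2) 1.
have sa : a < s by rewrite /s lt_min aN1 andbT ltrDl divr_gt0.
have s1 : s <= 1 by rewrite /s ge_min lexx orbT.
have sd : s <= a + d / 2 by rewrite /s ge_min lexx.
have : ball a d s by rewrite /ball /= distrC gtr0_norm ?subr_gt0 //; lra.
move=> /Hd /=; rewrite ka0 subr0.
have -> : 'd k a (s - a) = (s - a) * dk a.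
  by rewrite -deriveE // (derive_real _ df) derive1E Ha2.
rewrite (gtr0_norm (_ : 0 < s - a)) ?subr_gt0 // ler_norml => /andP[H _].
have : k s < 0 by apply: kneg; rewrite sa.
have : 0 < (s - a) * dk a by rewrite mulr_gt0 // subr_gt0.
move: H; set X := (s - a) * dk a; have -> : dk a / 2 * (s - a) = X / 2 by rewrite /X; ring.
lra.
Qed.

(** On a segment from [p] in the hyperplane [l = 0], slightly tilted towards
    [w], the function [f] has positive derivative at each of its zeros, so it
    stays nonnegative. Tilting towards [- w] gives the opposite sign; in the
    limit [f] vanishes on the hyperplane, and it increases along [w]. *)
Lemma flat_zero_set (f : V -> R) (l : {linear V -> R}) p w :
  continuous l -> l w = 1 -> f p = 0 ->
  (\forall y \near p, differentiable f y) -> (\forall y \near p, 0 < 'D_w f y) ->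
  (\forall y \near p, f y = 0 -> forall v, l v = 0 -> 'D_v f y = 0) ->
  \forall y \near p, f y = 0 <-> l (y - p) = 0.
Proof.
move=> lc lw fp N1 N2 N3.
have [d /= d0 Hd] := (nbhs_ballP _ _).1 (filterI N1 (filterI N2 N3)).
have {}Hd y : `|y - p| < d -> [/\ differentiable f y, 0 < 'D_w f y &
    f y = 0 -> forall v, l v = 0 -> 'D_v f y = 0].
  move=> yd; have : ball p d y by rewrite -ball_normE /= distrC.
  by move=> /Hd [? [? ?]].
have half y eta : `|y - p| < d / 2 -> l (y - p) = 0 -> `|eta *: w| < d / 2 -> 0 < eta ->
    0 <= f (y + eta *: w).
  move=> yd ly ed eta0.
  pose z := (y - p) + eta *: w.
  have zd : `|z| < d by apply: le_lt_trans (ler_normD _ _) _; lra.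
  have sd (s : R) : 0 <= s <= 1 -> `|(p + s *: z) - p| < d.
    move=> /andP[s0 s1]; rewrite addrC addKr normrZ ger0_norm //.
    by apply: le_lt_trans zd; rewrite ler_piMl.
  have := @pos_at_zeros_ge0 (fun s => f (p + s *: z)) (fun s => 'D_z f (p + s *: z)).
  have pz : p + z = y + eta *: w by rewrite /z addrA [p + _]addrC subrK.
  rewrite scale0r addr0 scale1r pz; apply=> //.
  - move=> s Hs; apply: path_derive; last exact: is_derive_line.
    by have [] := Hd _ (sd s Hs).
  - move=> s Hs fs; have [df Dw Dv] := Hd _ (sd s Hs).
    rewrite derive_dirD // derive_dirZ // (Dv fs) // add0r.
    by rewrite -[_ *: _]/(_ * _) mulr_gt0.
have half' y eta : `|y - p| < d / 2 -> l (y - p) = 0 -> `|eta *: w| < d / 2 -> 0 < eta ->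
    f (y - eta *: w) <= 0.
  move=> yd ly ed eta0.
  pose z := (y - p) - eta *: w.
  have zd : `|z| < d by apply: le_lt_trans (ler_normB _ _) _; lra.
  have sd (s : R) : 0 <= s <= 1 -> `|(p + s *: z) - p| < d.
    move=> /andP[s0 s1]; rewrite addrC addKr normrZ ger0_norm //.
    by apply: le_lt_trans zd; rewrite ler_piMl.
  have := @pos_at_zeros_ge0 (fun s => - f (p + s *: z)) (fun s => - 'D_z f (p + s *: z)).
  have pz : p + z = y - eta *: w by rewrite /z addrA [p + _]addrC subrK.
  rewrite scale0r addr0 scale1r pz oppr_ge0; apply=> //.
  - by rewrite fp oppr0.
  - move=> s Hs; apply: is_derive_oppf; apply: path_derive; last exact: is_derive_line.
    by have [] := Hd _ (sd s Hs).
  - move=> s Hs /eqP; rewrite oppr_eq0 => /eqP fs; have [df Dw Dv] := Hd _ (sd s Hs).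
    have zE : z = (y - p) + (- eta) *: w by rewrite /z scaleNr.
    have -> : 'D_z f (p + s *: z) = 'D_(y - p) f (p + s *: z) + (- eta) *: 'D_w f (p + s *: z).
      by rewrite -(derive_dirZ _ _ df) -(derive_dirD _ _ df) -zE.
    rewrite (Dv fs) // add0r.
    by rewrite -[_ *: _]/(_ * _) mulNr opprK mulr_gt0.
have flat y : `|y - p| < d / 2 -> l (y - p) = 0 -> f y = 0.
  move=> yd ly.
  have yd' : `|y - p| < d by lra.
  have [df _ _] := Hd _ yd'.
  have fc : (fun eta : R => f (y + eta *: w)) x @[x --> 0] --> f y.
    have -> : f y = (fun eta : R => f (y + eta *: w)) 0 by rewrite scale0r addr0.
    apply: differentiable_continuous; apply/derivable1_diffP.
    have D : differentiable f (y + (0 : R) *: w) by rewrite scale0r addr0.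
    exact: (@ex_derive _ _ _ _ _ _ _ (path_derive D (is_derive_line y w 0))).
  have W0 : 0 < `|w| + 1 by rewrite ltr_wpDl.
  have small : \forall eta \near (0 : R), `|eta *: w| < d / 2.
    near=> eta; rewrite normrZ; apply: (@le_lt_trans _ _ (`|eta| * (`|w| + 1))).
      by apply: ler_wpM2l => //; rewrite lerDl.
    by rewrite -ltr_pdivlMr //; near: eta; apply: near0_small; rewrite !divr_gt0.
  apply/eqP; rewrite eq_le; apply/andP; split; apply/ler_addgt0Pl => e e0.
    have fe : \forall eta \near (0 : R), `|f y - f (y + eta *: w)| < e.
      by move/cvgrPdist_lt: fc; apply.
    have [b /= b0 Hb] := (nbhs_ballP _ _).1 (filterI small fe).
    have [B1 B2] : `|(- (b / 2)) *: w| < d / 2 /\ `|f y - f (y + (- (b / 2)) *: w)| < e.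
      by apply: Hb; rewrite /ball /= sub0r opprK gtr0_norm ?divr_gt0 //; lra.
    have b20 : 0 < b / 2 by rewrite divr_gt0.
    rewrite scaleNr normrN in B1.
    have := half' y (b / 2) yd ly B1 b20; rewrite -scaleNr.
    move: B2; rewrite ltr_norml => /andP[_]; lra.
  have fe : \forall eta \near (0 : R), `|f y - f (y + eta *: w)| < e.
    by move/cvgrPdist_lt: fc; apply.
  have [b /= b0 Hb] := (nbhs_ballP _ _).1 (filterI small fe).
  have [B1 B2] : `|(b / 2) *: w| < d / 2 /\ `|f y - f (y + (b / 2) *: w)| < e.
    by apply: Hb; rewrite /ball /= sub0r normrN gtr0_norm ?divr_gt0 //; lra.
  have b20 : 0 < b / 2 by rewrite divr_gt0.
  have := half y (b / 2) yd ly B1 b20.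
  move: B2; rewrite ltr_norml => /andP[+ _]; lra.
have W0 : 0 < `|w| + 1 by rewrite ltr_wpDl.
have d2 : 0 < d / 4 by rewrite divr_gt0.
have lsmall : \forall y \near p, `|l (y - p)| * (`|w| + 1) < d / 4.
  have : l (y - p) @[y --> p] --> (0 : R).
    have -> : (0 : R) = l (p - p) by rewrite subrr linear0.
    apply: (@cvg_comp _ _ _ (fun y => y - p) l _ (nbhs (p - p))); last exact: lc.
    by apply: cvgB; [exact: cvg_id|exact: cvg_cst].
  move=> /cvgrPdist_lt /(_ (d / 4 / (`|w| + 1))); rewrite divr_gt0 // => /(_ isT).
  by apply: filterS => y; rewrite sub0r normrN ltr_pdivlMr.
have ysmall : \forall y \near p, `|y - p| < d / 4.
  by apply: filterS (nbhsx_ballx p _ d2) => y; rewrite -ball_normE /= distrC.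
near=> y.
have yd : `|y - p| < d / 4 by near: y.
have ld : `|l (y - p)| * (`|w| + 1) < d / 4 by near: y.
set c := l (y - p).
have cw : `|c *: w| < d / 4.
  rewrite normrZ; apply: le_lt_trans ld; apply: ler_wpM2l => //; by rewrite lerDl.
pose y0 := y - c *: w.
have y0p : y0 - p = (y - p) - c *: w by rewrite /y0 addrAC.
have y0d : `|y0 - p| < d / 2 by rewrite y0p; apply: le_lt_trans (ler_normB _ _) _; lra.
have fy0 : f y0 = 0.
  apply: flat => //; rewrite y0p linearB linearZ /= lw -/c.
  by rewrite -[_ *: _]/(_ * _) mulr1 subrr.
have yE : y = y0 + c *: w by rewrite subrK.
split=> [fy|c0]; last by rewrite yE c0 scale0r addr0.
pose k (s : R) := f (y0 + s *: (c *: w)).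
have segd (s : R) : 0 <= s <= 1 -> `|(y0 + s *: (c *: w)) - p| < d.
  move=> /andP[s0 s1]; rewrite addrAC; apply: le_lt_trans (ler_normD _ _) _.
  have : `|s *: (c *: w)| <= `|c *: w| by rewrite normrZ ger0_norm // ler_piMl.
  lra.
have Dk (s : R) : 0 <= s <= 1 -> is_derive s 1 k (c * 'D_w f (y0 + s *: (c *: w))).
  move=> Hs; have [df _ _] := Hd _ (segd s Hs).
  have := path_derive df (is_derive_line y0 (c *: w) s); rewrite derive_dirZ //.
have [s] : exists2 s, s \in `]0, 1[%R & k 1 - k 0 = c * 'D_w f (y0 + s *: (c *: w)) * (1 - 0).
  apply: (@MVT _ k (fun s => c * 'D_w f (y0 + s *: (c *: w)))) => //.
    by move=> t; rewrite in_itv /= => /andP[/ltW t0 /ltW t1]; apply: Dk; rewrite t0.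
  apply: derivable_within_continuous => t; rewrite in_itv /= => /Dk Ht; exact: ex_derive.
rewrite in_itv /= => /andP[/ltW s0 /ltW s1].
have [|_ Dw _] := Hd _ (segd s _); first by rewrite s0.
rewrite /k scale0r addr0 scale1r -yE fy fy0 subrr subr0 mulr1 => /esym/eqP.
by rewrite mulf_eq0 (gt_eqF Dw) orbF => /eqP.
Unshelve. all: by end_near. Qed.

End Analysis.

(** * Totally umbilic null hypersurfaces are radial *)

Section Primitive.
Context {R : realType} {V : normedModType R}.

(** After one differentiation only [psi \o f] and the derivatives of [f]
    occur. *)
Lemma smooth_primitive (J : set R) (phi psi : R -> R) (f : V -> R) x :
  open J -> J (f x) -> (forall r, J r -> is_derive r 1 phi (psi r)) ->
  smooth_at f x -> smooth_at (fun y => psi (f y)) x -> smooth_at (fun y => phi (f y)) x.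
Proof.
move=> Jo Jx Hphi Sf Spsi.
have Jn : \forall y \near x, J (f y).
  by apply: (smooth_cont Sf); apply: open_nbhs_nbhs.
have [U1 [U1o U1x U1J C1]] := smooth_atI Sf Jn.
have [U2 [U2o U2x C2]] := (smooth_atP _ _).1 Spsi.
apply/smooth_atP; exists (U1 `&` U2).
have Uo : open (U1 `&` U2) by exact: openI.
have {}C1 n : Ck n (U1 `&` U2) f by apply: Ck_sub (C1 n) => y [].
have {}C2 n : Ck n (U1 `&` U2) (fun y => psi (f y)) by apply: Ck_sub (C2 n) => y [].
have df y : (U1 `&` U2) y -> differentiable f y by exact: (Ck_diff (C1 0%N)).
have dphi y : (U1 `&` U2) y -> derivable phi (f y) 1.
  by move=> [Uy _]; case: (Hphi _ (U1J y Uy)).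
have d0 y : (U1 `&` U2) y -> differentiable (fun y => phi (f y)) y.
  move=> Uy; apply: (@differentiable_comp _ _ _ _ f phi); first exact: df.
  by apply/derivable1_diffP; exact: dphi.
split=> // -[|n]; split => // v.
apply: (@Ck_ext _ _ _ Uo _ _ (fun y => psi (f y) * 'D_v f y)).
  move=> y Uy; rewrite (derive_phi v (dphi y Uy) (df y Uy)) derive1E.
  by have [_ ->] := Hphi _ (U1J y Uy.1).
by apply: Ck_mul => //; case: (C1 n.+1) => _; apply.
Qed.

End Primitive.

Section Uniqueness.
Context {R : realType} (I : set R) (h : R -> R).
Hypothesis I_open : open I.
Hypothesis I_pos : I `<=` [set r | 0 < r].
Hypothesis h_smooth : forall (n : nat) (r : R), I r -> derivable (derive1n n h) r 1.
Hypothesis h_pos : forall r : R, I r -> 0 < h r.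
Local Notation amb := (@ambient R).
Local Notation M := (spacetime I).
Local Notation g := (metric h).
Local Notation h' := (derive1 h).

(** The derivative of [weyl] is - r^2 / 2 times the third derivative of [h].
    *)
Lemma weyl_third (J : set R) y : open J -> J `<=` I -> J y ->
  (forall z, J z -> weyl h z = 0) -> derive1n 3 h y = 0.
Proof.
move=> Jo JI Jy HJ.
have Iy := JI _ Jy.
have N : \forall z \near y, weyl h z = 0.
  have : nbhs y J by apply: open_nbhs_nbhs.
  by apply: filterS.
have := near_eq_derive (1 : R) N; rewrite derive_cst.
have H0 : is_derive y 1 h (h' y).
  by rewrite derive1E; apply: derivableP; exact: (@h_smooth 0%N).
have H1 : is_derive y 1 h' (derive1 h' y).
  by rewrite derive1E; apply: derivableP; exact: (@h_smooth 1%N).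
have H2 : is_derive y 1 (derive1 h') (derive1n 3 h y).
  by rewrite [derive1n 3 h y]derive1E; apply: derivableP; exact: (@h_smooth 2%N).
have Hy : is_derive y 1 (fun z : R => z) (1 : R) by exact: is_derive_id.
have Hc (c : R) : is_derive y 1 (fun _ : R => c) (0 : R) by exact: is_derive_cst.
have H := is_derive_addf (is_derive_addf (is_derive_addf (Hc 1) (is_derive_oppf H0))
  (is_derive_mulf Hy H1))
  (is_derive_oppf (is_derive_mulf (is_derive_mulf (is_derive_mulf Hy Hy) H2) (Hc 2^-1))).
have -> : weyl h = (fun z => 1 + - h z + z * h' z + - (z * z * derive1 h' z * 2^-1)).
  by apply/funext => z; rewrite /weyl expr2.
rewrite (@derive_val _ _ _ _ _ _ _ H).
have y0 : y != 0 by apply: lt0r_neq0; exact: I_pos.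
move: (derive1n 3 h y) (h' y) (derive1 h' y) => c a b E.
have : y ^+ 2 * c = 0.
  have solve (a' b' : R) : b' = 0 -> a' = - 2 * b' -> a' = 0 by move=> -> ->; rewrite mulr0.
  by apply: (solve _ _ E); field.
by move=> /eqP; rewrite mulf_eq0 expf_eq0 (negbTE y0) => /eqP.
Qed.

Section Umbilic.
Hypothesis h3 : forall J : set R, open J -> J `<=` I -> J !=set0 ->
            exists2 r, J r & derive1n 3 h r != 0.
Variables (L : set amb) (xi : amb -> amb) (rho : amb -> R).
Variable nabla : amb -> amb -> (amb -> amb) -> amb.
Hypothesis lc : levi_civita M g nabla.
Hypothesis HL : null_hypersurface M g L.
Hypothesis Hxi : null_field g L xi.
Hypothesis Srho : smooth_on L rho.
Hypothesis Humb : forall q u v, L q ->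
      tangent L q u -> g q u partial_t = 0 -> tangent L q v -> g q v partial_t = 0 ->
      null_second_form M g nabla L xi q u v = rho q * g q u v.

(** Around a point where the null direction is not radial, [weyl] vanishes at
    the radius of every point of [L]. These radii fill an interval because [L]
    is transversal to [partial_t]. *)
Lemma radial q : L q -> xc (xi q) = 0.
Proof.
move=> Lq; apply/eqP; apply/negP => /negP x0.
have [F [SF NF]] := Hxi.1 q Lq.
have [Ro [SR NR]] := Srho Lq.
have Mq : M q by exact: HL.1.1.
have [Iq _] := Mq.
have Gq : good_at L xi F rho Ro q by split.
have Fxi : F q = xi q by exact: (nbhs_singleton NF).
have x0' : 0 < dot (xc (F q)) (xc (F q)).
  rewrite Fxi lt_neqAle dot_ge0 andbT eq_sym; apply: contra x0 => /eqP E.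
  by apply/eqP; exact: dot_eq0.
have NX : \forall y \near q, 0 < dot (xc (F y)) (xc (F y)).
  by apply: cvgr_gt (smooth_cont (smooth_dot (smooth_xc SF) (smooth_xc SF))) _ _.
have NW : \forall y \near q, L y -> weyl h (rc y) = 0.
  apply: filterS2 NX (good_near Gq) => y y0 Gy Ly.
  apply: (nonradial_weyl I_open I_pos h_smooth h_pos lc HL Hxi Humb (Gy Ly)).
  by apply/eqP => E; move: y0; rewrite E dot0l ltxx.
have [f df] := hypersurface_defining I_open HL.1 Lq.
have Dt := defining_dt I_open I_pos h_pos HL Hxi Lq df.
have [Sf _ Nf] := df.
have fq : f q = 0 by apply: (nbhs_singleton Nf Mq).1.
have Ncont : \forall y \near q, {for y, continuous f}.
  by apply: filterS (smooth_near Sf) => y; exact: smooth_cont.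
have NA : \forall y \near q, (M y -> L y <-> f y = 0) /\ (L y -> weyl h (rc y) = 0).
  by apply: filterS2 Nf NW => y; split.
have NS := ivt_transversal er fq Ncont (smooth_diff Sf) Dt NA.
(* A point of [L] at radius [rc q + s] exists for all small [s]. *)
have NI : \forall s \near (0 : R), I (rc q + s).
  have C : (rc q + s) @[s --> (0 : R)] --> rc q.
    have {2}-> : rc q = rc q + 0 by rewrite addr0.
    by apply: cvgD; [exact: cvg_cst|exact: cvg_id].
  by apply: C; apply: open_nbhs_nbhs.
have NZ : \forall s \near (0 : R), weyl h (rc q + s) = 0.
  apply: filterS2 NS NI => s [t [[A1 A2] ft]] Is.
  set y := q + s *: er + t *: partial_t in A1 A2 ft.
  have ry : rc y = rc q + s.
    by rewrite /y !rcD !rcZ /er /partial_t rc_mk [rc (0, 0, 1)]/(0) mulr1 mulr0 addr0.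
  have xy : xc y = xc q.
    by rewrite /y !xcD !xcZ /er xc_mk [xc partial_t]/(0) !scaler0 !addr0.
  have My : M y by split; [rewrite -[_.1.1]/(rc y) ry|rewrite -[_.1.2]/(xc y) xy (dot1 Mq)].
  by rewrite -ry; apply: A2; apply/(A1 My).
have [d /= d0 Hd] := (nbhs_ballP _ _).1 NZ.
have [|||r Jr /eqP] := h3 (J := ball (rc q) d `&` I).
- by apply: openI => //; exact: ball_open.
- by move=> r [].
- by exists (rc q); split=> //; exact: ballxx.
apply; apply: (@weyl_third (ball (rc q) d `&` I)) => //.
- by apply: openI => //; exact: ball_open.
- move=> z [zd Iz]; have -> : z = rc q + (z - rc q) by rewrite addrC subrK.
  apply: Hd; move: zd; rewrite /ball /= sub0r normrN => zd; by rewrite distrC.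
Qed.

(** A radial null vector is a multiple of (h, 0, 1) or of (- h, 0, 1); the
    choice is locally constant by continuity. *)
Lemma radial_sign p : L p -> exists eps : R, eps ^+ 2 = 1 /\
  \forall y \near p, L y -> rc (xi y) = eps * h (rc y) * tc (xi y).
Proof.
move=> Lp.
have [F [SF NF]] := Hxi.1 p Lp.
have Mp : M p by exact: HL.1.1.
have [Ip _] := Mp.
have hp : h (rc p) != 0 by exact: (h_neq0 h_pos).
have Fxi : F p = xi p by exact: (nbhs_singleton NF).
have t0 : tc (F p) != 0 by rewrite Fxi; exact: (null_field_tc I_pos h_pos HL Hxi Lp).
pose u y := rc (F y) * (h (rc y) * tc (F y))^-1.
have Su : smooth_at u p.
  apply: smooth_mul; first exact: smooth_rc.
  apply: smooth_inv; first by rewrite mulf_neq0.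
  by apply: smooth_mul; [exact: (smooth_h I_open h_smooth Ip)|exact: smooth_tc].
have sq y : L y -> F y = xi y ->
    u y ^+ 2 = 1 /\ rc (xi y) = u y * h (rc y) * tc (xi y).
  move=> Ly Fy.
  have ty := null_field_tc I_pos h_pos HL Hxi Ly.
  have Iy : I (rc y) by case: (HL.1.1 _ Ly).
  have hy := h_neq0 h_pos Iy.
  have [_ _] := Hxi.2 y Ly; rewrite metricE (radial Ly) dot0l mulr0 addr0 => nx.
  rewrite /u Fy; move: nx hy ty; move: (rc (xi y)) (tc (xi y)) (h (rc y)) => a b c nx c0 b0.
  split; last by field; rewrite b0 c0.
  have E : a ^+ 2 = c ^+ 2 * b ^+ 2.
    have -> : a ^+ 2 = a * a / c * c by field.
    have -> : a * a / c = c * (b * b) by apply/eqP; rewrite -subr_eq0; apply/eqP.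
    ring.
  by rewrite exprMn E; field; rewrite b0 c0.
exists (u p); split; first by case: (sq p Lp Fxi).
have NU : \forall y \near p, `|u p - u y| < 1.
  by have /cvgrPdist_lt /(_ 1 ltr01) := smooth_cont Su.
apply: filterS2 NU NF => y uy Fy Ly.
have [s1 E] := sq y Ly (Fy Ly); have [s2 _] := sq p Lp Fxi.
rewrite E; congr (_ * _ * _); apply/eqP; rewrite -subr_eq0.
move: s1 s2 uy; move: (u p) (u y) => a b b1 a1.
rewrite ltr_norml => /andP[U1 U2].
have : (b - a) * (b + a) = 0 by rewrite -subr_sqr b1 a1 subrr.
move=> /eqP; rewrite mulf_eq0 => /orP[//|/eqP ba].
(* On [L], [u] only takes the values 1 and - 1, whose distance exceeds 1. *)
have b2 : b = - a by lra.
rewrite b2 in U1 U2; exfalso.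
have : (2 * a) ^+ 2 < 1 by rewrite expr_lt1 //; nra.
by rewrite exprMn a1; lra.
Qed.

Lemma tangent_radial p eps : L p -> rc (xi p) = eps * h (rc p) * tc (xi p) ->
  forall v, dot (xc p) (xc v) = 0 -> tc v = eps * rc v / h (rc p) -> tangent L p v.
Proof.
move=> Lp E v pv tv; apply/(tangent_nullP I_open I_pos h_pos HL Hxi Lp); split=> //.
have Ip : I (rc p) by case: (HL.1.1 _ Lp).
have hp := h_neq0 h_pos Ip.
by rewrite metricE (radial Lp) dot0l E tv; field.
Qed.

Lemma positive_defining p : L p -> exists f : amb -> R,
  [/\ smooth_at f p, f p = 0, 0 < 'D_partial_t f p &
      \forall y \near p, M y -> (L y <-> f y = 0)].
Proof.
move=> Lp; have [f df] := hypersurface_defining I_open HL.1 Lp.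
have Dt := defining_dt I_open I_pos h_pos HL Hxi Lp df.
have [Sf _ Nf] := df; have Mp : M p by exact: HL.1.1.
set c := 'D_partial_t f p in Dt.
(* The factor makes the derivative [c ^+ 2]. *)
exists (fun y => c * f y); split.
- by apply: smooth_mul => //; exact: smooth_cst.
- by rewrite ((nbhs_singleton Nf Mp).1 Lp) mulr0.
- rewrite (derive_mul _ (smooth_diff (smooth_cst c p)) (smooth_diff Sf)) derive_cst mul0r add0r.
  by rewrite -/c -expr2 lt_neqAle eq_sym sqr_ge0 sqrf_eq0 Dt.
- apply: filterS Nf => y Hy /Hy ->; split=> [->|/eqP]; first by rewrite mulr0.
  by rewrite mulf_eq0 (negbTE Dt) => /eqP.
Qed.

(** The map [Phi] normalises the position on the sphere and shifts the time so
    that the expected hypersurface becomes the level set of the time through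
    [p]. By [tangent_radial], the function [f \o Phi] has at each of its zeros
    no derivative in the directions of this level set, so [flat_zero_set]
    applies. *)
Lemma germ (J : set R) (H : R -> R) p eps : open J -> J `<=` I -> J (rc p) ->
  (forall r, J r -> is_derive r 1 H (h r)^-1) -> L p ->
  (\forall y \near p, L y -> rc (xi y) = eps * h (rc y) * tc (xi y)) ->
  same_germ p L
    [set y | [/\ M y, J (rc y) & tc y = tc p + eps * (H (rc y) - H (rc p))]].
Proof.
move=> Jo JI Jp DH Lp Neps.
have Mp : M p by exact: HL.1.1.
have [f [Sf fp Dt Nf]] := positive_defining Lp.
have Srp := smooth_rc_id p.
have Shi : smooth_at (fun y : amb => (h (rc y))^-1) p.
  apply: smooth_inv; last exact: (smooth_h I_open h_smooth (JI _ Jp)).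
  by apply: (h_neq0 h_pos); exact: JI.
have SH : smooth_at (fun y : amb => H (rc y)) p.
  exact: (@smooth_primitive _ _ J H (fun r => (h r)^-1)).
pose sh y := eps * (H (rc y) + - H (rc p)).
have Ssh : smooth_at sh p.
  apply: smooth_mul; first exact: smooth_cst.
  by apply: smooth_add => //; exact: smooth_cst.
have shp : sh p = 0 by rewrite /sh subrr mulr0.
(* [Psi] is a right inverse of [Phi] on the spacetime. *)
pose Phi (y : amb) : amb := mk (rc y) ((Num.sqrt (dot (xc y) (xc y)))^-1 *: xc y) (tc y + sh y).
pose Psi (y : amb) : amb := mk (rc y) (xc y) (tc y - sh y).
have SPhi : smooth_at Phi p.
  apply: smooth_mk; [exact: smooth_rc_id| |].
    by apply: smooth_rVZ; [exact: (smooth_norm Mp)|exact: smooth_xc_id].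
  by apply: smooth_add => //; exact: smooth_tc_id.
have SPsi : smooth_at Psi p.
  apply: smooth_mk; [exact: smooth_rc_id|exact: smooth_xc_id|].
  by apply: smooth_sub => //; exact: smooth_tc_id.
have Phip : Phi p = p.
  rewrite /Phi shp addr0 (dot1 Mp) sqrtr1 invr1 scale1r; exact/esym/mkE.
have Psip : Psi p = p by rewrite /Psi shp subr0; exact/esym/mkE.
have PhiPsi y : dot (xc y) (xc y) = 1 -> Phi (Psi y) = y.
  move=> y1; apply: amb_eq => //.
    by rewrite /Phi xc_mk [xc (Psi y)]/(xc y) y1 sqrtr1 invr1 scale1r.
  by rewrite /Phi tc_mk [tc (Psi y)]/(tc y - sh y) [sh (Psi y)]/(sh y) subrK.
have nearPhi (P : amb -> Prop) : (\forall y \near p, P y) -> \forall y \near p, P (Phi y).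
  move=> HP; have C : Phi y @[y --> p] --> p.
    by rewrite -[X in _ --> X]Phip; exact: smooth_cont SPhi.
  exact: C.
have nearPsi (P : amb -> Prop) : (\forall y \near p, P y) -> \forall y \near p, P (Psi y).
  move=> HP; have C : Psi y @[y --> p] --> p.
    by rewrite -[X in _ --> X]Psip; exact: smooth_cont SPsi.
  exact: C.
have NJ : \forall y \near p, J (rc y) by apply: (smooth_cont Srp); apply: open_nbhs_nbhs.
have Nd : \forall y \near p, 0 < dot (xc y) (xc y).
  apply: cvgr_gt (smooth_cont (smooth_dot (smooth_xc_id p) (smooth_xc_id p))) _ _.
  by rewrite (dot1 Mp).
have normd y : 0 < dot (xc y) (xc y) -> dot (xc (Phi y)) (xc (Phi y)) = 1.
  move=> y0; rewrite /Phi xc_mk dotZl dotZr mulrA -expr2 exprVn sqr_sqrtr ?ltW //.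
  by rewrite mulVf // gt_eqF.
have NM : \forall y \near p, M (Phi y).
  by apply: filterS2 NJ Nd => y /JI Iy y0; split=> //; exact: normd.
have DPhi : \forall y \near p, forall v, rc ('D_v Phi y) = rc v /\
    tc ('D_v Phi y) = tc v + eps * rc v / h (rc y).
  have N1 := smooth_near SPhi; have N2 := smooth_near SH.
  apply: filterS3 NJ N1 N2 => y Jy S1 S2 v.
  rewrite -(derive_rc _ (smooth_diff S1)) -(derive_tc _ (smooth_diff S1)).
  split; first by rewrite -[RHS](derive_rc_id y v).
  have HD := DH _ Jy.
  have E1 : 'D_v (fun z : amb => H (rc z)) y = (h (rc y))^-1 * rc v.
    rewrite (derive_phi v (@ex_derive _ _ _ _ _ _ _ HD) (smooth_diff (smooth_rc_id y))).
    by rewrite derive1E (@derive_val _ _ _ _ _ _ _ HD) derive_rc_id.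
  have D := is_derive_addf (smooth_is_derive v (smooth_tc_id y))
    (is_derive_mulf (smooth_is_derive v (smooth_cst eps y))
      (is_derive_addf (smooth_is_derive v S2) (smooth_is_derive v (smooth_cst (- H (rc p)) y)))).
  rewrite -[fun z => tc (Phi z)]/(fun z => tc z + eps * (H (rc z) + - H (rc p))).
  rewrite (@derive_val _ _ _ _ _ _ _ D) !derive_cst E1 derive_tc_id.
  by rewrite mul0r add0r addr0; congr (_ + _); rewrite mulrA mulrAC.
have DPhix : \forall y \near p, forall v, dot (xc (Phi y)) (xc ('D_v Phi y)) = 0.
  apply: filterS2 (smooth_near SPhi) (near_join Nd) => y S1 y0 v.
  have Sx := smooth_xc S1.
  have N : \forall z \near y, dot (xc (Phi z)) (xc (Phi z)) = 1 by apply: filterS y0 => z; exact: normd.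
  have := near_eq_derive v N; rewrite derive_cst (derive_dot v Sx Sx) dotC.
  rewrite (derive_xc v (smooth_diff S1)); lra.
have Dtp : \forall y \near p, 'D_partial_t Phi y = partial_t.
  apply: filterS3 DPhi (smooth_near SPhi) Nd => y D S1 y0.
  have [D1 D2] := D partial_t.
  apply: amb_eq => //; last by rewrite D2 /partial_t [rc _]/(0) mulr0 mul0r addr0.
  rewrite -(derive_xc _ (smooth_diff S1)).
  rewrite -[fun z => xc (Phi z)]/(fun z : amb => (fun w => (Num.sqrt (dot w w))^-1 *: w) (xc z)).
  have Sxc : smooth_at (fun w : 'rV[R]_3 => (Num.sqrt (dot w w))^-1 *: w) (xc y).
    apply: smooth_rVZ; last exact: smooth_id.
    apply: smooth_inv; first by rewrite gt_eqF // sqrtr_gt0.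
    by apply: smooth_sqrt => //; apply: smooth_dot; exact: smooth_id.
  rewrite (derive_chain _ (smooth_diff (smooth_xc_id y)) (smooth_diff Sxc)) derive_xc_id.
  by rewrite [xc partial_t]/(0) derive0.
pose f2 y := f (Phi y).
have D2E : \forall y \near p, forall v, 'D_v f2 y = 'D_('D_v Phi y) f (Phi y).
  apply: filterS2 (smooth_near SPhi) (nearPhi _ (smooth_near Sf)) => y S1 S2 v.
  exact: (derive_chain v (smooth_diff S1) (smooth_diff S2)).
have flat : \forall y \near p, f2 y = 0 <-> tc (y - p) = 0.
  apply: (@flat_zero_set _ _ f2 tc p partial_t).
  - exact: tc_cont.
  - by [].
  - by rewrite /f2 Phip.
  - apply: filterS2 (smooth_near SPhi) (nearPhi _ (smooth_near Sf)) => y S1 S2.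
    by apply: (@differentiable_comp _ _ _ _ Phi f); exact: smooth_diff.
  - have ND : \forall y \near p, 0 < 'D_partial_t f y.
      by apply: cvgr_gt (smooth_cont (smooth_D partial_t Sf)) _ _.
    by apply: filterS3 D2E Dtp (nearPhi _ ND) => y -> ->.
  - have NT : \forall y \near p, f2 y = 0 -> L (Phi y) /\ (\forall z \near Phi y, L z -> f z = 0).
      have NF : \forall y \near p, \forall z \near y, L z -> f z = 0.
        by apply: near_join; apply: filterS Nf => z Nz Lz; apply: (Nz (HL.1.1 _ Lz)).1.
      by apply: filterS3 NM (nearPhi _ Nf) (nearPhi _ NF) => y My Ny Nz fy; split=> //; apply/(Ny My).
    have NE := nearPhi _ Neps; have NSf := nearPhi _ (smooth_near Sf).
    have NT2 : \forall y \near p, f2 y = 0 -> forall v, tc v = 0 -> tangent L (Phi y) ('D_v Phi y).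
      apply: filterS3 NT NE (filterI DPhi DPhix) => y Ty Ey [D1 D2] fy v tv.
      have [Ly _] := Ty fy; have [R1 R2] := D1 v.
      by apply: (tangent_radial Ly (Ey Ly)); [exact: D2|rewrite R2 tv R1 add0r].
    have NT3 : \forall y \near p, f2 y = 0 -> (\forall z \near Phi y, L z -> f z = 0).
      by apply: filterS NT => y Ty fy; case: (Ty fy).
    have NT4 : \forall y \near p, f2 y = 0 -> forall v, tc v = 0 -> 'D_('D_v Phi y) f (Phi y) = 0.
      by apply: filterS3 NT2 NT3 NSf => y T2 T3 S3 fy v tv; exact: (T2 fy v tv f S3 (T3 fy)).
    by apply: filterS2 D2E NT4 => y E N fy v tv; rewrite E; exact: N.
have flatPsi := nearPsi _ flat.
rewrite /same_germ; apply: filterS3 flatPsi Nf NJ => y Fy Ny Jy; split.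
- move=> Ly; have My := HL.1.1 _ Ly; split=> //.
  have : f2 (Psi y) = 0.
    by rewrite /f2 (PhiPsi _ (dot1 My)); exact: (Ny My).1.
  move/Fy; rewrite tcD tcN /Psi tc_mk /sh; lra.
- move=> [My _ ty]; apply/(Ny My).
  have : f2 (Psi y) = 0.
    by apply/Fy; rewrite tcD tcN /Psi tc_mk /sh ty; ring.
  by rewrite /f2 (PhiPsi _ (dot1 My)).
Qed.

End Umbilic.
End Uniqueness.

(** * The two radial null hypersurfaces *)

Section Existence.
Context {R : realType} (I : set R) (h : R -> R).
Hypothesis I_open : open I.
Hypothesis I_pos : I `<=` [set r | 0 < r].
Hypothesis h_smooth : forall (n : nat) (r : R), I r -> derivable (derive1n n h) r 1.
Hypothesis h_pos : forall r : R, I r -> 0 < h r.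
Local Notation amb := (@ambient R).
Local Notation M := (spacetime I).
Local Notation g := (metric h).
Local Notation h' := (derive1 h).

(** The interval is cut down to a compact neighborhood of [r0], where the
    integral of [h^-1] from the left end is a primitive. *)
Lemma local_primitive r0 : I r0 -> exists (J : set R) (H : R -> R),
  [/\ open J, J `<=` I, J r0 & forall r, J r -> is_derive r 1 H (h r)^-1].
Proof.
move=> Ir0.
have [d /= d0 Hd] := (nbhs_ballP _ _).1 (open_nbhs_nbhs (conj I_open Ir0)).
pose a := r0 - d / 2; pose b := r0 + d / 2.
have abI r : a <= r <= b -> I r.
  move=> /andP[ar rb]; apply: Hd; rewrite /ball /= ltr_norml; rewrite /a /b in ar rb.
  by apply/andP; split; lra.
have hc r : I r -> {for r, continuous (fun r => (h r)^-1)}.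
  move=> Ir; apply: cvgV; first exact: (h_neq0 h_pos).
  by apply: differentiable_continuous; apply/derivable1_diffP; exact: (@h_smooth 0%N).
pose H (x : R) := (\int[lebesgue_measure]_(t in [set` `[a, x]]) (h t)^-1)%R.
exists [set` `]a, b[], H; split.
- exact: interval_open.
- move=> r; rewrite /= in_itv /= => /andP[/ltW ar /ltW rb]; apply: abI; exact/andP.
- by rewrite /= in_itv /= /a /b; apply/andP; split; lra.
move=> r; rewrite /= in_itv /= => /andP[ar rb].
have Ir : I r by apply: abI; rewrite !ltW.
have fi : lebesgue_measure.-integrable `[a, b] (EFin \o (fun t => (h t)^-1)).
  apply: continuous_compact_integrable; first exact: segment_compact.
  apply: continuous_in_subspaceT => x; rewrite inE /= in_itv /= => Hx.
  by apply: hc; exact: abI.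
have [D1 D2] := continuous_FTC1_closed rb fi ar (hc r Ir).
by apply: DeriveDef; [exact: D1|rewrite -derive1E; exact: D2].
Qed.

Definition radial_null (p : amb) (J : set R) (H : R -> R) (eps : R) : set amb :=
  [set y | [/\ M y, J (rc y) & tc y = tc p + eps * (H (rc y) - H (rc p))]].

Section Sheet.
Variables (p : amb) (J : set R) (H : R -> R) (eps : R).
Hypothesis Jo : open J.
Hypothesis JI : J `<=` I.
Hypothesis DH : forall r, J r -> is_derive r 1 H (h r)^-1.
Hypothesis eps1 : eps ^+ 2 = 1.
Local Notation L := (radial_null p J H eps).

Let eps0 : eps != 0.
Proof. by apply: contra_eq_neq eps1 => ->; rewrite expr0n /= eq_sym oner_eq0. Qed.

Definition sheet_fun (y : amb) : R := tc y + - (tc p + eps * (H (rc y) + - H (rc p))).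

Lemma smooth_H (q : amb) : J (rc q) -> smooth_at (fun y => H (rc y)) q.
Proof.
move=> Jq; apply: (@smooth_primitive _ _ J H (fun r => (h r)^-1)) => //.
  exact: smooth_rc_id.
apply: smooth_inv; last exact: (smooth_h I_open h_smooth (JI Jq)).
by apply: (h_neq0 h_pos); exact: JI.
Qed.

Lemma smooth_sheet (q : amb) : J (rc q) -> smooth_at sheet_fun q.
Proof.
move=> Jq; apply: smooth_add; first exact: smooth_tc_id.
apply: smooth_opp; apply: smooth_add; first exact: smooth_cst.
apply: smooth_mul; first exact: smooth_cst.
by apply: smooth_add; [exact: smooth_H|exact: smooth_cst].
Qed.

Lemma derive_sheet (q v : amb) : J (rc q) ->
  'D_v sheet_fun q = tc v - eps * rc v / h (rc q).
Proof.
move=> Jq; have HD := DH Jq.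
have E1 : 'D_v (fun z : amb => H (rc z)) q = (h (rc q))^-1 * rc v.
  rewrite (derive_phi v (@ex_derive _ _ _ _ _ _ _ HD) (smooth_diff (smooth_rc_id q))).
  by rewrite derive1E (@derive_val _ _ _ _ _ _ _ HD) derive_rc_id.
have D := is_derive_addf (smooth_is_derive v (smooth_tc_id q))
  (is_derive_oppf (is_derive_addf (smooth_is_derive v (smooth_cst (tc p) q))
   (is_derive_mulf (smooth_is_derive v (smooth_cst eps q))
    (is_derive_addf (smooth_is_derive v (smooth_H Jq)) (smooth_is_derive v (smooth_cst (- H (rc p)) q)))))).
rewrite (@derive_val _ _ _ _ _ _ _ D) !derive_cst E1 derive_tc_id.
by rewrite mul0r !add0r addr0; congr (_ - _); rewrite mulrA mulrAC.
Qed.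

Lemma sheet_sub : L `<=` M. Proof. by move=> y []. Qed.

Lemma near_sheet (q : amb) : J (rc q) -> \forall y \near q, M y -> (L y <-> sheet_fun y = 0).
Proof.
move=> Jq; have NJ : \forall y \near q, J (rc y).
  by apply: (smooth_cont (smooth_rc_id q)); apply: open_nbhs_nbhs.
apply: filterS NJ => y Jy My; rewrite /sheet_fun; split=> [[_ _ ->]|E]; first by rewrite subrr.
by split=> //; apply/eqP; rewrite -subr_eq0; apply/eqP.
Qed.

Lemma sheet_defining q : L q -> defining I L q sheet_fun.
Proof.
move=> [Mq Jq _]; split; [exact: smooth_sheet| |exact: near_sheet].
exists partial_t; first exact: dot0r.
by rewrite (derive_sheet _ Jq) /= mulr0 mul0r subr0 oner_neq0.
Qed.

Lemma sheet_hypersurface : hypersurface M L.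
Proof.
split; first exact: sheet_sub.
move=> q Lq; have [Sf [v vq Dv] Nf] := sheet_defining Lq.
exists sheet_fun; split=> //; exists v => //.
by apply/(tangent_spacetime I_open v (sheet_sub Lq)).
Qed.

Lemma tangent_sheet q v : L q ->
  tangent L q v <-> dot (xc q) (xc v) = 0 /\ tc v = eps * rc v / h (rc q).
Proof.
move=> Lq; have [Mq Jq _] := Lq.
have T := tangent_hyper I_open v sheet_sub Lq (sheet_defining Lq).
rewrite (derive_sheet _ Jq) in T; split.
  by move=> /T [-> /eqP]; rewrite subr_eq0 => /eqP.
by move=> [vq tv]; apply/T; rewrite tv subrr.
Qed.

Definition sheet_field (y : amb) : amb := mk (eps * h (rc y)) 0 1.

Lemma smooth_sheet_field (q : amb) : I (rc q) -> smooth_at sheet_field q.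
Proof.
move=> Iq; apply: smooth_mk; [|exact: smooth_cst|exact: smooth_cst].
by apply: smooth_mul; [exact: smooth_cst|exact: (smooth_h I_open h_smooth Iq)].
Qed.

Lemma sheet_field_tangent q : L q -> tangent L q (sheet_field q).
Proof.
move=> Lq; have [_ Jq _] := Lq; apply/(tangent_sheet _ Lq).
rewrite /sheet_field rc_mk xc_mk tc_mk dot0r mulrA -expr2 eps1 mul1r divff //.
exact: (h_neq0 h_pos (JI Jq)).
Qed.

Lemma sheet_field_null q w : L q -> tangent L q w -> g q (sheet_field q) w = 0.
Proof.
move=> Lq /(tangent_sheet _ Lq) [_ tw]; have [_ Jq _] := Lq.
have h0 := h_neq0 h_pos (JI Jq).
by rewrite metricE /sheet_field rc_mk xc_mk tc_mk dot0l tw; field.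
Qed.

Lemma sheet_field_neq0 q : sheet_field q != 0.
Proof. by apply/eqP => /(congr1 tc); rewrite tc_mk => /eqP; rewrite oner_eq0. Qed.

Lemma sheet_null_hypersurface : null_hypersurface M g L.
Proof.
split; first exact: sheet_hypersurface.
move=> q Lq; exists (sheet_field q); split; first exact: sheet_field_tangent.
  exact: sheet_field_neq0.
by move=> w; exact: sheet_field_null.
Qed.

Lemma sheet_null_field : null_field g L sheet_field.
Proof.
split=> [q [Mq Jq _]|q Lq].
  exists sheet_field; split; first by apply: smooth_sheet_field; exact: JI.
  exact: (@filterE _ (nbhs q)).
split; [exact: sheet_field_tangent|exact: sheet_field_neq0|].
exact: sheet_field_null (sheet_field_tangent Lq).
Qed.

(** A screen vector of the sheet is tangent to the sphere, along which the
    components of [sheet_field] are constant; what remains is the second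
    fundamental form of a round sphere. *)
Lemma sheet_umbilic nabla (lc : levi_civita M g nabla) :
  totally_umbilic M g nabla partial_t L.
Proof.
exists sheet_field; split; first exact: sheet_null_field.
pose rho (y : amb) := - (eps * h (rc y) * (rc y)^-1).
exists rho => [q [Mq Jq _]|q u v Lq Tu gu Tv gv].
  exists rho; split; last exact: (@filterE _ (nbhs q)).
  have Iq := JI Jq.
  apply: smooth_opp; apply: smooth_mul.
    by apply: smooth_mul; [exact: smooth_cst|exact: (smooth_h I_open h_smooth Iq)].
  by apply: smooth_inv; [apply: lt0r_neq0; exact: I_pos|exact: smooth_rc_id].
have [Mq Jq _] := Lq; have Iq := JI Jq.
have h0 := h_neq0 h_pos Iq.
have r0 : rc q != 0 by apply: lt0r_neq0; exact: I_pos.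
have tu : tc u = 0 by exact/(metric_dt0 h_pos _ Mq).
have tv : tc v = 0 by exact/(metric_dt0 h_pos _ Mq).
have rc0 z : tangent L q z -> tc z = 0 -> rc z = 0.
  move=> /(tangent_sheet _ Lq) [_ ->] /eqP.
  by rewrite mulf_eq0 invr_eq0 (negbTE h0) orbF mulf_eq0 (negbTE eps0) => /eqP.
have ru := rc0 u Tu tu; have rv := rc0 v Tv tv.
have Tx y : L y -> tangent L y (sheet_field y) by exact: sheet_field_tangent.
have SX := smooth_sheet_field Iq.
have NX : \forall y \near q, L y -> sheet_field y = sheet_field y by exact: (@filterE _ (nbhs q)).
rewrite (second_formE I_open h_smooth h_pos lc sheet_hypersurface Lq sheet_null_field.1 Tx SX NX Tu Tv tu tv).
have -> : 'D_u sheet_field q = mk 0 0 0.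
  have Sh := smooth_h I_open h_smooth Iq.
  have Sr := smooth_mul (smooth_cst eps q) Sh.
  rewrite (derive_mk u Sr (smooth_cst (0 : 'rV[R]_3) q) (smooth_cst (1 : R) q)) !derive_cst.
  rewrite (derive_mul u (smooth_diff (smooth_cst eps q)) (smooth_diff Sh)).
  by rewrite derive_cst (derive_h h_smooth u Iq) ru !mulr0 mul0r addr0.
rewrite !metricE !rc_mk !xc_mk !tc_mk ru rv tu tv !dot0l /rho.
by field; rewrite h0 r0.
Qed.

Lemma sheet_through nabla : levi_civita M g nabla -> M p -> J (rc p) ->
  umbilic_null_through I h nabla p L.
Proof.
move=> lc Mp Jp; split; [|exact: sheet_null_hypersurface|exact: sheet_umbilic].
by split=> //; rewrite subrr mulr0 addr0.
Qed.

End Sheet.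

(** The null field of the first sheet is not tangent to the second one. *)
Lemma sheets_differ p J H : open J -> J `<=` I -> M p -> J (rc p) ->
  (forall r, J r -> is_derive r 1 H (h r)^-1) ->
  ~ same_germ p (radial_null p J H 1) (radial_null p J H (- 1)).
Proof.
move=> Jo JI Mp Jp DH S.
have e1 : (1 : R) ^+ 2 = 1 by rewrite expr1n.
have e2 : (- 1 : R) ^+ 2 = 1 by rewrite sqrrN expr1n.
have Lp : radial_null p J H 1 p by split=> //; rewrite subrr mulr0 addr0.
have T := sheet_field_tangent Jo JI DH e1 Lp.
have Sf := smooth_sheet p (- 1) Jo JI DH Jp.
have N : \forall y \near p, radial_null p J H 1 y -> sheet_fun p H (- 1) y = 0.
  have NS := near_sheet p H (- 1) Jo Jp.
  rewrite /same_germ in S; apply: filterS2 S NS => y Sy Ny Ly.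
  by have [My _ _] := Ly; apply: (Ny My).1; apply/Sy.
have := T _ Sf N.
rewrite (derive_sheet p (- 1) Jo JI DH _ Jp) /sheet_field rc_mk tc_mk.
have h0 := h_neq0 h_pos (JI _ Jp).
have -> : 1 - -1 * (1 * h (rc p)) / h (rc p) = 2 by field.
by move=> /eqP; rewrite pnatr_eq0.
Qed.

End Existence.

Theorem theorem5p5 (R : realType) (I : set R) (h : R -> R)
    (nabla : @ambient R -> @ambient R -> (@ambient R -> @ambient R) ->
             @ambient R)
    (I_open : open I) (I_itv : is_interval I)
    (I_pos : I `<=` [set r | 0 < r])
    (h_smooth : forall (n : nat) (r : R), I r -> derivable (derive1n n h) r 1)
    (h_pos : forall r : R, I r -> 0 < h r)
    (h3 : forall J : set R, open J -> J `<=` I -> J !=set0 ->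
            exists2 r, J r & derive1n 3 h r != 0)
    (nabla_lc : levi_civita (spacetime I) (metric h) nabla)
    (p : @ambient R) (Mp : spacetime I p) :
  exists L1 L2 : set (@ambient R),
    [/\ umbilic_null_through I h nabla p L1,
        umbilic_null_through I h nabla p L2,
        ~ same_germ p L1 L2 &
        forall L : set (@ambient R), umbilic_null_through I h nabla p L ->
          same_germ p L L1 \/ same_germ p L L2].
Proof.
have [J [H [Jo JI Jp DH]]] := local_primitive I_open h_smooth h_pos Mp.1.
exists (radial_null I p J H 1), (radial_null I p J H (- 1)); split.
- by apply: sheet_through => //; rewrite expr1n.
- by apply: sheet_through => //; rewrite sqrrN expr1n.
- exact: sheets_differ.
move=> L [Lp HL [xi [Hxi [rho Srho Humb]]]].
have [eps [e2 Neps]] := radial_sign I_open I_pos h_smooth h_pos h3 nabla_lc HL Hxi Srho Humb Lp.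
have G := germ I_open I_pos h_smooth h_pos h3 nabla_lc HL Hxi Srho Humb Jo JI Jp DH Lp Neps.
have : (eps - 1) * (eps + 1) = 0 by rewrite -subr_sqr e2 expr1n subrr.
move=> /eqP; rewrite mulf_eq0 subr_eq0 addr_eq0 => /orP[] /eqP E; rewrite E in G.
  by left.
by right.
Qed.
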